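(* Let $L$ be slowly varying at infinity and let $\alpha\in\mathbb{R}$. Suppose that $f\in\mathcal{D}^{*\prime}$ is supported in $[0,\infty)$ and has quasiasymptotic behavior $$f(\lambda x)\sim c\,\lambda^{\alpha}L(\lambda)\,x^{\alpha}\quad\text{in }\mathcal{D}^{*\prime}(0,\infty)\text{ as }\lambda\to\infty.$$ (i) If $\alpha>-1$, then $f(\lambda x)\sim c\,\lambda^{\alpha}L(\lambda)\,x_{+}^{\alpha}$ in $\mathcal{D}^{*\prime}$ as $\lambda\to\infty$. (ii) If $\alpha<-1$ and $N\in\mathbb{N}$ is such that $-(N+1)<\alpha<-N$, then there exist constants $a_{0},\dots,a_{N-1}$ such that $$f(\lambda x)-\sum_{n=0}^{N-1}a_{n}\frac{\delta^{(n)}(x)}{\lambda^{n+1}}\sim c\,\lambda^{\alpha}L(\lambda)\,x_{+}^{\alpha}\quad\text{in }\mathcal{D}^{*\prime}\text{ as }\lambda\to\infty.$$ (iii) If $\alpha=-k\in\mathbb{Z}_{-}$, then there is a function $b$ satisfying, for each $a>0$, $$b(ax)=b(x)+c\,\frac{(-1)^{k-1}}{(k-1)!}L(x)\log a+o(L(x)),\qquad x\to\infty,$$ and constants $a_{0},\dots,a_{k-1}$ such that $$f(\lambda x)=c\,\frac{L(\lambda)}{\lambda^{k}}\operatorname{Pf}\!\left(\frac{H(x)}{x^{k}}\right)+\frac{b(\lambda)}{\lambda^{k}}\delta^{(k-1)}(x)+\sum_{j=0}^{k-1}a_{j}\frac{\delta^{(j)}(x)}{\lambda^{j+1}}+o\!\left(\frac{L(\lambda)}{\lambda^{k}}\right)$$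 in $\mathcal{D}^{*\prime}$ as $\lambda\to\infty$.
   Context: $\mathbb{N}=\{0,1,2,\dots\}$, $\mathbb{Z}_{-}=\{-1,-2,\dots\}$. Weight sequence: $(M_p)_{p\in\mathbb{N}}$ is a fixed sequence of positive numbers satisfying Komatsu's conditions (M.1) $M_p^2\le M_{p-1}M_{p+1}$ for $p\ge1$; (M.2) there are $A,H>0$ with $M_p\le AH^p\min_{0\le q\le p}M_qM_{p-q}$ for all $p$; (M.3) there is $A>0$ with $\sum_{q=p+1}^\infty M_{q-1}/M_q\le A\,pM_p/M_{p+1}$ for $p\ge1$. Spaces: the symbol $*$ denotes either $(M_p)$ (Beurling case) or $\{M_p\}$ (Roumieu case). For $\Omega\subseteq\mathbb{R}$ open, $\mathcal{E}^{(M_p)}(\Omega)$ (resp. $\mathcal{E}^{\{M_p\}}(\Omega)$) is the space of $\varphi\in C^\infty(\Omega)$ such that for every compact $K\subset\Omega$ and every $h>0$ (resp. some $h>0$) $\sup_{x\in K,p\in\mathbb{N}}|\varphi^{(p)}(x)|/(h^pM_p)<\infty$; $\mathcal{D}^*(\Omega)$ is the subspace of compactly supported elements, with its usual locally convex topology (inductive limit over compact $K$ of the spaces $\mathcal D^*_K$ of elements supported in $K$, where $\mathcal D^*_K$ is the projective limit as $h\to0^+$, resp. inductive limit as $h\to\infty$, of the Banach spaces with norms $\sup_{x\in K,p}|\varphi^{(p)}(x)|/(h^pM_p)$). $\mathcal{D}^{*\prime}(\Omega)$ is its dual (ultradistributions on $\Omega$), and $\mathcal{D}^*=\mathcal{D}^*(\mathbb{R})$,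 $\mathcal{D}^{*\prime}=\mathcal{D}^{*\prime}(\mathbb{R})$. Slow variation: a real-valued measurable $L$ is slowly varying at infinity if it is positive for large arguments and $L(ax)\sim L(x)$ as $x\to\infty$ for every $a>0$. Quasiasymptotics: $f(\lambda x)$ is defined by $\langle f(\lambda x),\phi(x)\rangle=\lambda^{-1}\langle f(x),\phi(x/\lambda)\rangle$. For $\Omega=\mathbb{R}$ or $\Omega=(0,\infty)$, a relation $f(\lambda x)\sim\lambda^\alpha L(\lambda)g(x)$ in $\mathcal{D}^{*\prime}(\Omega)$ as $\lambda\to\infty$ means $\lim_{\lambda\to\infty}\langle f(\lambda x)/(\lambda^\alpha L(\lambda)),\phi(x)\rangle=\langle g,\phi\rangle$ for all $\phi\in\mathcal{D}^*(\Omega)$; $g=0$ is allowed, in particular $c$ is an arbitrary constant, possibly $0$, and the same meaning (the quotient by $\lambda^\alpha L(\lambda)$ converges to $g$) applies when $f(\lambda x)$ is replaced by another $\lambda$-dependent ultradistribution. Likewise, asymptotic expansions with remainder $o(\cdot)$ in $\mathcal{D}^{*\prime}$ are understood after pairing with each fixed test function $\phi\in\mathcal{D}^*$. Distributions: $\delta$ is the Dirac delta, $H$ the Heaviside function. For $\alpha>-1$, $x_+^\alpha=x^\alpha H(x)$; for other $\alpha\notin\mathbb{Z}_-$, $x_+^\alpha=\frac{\Gamma(\alpha+1)}{\Gamma(\alpha+k+1)}\frac{d^k}{dx^k}x_+^{\alpha+k}$ for any $k\in\mathbb{N}$ with $\alpha+k>-1$. $\operatorname{Pf}(H(x)/x^k)$,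 $k\ge1$, is the Hadamard finite part regularization: $$\left\langle\operatorname{Pf}\frac{H(x)}{x^k},\phi\right\rangle=\int_0^1\frac{\phi(x)-\sum_{j=0}^{k-1}\phi^{(j)}(0)x^j/j!}{x^k}dx+\int_1^\infty\frac{\phi(x)}{x^k}dx-\sum_{j=0}^{k-2}\frac{\phi^{(j)}(0)}{j!\,(k-1-j)}.$$ *)

(* Defs.v *)
(* Written against mathcomp-analysis, with complex numbers from
   mathcomp-real-closed. Test functions, functionals and constants are
   complex-valued; L, alpha and the weight sequence are real. *)
From HB Require Import structures.
From mathcomp Require Import all_boot all_order all_algebra.
From mathcomp Require Import complex.
From mathcomp Require Import all_classical all_reals all_analysis.
From mathcomp Require Import measurable_realfun.

Set Implicit Arguments.
Unset Strict Implicit.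
Unset Printing Implicit Defensive.

Import Order.TTheory GRing.Theory Num.Theory.
Import numFieldNormedType.Exports.

Local Open Scope classical_set_scope.
Local Open Scope ring_scope.

Definition weight_sequence (R : realType) (M : nat -> R) : Prop :=
  [/\ forall p, 0 < M p,
      forall p, (1 <= p)%N -> M p ^+ 2 <= M p.-1 * M p.+1,
      exists A H : R, [/\ 0 < A, 0 < H &
        forall p q, (q <= p)%N -> M p <= A * H ^+ p * (M q * M (p - q)%N)] &
      exists2 A : R, 0 < A & forall p, (1 <= p)%N ->
        (\sum_(p.+1 <= q <oo) (M q.-1 / M q)%:E
          <= (A * p%:R * (M p / M p.+1))%:E)%E].

(* The domain type of a Lebesgue measurable function: the real line with the
   completed Borel sigma-algebra (measurableTypeR carries the Borel one). *)
Definition lebesgueType (R : realType) :=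
  g_sigma_algebraType (completed_algebra_gen (@lebesgue_measure R)).

(* L need only be measurable on a neighbourhood [A, +oo[ of infinity. *)
Definition slowly_varying (R : realType) (L : R -> R) : Prop :=
  [/\ exists A : R,
        @measurable_fun _ _ (lebesgueType R) (measurableTypeR R)
          `[A, +oo[ L,
      \forall x \near +oo, 0 < L x &
      forall a : R, 0 < a -> L (a * x) / L x @[x --> +oo] --> (1 : R)].

Definition cderivn (R : realType) (n : nat) (phi : R -> R[i]) (x : R) : R[i] :=
  (derive1n n (fun t => complex.Re (phi t)) x +i*
   derive1n n (fun t => complex.Im (phi t)) x)%C.

Definition smooth_on (R : realType) (Omega : set R) (phi : R -> R[i]) : Prop :=
  forall (n : nat) (x : R), Omega x ->
    derivable (derive1n n (fun t => complex.Re (phi t))) x 1 /\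
    derivable (derive1n n (fun t => complex.Im (phi t))) x 1.

Definition cintegral (R : realType) (D : set R) (phi : R -> R[i]) : R[i] :=
  (\int[lebesgue_measure]_(x in D) complex.Re (phi x) +i*
   \int[lebesgue_measure]_(x in D) complex.Im (phi x))%C.

Definition ultranorm (R : realType) (M : nat -> R) (K : set R) (h : R)
    (phi : R -> R[i]) : \bar R :=
  ereal_sup [set (ComplexField.Normc.normc (cderivn p phi x)
                   / (h ^+ p * M p))%:E | x in K & p in [set: nat]].

Inductive ultraclass := Beurling | Roumieu.

Definition ultradiff (R : realType) (s : ultraclass) (M : nat -> R)
    (Omega : set R) (phi : R -> R[i]) : Prop :=
  smooth_on Omega phi /\
  forall K : set R, compact K -> K `<=` Omega ->
    match s with
    | Beurling => forall h : R, 0 < h -> (ultranorm M K h phi < +oo)%E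
    | Roumieu => exists2 h : R, 0 < h & (ultranorm M K h phi < +oo)%E
    end.

Definition supp_in (R : realType) (K : set R) (phi : R -> R[i]) : Prop :=
  forall x, ~ K x -> phi x = 0.

(* Elements of D^*(Omega) are identified with their extensions by 0 to the
   whole line, so that D^*(Omega) is a subset of D^*(R) and an ultradistribution
   on R restricts to Omega without any change of notation. *)
Definition testfun (R : realType) (s : ultraclass) (M : nat -> R)
    (Omega : set R) (phi : R -> R[i]) : Prop :=
  ultradiff s M Omega phi /\
  exists K : set R, [/\ compact K, K `<=` Omega & supp_in K phi].

(* Only the values of a functional on test functions are meaningful. *)
Definition functional (R : realType) := (R -> R[i]) -> R[i].

Definition abs_convex (R : realType) (V : set (R -> R[i])) : Prop :=
  forall (a b : R[i]) (phi psi : R -> R[i]), `|a| + `|b| <= 1 ->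
    V phi -> V psi -> V (fun x => a * phi x + b * psi x).

(* For absolutely convex V: the trace of V on D^*_K is a neighbourhood of 0,
   for the projective limit as h -> 0 of the normed steps (Beurling) or for
   their locally convex inductive limit as h -> +oo (Roumieu). *)
Definition nbhs0_step (R : realType) (s : ultraclass) (M : nat -> R)
    (Omega K : set R) (V : set (R -> R[i])) : Prop :=
  let contains_ball h := exists2 e : R, 0 < e &
    forall phi, testfun s M Omega phi -> supp_in K phi ->
      (ultranorm M K h phi < e%:E)%E -> V phi in
  match s with
  | Beurling => exists2 h : R, 0 < h & contains_ball h
  | Roumieu => forall h : R, 0 < h -> contains_ball h
  end.

(* The basic neighbourhoods of 0 of the locally convex inductive limit
   D^*(Omega) of the spaces D^*_K, K compact in Omega. *)
Definition nbhs0_testfun (R : realType) (s : ultraclass) (M : nat -> R)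
    (Omega : set R) (V : set (R -> R[i])) : Prop :=
  abs_convex V /\
  forall K : set R, compact K -> K `<=` Omega -> nbhs0_step s M Omega K V.

Definition ultradistribution (R : realType) (s : ultraclass) (M : nat -> R)
    (Omega : set R) (f : functional R) : Prop :=
  (forall (a : R[i]) (phi psi : R -> R[i]),
     testfun s M Omega phi -> testfun s M Omega psi ->
     f (fun x => a * phi x + psi x) = a * f phi + f psi) /\
  (forall e : R, 0 < e ->
     exists2 V, nbhs0_testfun s M Omega V &
       forall phi, testfun s M Omega phi -> V phi ->
         ComplexField.Normc.normc (f phi) < e).

(* For closed F: the restriction of f to the complement of F is zero. *)
Definition supported_in (R : realType) (s : ultraclass) (M : nat -> R)
    (F : set R) (f : functional R) : Prop :=
  forall phi, testfun s M (~` F) phi -> f phi = 0.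

(* f(lambda x) *)
Definition dilate (R : realType) (f : functional R) (lambda : R) :
    functional R :=
  fun phi => (lambda^-1)%:C%C * f (fun x => phi (x / lambda)).

(* F_lambda ~ lambda^alpha L(lambda) g in D^{*'}(Omega), lambda -> +oo;
   g = 0 is allowed. *)
Definition quasiasymptotic (R : realType) (s : ultraclass) (M : nat -> R)
    (Omega : set R) (F : R -> functional R) (alpha : R) (L : R -> R)
    (g : functional R) : Prop :=
  forall phi, testfun s M Omega phi ->
    F lambda phi / (lambda `^ alpha * L lambda)%:C%C @[lambda --> +oo]
      --> (g phi : R[i]^o).

(* F_lambda = o(r(lambda)) in D^{*'}(R), lambda -> +oo *)
Definition littleo_dual (R : realType) (s : ultraclass) (M : nat -> R)
    (F : R -> functional R) (r : R -> R) : Prop :=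
  forall phi, testfun s M setT phi ->
    F lambda phi / (r lambda)%:C%C @[lambda --> +oo] --> (0 : R[i]^o).

Definition scaled (R : realType) (c : R[i]) (g : functional R) : functional R :=
  fun phi => c * g phi.

(* Integration against x^beta over (0, +oo): this is x^beta as an element of
   D^{*'}(0, +oo), and x_+^beta on the whole line when beta > -1. *)
Definition pos_power (R : realType) (beta : R) : functional R :=
  fun phi => cintegral `]0, +oo[ (fun x => (x `^ beta)%:C%C * phi x).

Definition Gamma_integral (R : realType) (x : R) : R :=
  \int[lebesgue_measure]_(t in `]0, +oo[) (t `^ (x - 1) * expR (- t)).

(* For x <= 0 not an integer,
   Gamma(x) = Gamma(x + n) / (x (x + 1) ... (x + n - 1)), where n is the least
   natural number with x + n > 0. *)
Definition Gamma (R : realType) (x : R) : R :=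
  if 0 < x then Gamma_integral x
  else let n := (Num.truncn (- x)).+1 in
    Gamma_integral (x + n%:R) / \prod_(i < n) (x + i%:R).

(* The k-th distributional derivative of g. *)
Definition ddist (R : realType) (k : nat) (g : functional R) : functional R :=
  fun phi => (-1) ^+ k * g (cderivn k phi).

(* x_+^alpha for alpha not a negative integer. For alpha < -1,
   k = truncn (- alpha) is the least natural number with alpha + k > -1;
   the result does not depend on the choice of such a k. *)
Definition xplus (R : realType) (alpha : R) : functional R :=
  if -1 < alpha then pos_power alpha
  else let k := Num.truncn (- alpha) in
    scaled (Gamma (alpha + 1) / Gamma (alpha + k%:R + 1))%:C%C
      (ddist k (pos_power (alpha + k%:R))).

Definition delta (R : realType) : functional R := fun phi => phi 0.

(* Pf (H(x) / x^k), k >= 1 *)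
Definition Pf_Hx (R : realType) (k : nat) : functional R := fun phi =>
  cintegral `]0, 1[ (fun x =>
     (phi x - \sum_(j < k) cderivn j phi 0 * (x ^+ j / j`!%:R)%:C%C)
       / (x ^+ k)%:C%C)
  + cintegral `]1, +oo[ (fun x => phi x / (x ^+ k)%:C%C)
  - \sum_(j < k.-1) cderivn j phi 0 / (j`!%:R * (k - 1 - j)%N%:R).

(* Main.v *)
(* Let gamma = alpha + 1 and G(l) = l^gamma L(l). Subtracting from a test function
   its Taylor polynomial of order m > -gamma, multiplied by a cutoff chi equal to 1
   near 0, leaves a function rho vanishing to order m at 0. The dyadic pieces of rho
   are, up to factors 2^(-jm), dilates of a bounded sequence of test functions
   supported away from 0; on such a sequence f(u(./l)) = O(G(l)) uniformly, by
   Banach-Steinhaus, and regular variation of G makes the sum over the pieces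
   geometric. Hence f(rho(./l)) / G(l) tends to c times the absolutely convergent
   integral of x^alpha rho(x).
   There remain the moments g_n(l) = l^n f((x^n chi)(./l)). Since
   x^n (chi(x/a) - chi(x)) vanishes near 0, g_n(a l) - g_n(l) is asymptotic to a
   constant times l^n G(l). If gamma + n < 0, this is summable along l, 2l, 4l, ...,
   so that g_n tends to a constant, which gives the coefficient of delta^(n). If
   gamma + n = 0, the constant is c log a, and g_n is the function b up to
   normalization and a multiple of L. Integration by parts identifies the sum of the
   limits with x_+^alpha, respectively Pf(H(x)/x^k).
   Cutoffs come from the Denjoy-Carleman construction, iterated convolution with
   normalized indicators of intervals of summable lengths. *)

Require Import Defs.
From HB Require Import structures.
From mathcomp Require Import all_boot all_order all_algebra.
From mathcomp Require Import complex.
From mathcomp Require Import all_classical all_reals all_analysis.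
From mathcomp Require Import measurable_realfun.
From mathcomp Require Import ring lra.

Set Implicit Arguments.
Unset Strict Implicit.
Unset Printing Implicit Defensive.

Import Order.TTheory GRing.Theory Num.Theory.
Import numFieldNormedType.Exports.

Local Open Scope classical_set_scope.
Local Open Scope ring_scope.

(** * Iterated derivatives *)

(** Continuity of [f] enters through one consequence: its values on a family bounded in one step are
    bounded. Countable combinations of such a family with weights 3^-k are again test functions with
    the same kind of bounds, so Banach-Steinhaus turns into a gliding hump on a double sequence of
    reals, identical for the Beurling and the Roumieu class. The dyadic sum near 0 cannot be carried
    on forever: it stops where 2^n is comparable to l. There [f] is tested at unit scale, where only
    boundedness is available, and a term O(l^-m) remains which has to be o(G(l)). As [L] is merely
    measurable, this requires a lower bound for [L] on some [X, 2X] with X as large as desired,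
    found by comparing measures of two sets and then propagated by doubling. The analysis is done
    for real test functions and real-valued functionals: the real and imaginary parts of [f] on real
    functions inherit the hypotheses with the constants Re c and Im c, and the complex statement is
    recombined at the end. *)

Section smooth.
Context {R : realType}.
Implicit Types (u v : R -> R) (x t : R).

Lemma deriv_add u v x a b : is_derive x 1 u a -> is_derive x 1 v b ->
  is_derive x 1 (fun y => u y + v y) (a + b).
Proof. exact: is_deriveD. Qed.

Lemma deriv_mul u v x a b : is_derive x 1 u a -> is_derive x 1 v b ->
  is_derive x 1 (fun y => u y * v y) (a * v x + u x * b).
Proof.
move=> du dv; apply: is_derive_eq (is_deriveM du dv) _.
by rewrite /GRing.scale /= addrC [v x * a]mulrC.
Qed.

Lemma deriv_scale k u x a : is_derive x 1 u a ->
  is_derive x 1 (fun y => k * u y) (k * a).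
Proof. exact: is_deriveZ. Qed.

Lemma deriv_comp u v x a b : is_derive (v x) 1 u a -> is_derive x 1 v b ->
  is_derive x 1 (fun y => u (v y)) (a * b).
Proof. exact: is_derive1_comp. Qed.

Lemma deriv_exprn n x :
  is_derive x 1 (fun y => y ^+ n) (n%:R * x ^+ n.-1).
Proof.
have := @is_deriveX _ _ (@id R) n x 1 1 (is_derive_id x 1).
by rewrite /GRing.scale /= mulr1; congr is_derive; apply/funext => y; rewrite fctE.
Qed.

Definition smooth u := forall n x, derivable (derive1n n u) x 1.

Lemma derive1nSr n u : derive1n n.+1 u = derive1n n (derive1 u).
Proof. by rewrite /derive1n iterSr. Qed.

Lemma smooth_is_derive u : smooth u ->
  forall n x, is_derive x 1 (derive1n n u) (derive1n n.+1 u x).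
Proof.
move=> su n x; rewrite derive1nS derive1E.
by apply/derivableP; apply: su.
Qed.

Lemma smooth_derive u : smooth u -> smooth (derive1 u).
Proof. by move=> su n x; rewrite -derive1nSr. Qed.

Lemma smooth_derive1n n u : smooth u -> smooth (derive1n n u).
Proof.
elim: n => [su|n IH su]; first exact: su.
rewrite derive1nS; apply: smooth_derive; exact: IH.
Qed.

Lemma derive1nD n m u : derive1n n (derive1n m u) = derive1n (n + m) u.
Proof. by rewrite /derive1n iterD. Qed.

Lemma smooth_continuous u : smooth u -> continuous u.
Proof.
move=> su x; apply: differentiable_continuous.
by apply/derivable1_diffP; apply: (su 0%N).
Qed.

(** Iterated derivatives are computed throughout by exhibiting the whole sequence at once; its first
    term is then smooth and its derivatives are known simultaneously. *)
Lemma jetE (d : nat -> R -> R) :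
  (forall p x, is_derive x 1 (d p) (d p.+1 x)) ->
  forall p, derive1n p (d 0%N) = d p.
Proof.
move=> dd; elim=> // p IH; rewrite derive1nS IH.
by apply/funext => x; rewrite derive1E derive_val.
Qed.

Lemma jet_smooth (d : nat -> R -> R) :
  (forall p x, is_derive x 1 (d p) (d p.+1 x)) -> smooth (d 0%N).
Proof. by move=> dd n x; rewrite (jetE dd); have [] := dd n x. Qed.

Lemma derive1n_lin a b u v n : smooth u -> smooth v ->
  derive1n n (fun x => a * u x + b * v x) =
  (fun x => a * derive1n n u x + b * derive1n n v x).
Proof.
move=> su sv.
apply: (@jetE (fun p x => a * derive1n p u x + b * derive1n p v x)) => p x.
have := smooth_is_derive su p x; have := smooth_is_derive sv p x => dv du.
exact: deriv_add (deriv_scale a du) (deriv_scale b dv).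
Qed.

Lemma smooth_lin a b u v : smooth u -> smooth v ->
  smooth (fun x => a * u x + b * v x).
Proof.
move=> su sv.
apply: (@jet_smooth (fun p x => a * derive1n p u x + b * derive1n p v x)) => p x.
have := smooth_is_derive su p x; have := smooth_is_derive sv p x => dv du.
exact: deriv_add (deriv_scale a du) (deriv_scale b dv).
Qed.

Lemma dilate_jet t u : smooth u -> forall p x,
  is_derive x 1 (fun x => t ^+ p * derive1n p u (t * x))
                (t ^+ p.+1 * derive1n p.+1 u (t * x)).
Proof.
move=> su p x.
have du := smooth_is_derive su p (t * x).
have dt : is_derive x 1 (fun y : R => t * y) (t * 1).
  exact: deriv_scale (is_derive_id x 1).
apply: is_derive_eq (deriv_scale (t ^+ p) (deriv_comp du dt)) _.
by rewrite mulr1 exprSr -mulrA [t * _ in RHS]mulrC.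
Qed.

Lemma derive1n_dilate t u n : smooth u ->
  derive1n n (fun x => u (t * x)) = (fun x => t ^+ n * derive1n n u (t * x)).
Proof.
move=> su; rewrite -(jetE (dilate_jet t su)); congr derive1n.
by apply/funext => x; rewrite expr0 mul1r.
Qed.

Lemma smooth_dilate t u : smooth u -> smooth (fun x => u (t * x)).
Proof.
move=> su; have := jet_smooth (dilate_jet t su).
by congr smooth; apply/funext => x; rewrite expr0 mul1r.
Qed.

(** Leibniz rule as an unfolded binary recursion: each differentiation falls on [u] or on [v].
    Avoiding binomial coefficients makes the bound by (h + k)^p a plain induction. *)
Fixpoint prod_jet u v p i j x : R :=
  if p is p'.+1 then prod_jet u v p' i.+1 j x + prod_jet u v p' i j.+1 x
  else derive1n i u x * derive1n j v x.

Lemma prod_jetP u v : smooth u -> smooth v -> forall p i j x,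
  is_derive x 1 (prod_jet u v p i j) (prod_jet u v p.+1 i j x).
Proof.
move=> su sv; elim=> [|p IH] i j x /=; last exact: deriv_add (IH _ _ _) (IH _ _ _).
exact: deriv_mul (smooth_is_derive su i x) (smooth_is_derive sv j x).
Qed.

Lemma derive1nM u v n : smooth u -> smooth v ->
  derive1n n (fun x => u x * v x) = prod_jet u v n 0 0.
Proof. by move=> su sv; rewrite -(jetE (fun p => prod_jetP su sv p 0%N 0%N)). Qed.

Lemma smoothM u v : smooth u -> smooth v -> smooth (fun x => u x * v x).
Proof. by move=> su sv; exact: (jet_smooth (fun p => prod_jetP su sv p 0%N 0%N)). Qed.

Lemma exprn_jet n p x :
  is_derive x 1 (fun y : R => (n ^_ p)%:R * y ^+ (n - p))
                ((n ^_ p.+1)%:R * x ^+ (n - p.+1)).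
Proof.
apply: is_derive_eq (deriv_scale _ (deriv_exprn _ x)) _.
by rewrite ffactnSr natrM -mulrA subnS.
Qed.

Lemma derive1n_exprn n p :
  derive1n p (fun x : R => x ^+ n) = (fun x => (n ^_ p)%:R * x ^+ (n - p)).
Proof.
rewrite -(jetE (exprn_jet n)); congr derive1n.
by apply/funext => x; rewrite ffactn0 mul1r subn0.
Qed.

Lemma smooth_exprn n : smooth (fun x : R => x ^+ n).
Proof.
have := jet_smooth (exprn_jet n).
by congr smooth; apply/funext => x; rewrite ffactn0 mul1r subn0.
Qed.

Lemma derive1n_cst (k : R) n : derive1n n (fun=> k : R) = (fun=> if n == 0%N then k else 0).
Proof.
apply: (@jetE (fun n (x : R) => if n == 0%N then k else 0)) => -[|p] x /=; exact: is_derive_cst.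
Qed.

Lemma smooth_cst (k : R) : smooth (fun=> k).
Proof.
apply: (@jet_smooth (fun n (x : R) => if n == 0%N then k else 0)) => -[|p] x /=; exact: is_derive_cst.
Qed.

Lemma derive1n_near u v x n : (\near x, u x = v x) ->
  derive1n n u x = derive1n n v x.
Proof.
move=> uv; suff : \near x, derive1n n u x = derive1n n v x by exact: nbhs_singleton.
elim: n => [//|n IH]; rewrite !derive1nS.
rewrite -near_nbhs in IH.
have := near_join IH; apply: filterS => y.
by rewrite !derive1E; exact: near_eq_derive.
Qed.

Lemma smooth_local u :
  (forall x, exists2 w, smooth w & \near x, u x = w x) -> smooth u.
Proof.
move=> H n x; have [w sw uw] := H x.
suff: \near x, derive1n n w x = derive1n n u x.
  by move/near_eq_derivable; apply; exact: sw.
have := near_join uw; apply: filterS => y yuw.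
by apply/esym/derive1n_near.
Qed.

End smooth.

(** * Bounded families of test functions *)

Section weights.
Context {R : realType} (M : nat -> R).
Hypothesis hM : weight_sequence M.

Lemma weight_gt0 p : 0 < M p.
Proof. by case: hM. Qed.

Lemma weight_ratio_homo p q : (p <= q)%N -> M p.+1 / M p <= M q.+1 / M q.
Proof.
apply: (@homo_leq _ (fun p => M p.+1 / M p) (fun x y => x <= y)) => //.
  exact: le_trans.
move=> n; case: hM => Mpos Mconv _ _.
rewrite ler_pdivrMr // mulrAC ler_pdivlMr // -expr2 mulrC.
exact: (Mconv n.+1).
Qed.

(** By (M.1) the ratios [M p.+1 / M p] are nondecreasing, so each increment of [q] costs no more on
    the left than on the right. This is what makes products stay in the class. *)
Lemma weight_mulD q r : M q * M r <= M 0%N * M (q + r)%N.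
Proof.
elim: q => [//|q IH].
have M0 := weight_gt0; have rat := weight_ratio_homo (leq_addr r q).
rewrite addSn.
have -> : M q.+1 * M r = M q.+1 / M q * (M q * M r) by field; rewrite gt_eqF.
have -> : M 0%N * M (q + r).+1 = M (q + r).+1 / M (q + r) * (M 0%N * M (q + r)).
  by field; rewrite gt_eqF.
by apply: ler_pM => //; rewrite ?divr_ge0 ?mulr_ge0 ?ltW.
Qed.

End weights.

Section forh.
Context {R : realType} (s : ultraclass).
Implicit Types (P Q S : R -> Prop).

(** The only place where the two classes differ, the quantifier on h. The closure lemmas below allow
    a single proof for both. *)
Definition forh P : Prop :=
  match s with
  | Beurling => forall h, 0 < h -> P h
  | Roumieu => exists2 h, 0 < h & P h
  end.

Lemma forh_scale k P S : 0 < k ->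
  (forall h, 0 < h -> P h -> S (k * h)) -> forh P -> forh S.
Proof.
rewrite /forh; case: s => k0 H; last first.
  by case=> h h0 Ph; exists (k * h); [exact: mulr_gt0|exact: H].
move=> HP h h0; have hk : 0 < h / k by exact: divr_gt0.
by have := H _ hk (HP _ hk); rewrite mulrCA divff ?mulr1 // gt_eqF.
Qed.

Lemma forh_mono P S : (forall h, 0 < h -> P h -> S h) -> forh P -> forh S.
Proof. by move=> H; apply: (@forh_scale 1) => // h h0 /(H h h0); rewrite mul1r. Qed.

Lemma forh_all P : (forall h, 0 < h -> P h) -> forh P.
Proof. by rewrite /forh; case: s => // H; exists 1 => //; exact: H. Qed.

Lemma forh_comb P Q S :
  (forall h k, 0 < h -> 0 < k -> P h -> Q k -> S (h + k)) ->
  forh P -> forh Q -> forh S.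
Proof.
rewrite /forh; case: s => H; last first.
  by move=> [h h0 Ph] [k k0 Qk]; exists (h + k); [exact: addr_gt0|exact: H].
(* Beurling case: the prescribed h is shared equally between the two hypotheses. *)
move=> HP HQ h h0; rewrite (splitr h).
by apply: H; rewrite ?divr_gt0 //; [apply: HP|apply: HQ]; rewrite divr_gt0.
Qed.

End forh.

Section families.
Context {R : realType} (M : nat -> R) (s : ultraclass).
Hypothesis hM : weight_sequence M.
Implicit Types (r t a b k h T A x C E : R) (u v : R -> R) (n m p : nat).

Definition bfam (I : Type) (u : I -> R -> R) (D : set R) : Prop :=
  forh s (fun h => exists2 C, 0 <= C &
    forall i p x, D x -> `|derive1n p (u i) x| <= C * (h ^+ p * M p)).

(* Families bounded in one step of D^*(R): in the Roumieu case h is common to the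
   whole family. *)
Definition tfam (I : Type) (u : I -> R -> R) : Prop :=
  [/\ forall i, smooth (u i),
      exists2 r, 0 < r & forall i x, r < `|x| -> u i x = 0 &
      bfam u setT].

(** Families bounded on every ball but without common compact support; they serve as multipliers,
    for instance powers of x. *)
Definition lfam (I : Type) (u : I -> R -> R) : Prop :=
  (forall i, smooth (u i)) /\ forall r, bfam u [set x | `|x| <= r].

Definition tf (u : R -> R) : Prop := tfam (fun _ : unit => u).
Definition lf (u : R -> R) : Prop := lfam (fun _ : unit => u).

Let M0 := weight_gt0 hM.
Let hMp h p : 0 < h -> 0 <= h ^+ p * M p.
Proof. by move=> h0; rewrite mulr_ge0 ?exprn_ge0 ?ltW. Qed.

Lemma bfam_reindex (I J : Type) (g : J -> I) (u : I -> R -> R) D :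
  bfam u D -> bfam (u \o g) D.
Proof.
apply: forh_mono => h h0 [C C0 HC]; exists C => // i p x; exact: HC.
Qed.

Lemma tfam_reindex (I J : Type) (g : J -> I) (u : I -> R -> R) :
  tfam u -> tfam (u \o g).
Proof.
case=> su [r r0 ur] bu; split; [by move=> i; exact: su| |exact: bfam_reindex].
by exists r => // i x; exact: ur.
Qed.

Lemma tf_tfam (I : Type) u : tf u -> tfam (fun _ : I => u).
Proof. by move=> tu; exact: (tfam_reindex (fun _ : I => tt) tu). Qed.

Lemma tfam_tf (I : Type) (u : I -> R -> R) i : tfam u -> tf (u i).
Proof. by move=> tu; exact: (tfam_reindex (fun _ : unit => i) tu). Qed.

Lemma bfam_subset (I : Type) (u : I -> R -> R) (D E : set R) : D `<=` E -> bfam u E -> bfam u D.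
Proof.
move=> DE; apply: forh_mono => h h0 [C C0 HC]; exists C => // i p x /DE; exact: HC.
Qed.

Lemma tfam_lfam (I : Type) (u : I -> R -> R) : tfam u -> lfam u.
Proof. by case=> su _ bu; split => // r; exact: bfam_subset bu. Qed.

Lemma tf_smooth u : tf u -> smooth u.
Proof. by case=> su _ _; exact: (su tt). Qed.

Lemma tf_supp u : tf u -> exists2 r, 0 < r & forall x, r < `|x| -> u x = 0.
Proof. by case=> _ [r r0 ur] _; exists r => // x; exact: (ur tt). Qed.

Lemma bfam_bound (I : Type) (u : I -> R -> R) D p : bfam u D ->
  exists2 C, 0 <= C & forall i x, D x -> `|derive1n p (u i) x| <= C.
Proof.
suff: forh s (fun h => exists2 C, 0 <= C &
    forall i p x, D x -> `|derive1n p (u i) x| <= C * (h ^+ p * M p)) ->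
   exists h C : R, [/\ 0 < h, 0 <= C & forall i p x, D x -> `|derive1n p (u i) x| <= C * (h ^+ p * M p)].
  move=> H /H[h [C [h0 C0 HC]]]; exists (C * (h ^+ p * M p)); first exact: mulr_ge0 (hMp _ _).
  by move=> i x; exact: HC.
rewrite /forh; case: s => [/(_ 1 ltr01)[C C0 HC]|[h h0 [C C0 HC]]].
  by exists 1, C.
by exists h, C.
Qed.

Lemma bfam_lin (I : Type) (a b : I -> R) (u v : I -> R -> R) A D :
  (forall i, `|a i| <= A) -> (forall i, `|b i| <= A) ->
  (forall i, smooth (u i)) -> (forall i, smooth (v i)) ->
  bfam u D -> bfam v D -> bfam (fun i x => a i * u i x + b i * v i x) D.
Proof.
move=> aA bA su sv; apply: forh_comb => h k h0 k0 [C C0 HC] [E E0 HE].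
(* The bound [A] is known to be nonnegative only if the index set is inhabited; over an empty one
   any constant will do. *)
have [A0|nI] : 0 <= A \/ (I -> False).
  have [i|nI] := pselect (exists i : I, True); last by right => i; apply: nI; exists i.
  by left; case: i => i _; exact: le_trans (aA i).
  exists (A * (C + E)); first by rewrite mulr_ge0 ?addr_ge0.
  move=> i p x Dx; rewrite derive1n_lin //.
  apply: le_trans (ler_normD _ _) _; rewrite !normrM mulrDr mulrDl.
  have hk : h ^+ p * M p <= (h + k) ^+ p * M p.
    by rewrite ler_pM2r // lerXn2r ?nnegrE ?ltW ?addr_gt0 // ltrDl.
  have kh : k ^+ p * M p <= (h + k) ^+ p * M p.
    by rewrite ler_pM2r // lerXn2r ?nnegrE ?ltW ?addr_gt0 // ltrDr.
  apply: lerD; rewrite -mulrA; apply: ler_pM => //.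
    by apply: le_trans (HC _ _ _ Dx) _; rewrite ler_wpM2l.
  by apply: le_trans (HE _ _ _ Dx) _; rewrite ler_wpM2l.
by exists 0 => // i; have := nI i.
Qed.

(** Each of the two branches raises [i] or [j] by one, hence contributes one factor h or k; their
    sum is the extra factor h + k. The base case is [weight_mulD]. *)
Lemma prod_jet_bound (u v : R -> R) (h k C E x : R) : 0 < h -> 0 < k ->
  0 <= C -> 0 <= E ->
  (forall p, `|derive1n p u x| <= C * (h ^+ p * M p)) ->
  (forall p, `|derive1n p v x| <= E * (k ^+ p * M p)) ->
  forall p i j, `|prod_jet u v p i j x| <=
    C * E * h ^+ i * k ^+ j * (h + k) ^+ p * (M 0%N * M (p + i + j)%N).
Proof.
move=> h0 k0 C0 E0 HC HE; elim=> [|p IH] i j /=.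
  rewrite normrM expr0 mulr1.
  apply: le_trans (ler_pM _ _ (HC i) (HE j)) _ => //.
  rewrite [leLHS](_ : _ = C * E * h ^+ i * k ^+ j * (M i * M j)); last by ring.
  rewrite ler_wpM2l ?weight_mulD //.
  by rewrite !mulr_ge0 ?exprn_ge0 // ltW.
apply: le_trans (ler_normD _ _) _.
apply: le_trans (lerD (IH _ _) (IH _ _)) _.
rewrite !addnS !addSn !exprS le_eqVlt; apply/orP; left; apply/eqP; ring.
Qed.

Lemma bfamM (I : Type) (u v : I -> R -> R) D :
  (forall i, smooth (u i)) -> (forall i, smooth (v i)) ->
  bfam u D -> bfam v D -> bfam (fun i x => u i x * v i x) D.
Proof.
move=> su sv; apply: forh_comb => h k h0 k0 [C C0 HC] [E E0 HE].
exists (C * E * M 0%N); first by rewrite !mulr_ge0 // ltW.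
move=> i p x Dx; rewrite derive1nM //.
have := @prod_jet_bound (u i) (v i) h k C E x h0 k0 C0 E0 
  (fun p => HC i p x Dx) (fun p => HE i p x Dx) p 0%N 0%N.
by rewrite !expr0 !addn0 => /le_trans; apply; rewrite !mulr1 le_eqVlt; apply/orP; left; apply/eqP; ring.
Qed.

Lemma derive1n_out (u : R -> R) r p : (forall x, r < `|x| -> u x = 0) ->
  forall x, r < `|x| -> derive1n p u x = 0.
Proof.
move=> ur x rx; rewrite (@derive1n_near _ u (fun=> 0)).
  by rewrite derive1n_cst; case: p.
have : \forall y \near x, r < `|y|.
  exact: cvgr_gt (cvg_norm (@cvg_id _ (nbhs x))) _ rx.
by apply: filterS => y; exact: ur.
Qed.

Lemma tfam_lin (I : Type) (a b : I -> R) (u v : I -> R -> R) A :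
  (forall i, `|a i| <= A) -> (forall i, `|b i| <= A) ->
  tfam u -> tfam v -> tfam (fun i x => a i * u i x + b i * v i x).
Proof.
move=> aA bA [su [r r0 ur] bu] [sv [r' r'0 vr] bv]; split.
- by move=> i; exact: smooth_lin.
- exists (r + r'); first exact: addr_gt0.
  by move=> i x rx; rewrite ur ?vr ?mulr0 ?addr0 //; lra.
- exact: bfam_lin aA bA _ _ _ _.
Qed.

(** The multiplier has to be controlled only on a ball containing all supports; outside it all
    derivatives of the product vanish. *)
Lemma tfamM (I : Type) (u v : I -> R -> R) :
  tfam u -> lfam v -> tfam (fun i x => u i x * v i x).
Proof.
move=> [su [r r0 ur] bu] [sv bv]; split.
- by move=> i; exact: smoothM.
- by exists r => // i x rx; rewrite ur ?mul0r.
have := bfamM su sv (bfam_subset (@subsetT _ _) bu) (bv r).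
apply: forh_mono => h h0 [C C0 HC]; exists C => // i p x _.
have [/(HC i p x)//|rx] := leP `|x| r.
rewrite (@derive1n_out _ r) ?normr0 ?mulr_ge0 ?exprn_ge0 // ?ltW //.
by move=> y ry; rewrite ur ?mul0r.
Qed.

Lemma tf_lin a b u v : tf u -> tf v -> tf (fun x => a * u x + b * v x).
Proof.
by move=> tu tv; apply: (@tfam_lin _ (fun=> a) (fun=> b) _ _ (`|a| + `|b|)) => //= _; rewrite ?lerDl ?lerDr.
Qed.

Lemma tfM u v : tf u -> lf v -> tf (fun x => u x * v x).
Proof. exact: tfamM. Qed.

Lemma lf_exprn n : lf (fun x => x ^+ n).
Proof.
split => [_|r]; first exact: smooth_exprn.
apply: forh_all => h h0.
pose B := \sum_(p < n.+1) ((n ^_ p)%:R * `|r| ^+ (n - p)) / (h ^+ p * M p).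
have term0 (p : nat) : 0 <= ((n ^_ p)%:R * `|r| ^+ (n - p)) / (h ^+ p * M p).
  by rewrite divr_ge0 ?hMp // mulr_ge0 ?exprn_ge0.
have B0 : 0 <= B by apply: sumr_ge0.
exists B => //.
move=> _ p x /= xr; rewrite derive1n_exprn.
have [np|pn] := ltnP n p.
  by rewrite ffact_small // mul0r normr0 mulr_ge0 ?hMp.
rewrite -ler_pdivrMr ?mulr_gt0 ?exprn_gt0 //.
rewrite /B (bigD1 (Ordinal (pn : (p < n.+1)%N))) //=.
rewrite ler_wpDr ?sumr_ge0 // ler_wpM2r ?invr_ge0 ?hMp //.
rewrite normrM ger0_norm ?ler0n // ler_wpM2l ?ler0n // normrX lerXn2r ?nnegrE //.
exact: le_trans (ler_norm _).
Qed.

(** The lower bound on the factors keeps the supports in a common ball; the upper bound multiplies h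
    by a fixed constant, which [forh_scale] absorbs. *)
Lemma tfam_dilate (I : Type) (t : I -> R) (u : I -> R -> R) a T : 0 < a ->
  (forall i, a <= t i <= T) -> tfam u -> tfam (fun i x => u i (t i * x)).
Proof.
move=> a0 taT [su [r r0 ur] bu]; split => [i||]; first exact: smooth_dilate.
  exists (r / a); first exact: divr_gt0.
  move=> i x; rewrite ltr_pdivrMr // => rx; apply: ur.
  have /andP[ta _] := taT i.
  apply: lt_le_trans rx _; rewrite normrM mulrC ler_wpM2r //.
  exact: le_trans (ler_norm _).
pose T' := `|T| + 1.
have T0 : 0 < T' by rewrite ltr_wpDl.
apply: (forh_scale T0 _ bu) => h h0 [C C0 HC]; exists C => // i p x /= _.
rewrite derive1n_dilate // normrM exprMn.
have tT' : `|t i| <= T'.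
  have /andP[ta tT] := taT i.
  rewrite ger0_norm; last by apply: le_trans ta; exact: ltW.
  by apply: le_trans tT _; rewrite (le_trans (ler_norm _)) // lerDl.
rewrite [leRHS](_ : _ = T' ^+ p * (C * (h ^+ p * M p))); last by ring.
have tp : `|t i ^+ p| <= T' ^+ p by rewrite normrX lerXn2r ?nnegrE ?(ltW T0).
apply: ler_pM => //.
exact: HC.
Qed.

Lemma tf_dilate (t : R) u : 0 < t -> tf u -> tf (fun x => u (t * x)).
Proof. by move=> t0 tu; apply: (@tfam_dilate unit (fun=> t) (fun=> u) t t) => // _; rewrite lexx. Qed.

End families.

(** * Mean value estimates and geometrically weighted series *)

Section calculus.
Context {R : realType}.
Implicit Types (a b x y z h C : R) (g dg : R -> R).

Lemma mvt_le g dg a b C : (forall x, is_derive x 1 g (dg x)) ->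
  (forall z, `|z - a| <= `|b - a| -> `|dg z| <= C) -> `|g b - g a| <= C * `|b - a|.
Proof.
move=> gd gC.
have gc (A : set R) : {within A, continuous g}.
  apply: continuous_subspaceT => x; apply: differentiable_continuous.
  by apply/derivable1_diffP; have [] := gd x.
have [ab|ba] := leP a b.
  have [z zab ->] := @MVT_segment _ g dg _ _ ab (fun x _ => gd x) (gc _).
  rewrite normrM ler_wpM2r // gC //.
  by move: zab; rewrite in_itv /= => /andP[az zb]; rewrite !ger0_norm ?subr_ge0 // lerD2r.
have [z zab] := @MVT_segment _ g dg _ _ (ltW ba) (fun x _ => gd x) (gc _).
rewrite (distrC (g b)) => ->.
rewrite normrM (distrC a) ler_wpM2r // gC //.
move: zab; rewrite in_itv /= => /andP[az zb].
by rewrite distrC (distrC b) !ger0_norm ?subr_ge0 ?(ltW ba) // lerD2l lerN2.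
Qed.

Lemma taylor2_le (u : R -> R) C x h : smooth u ->
  (forall z, `|derive1n 2 u z| <= C) ->
  `|u (x + h) - u x - h * derive1n 1 u x| <= C * h ^+ 2.
Proof.
move=> su uC; have C0 : 0 <= C by apply: le_trans (uC 0).
pose g y := u y + (- derive1n 1 u x) * y.
have gd z : is_derive z 1 g (derive1n 1 u z + (- derive1n 1 u x) * 1).
  exact: deriv_add (smooth_is_derive su 0 z) (deriv_scale _ (is_derive_id z 1)).
have := @mvt_le g _ x (x + h) (C * `|h|) gd.
rewrite [x + h - x]addrAC subrr add0r => H.
have -> : u (x + h) - u x - h * derive1n 1 u x = g (x + h) - g x by rewrite /g; ring.
have -> : C * h ^+ 2 = C * `|h| * `|h| by rewrite -mulrA -expr2 real_normK ?num_real.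
apply: H => z zx; rewrite mulr1.
apply: le_trans (mvt_le (smooth_is_derive su 1) (fun z _ => uC z)) _.
by rewrite ler_wpM2l.
Qed.

(** With [taylor2_le] this differentiates a series term by term: a quadratic remainder uniform over
    the terms passes to the sum. *)
Lemma is_derive_quad g x l B :
  (forall h, `|g (x + h) - g x - h * l| <= B * h ^+ 2) -> is_derive x 1 g l.
Proof.
move=> H.
have cv : h^-1 *: ((g \o shift x) (h *: 1) - g x) @[h --> (0:R)^'] --> l.
  apply/subr_cvg0/cvgr0Pnorm_le => e e0.
  have B1 : 0 < `|B| + 1 by rewrite ltr_wpDl.
  near=> h.
  have h0 : h != 0 by near: h; exact: nbhs_dnbhs_neq.
  have he : `|h| <= e / (`|B| + 1).
    near: h; apply: dnbhs0_le; exact: divr_gt0.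
  rewrite /= /GRing.scale /= mulr1 [h + x]addrC.
  have -> : h^-1 * (g (x + h) - g x) - l = h^-1 * (g (x + h) - g x - h * l) by field.
  rewrite normrM normfV ler_pdivrMl ?normr_gt0 //.
  apply: le_trans (H h) _.
  have -> : h ^+ 2 = `|h| * `|h| by rewrite -expr2 real_normK ?num_real.
  rewrite mulrCA ler_wpM2l //.
  apply: le_trans (_ : (`|B| + 1) * `|h| <= _); last by rewrite mulrC -ler_pdivlMr.
  by rewrite ler_wpM2r // (le_trans (ler_norm _)) // lerDl.
apply: DeriveDef; first by apply/cvg_ex; exists l.
exact/cvg_lim.
Unshelve. all: by end_near. Qed.

Lemma cvg_lin (T : Type) (F : set_system T) {FF : Filter F} (f g : T -> R) a b (p q : R) :
  f @ F --> a -> g @ F --> b -> (fun z : T => p * f z + q * g z) @ F --> p * a + q * b.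
Proof.
move=> fa gb; apply: cvgD; apply: cvgM => //; exact: cvg_cst.
Qed.

Arguments cvg_lin {T F FF f g a b} p q _ _.

Lemma cvg_ext (T : Type) (F : set_system T) {FF : Filter F} (f g : T -> R) (l : R) :
  f @ F --> l -> (forall z : T, f z = g z) -> g @ F --> l.
Proof. by move=> + /funext <-. Qed.

(** The ratio 1/3 is chosen for the gliding hump: there the terms after a nearly maximal one add up
    to at most 1/3 * 2 * 4/3 = 8/9 of it. *)
Definition ssum (a : nat -> R) : R := limn (series (fun k => 3^-1 ^+ k * a k)).

Lemma ssum_cvg (a : nat -> R) C : (forall k, `|a k| <= C) ->
  series (fun k => 3^-1 ^+ k * a k) @ \oo --> ssum a.
Proof.
move=> aC; apply: normed_cvg.
have C0 : 0 <= C by apply: le_trans (aC 0%N).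
have q0 : 0 <= 3^-1 :> R by rewrite invr_ge0.
apply: (@series_le_cvg _ _ (geometric C 3^-1)) => //=.
- by move=> n; rewrite mulr_ge0 // exprn_ge0.
- by move=> n; rewrite normrM normrX ger0_norm // mulrC ler_wpM2r ?exprn_ge0.
- by apply: is_cvg_geometric_series; rewrite ger0_norm // invf_lt1 ?ltr1n.
Qed.

Lemma ssum_bound (a : nat -> R) C : (forall k, `|a k| <= C) -> `|ssum a| <= 2 * C.
Proof.
move=> aC.
have C0 : 0 <= C by apply: le_trans (aC 0%N).
have q0 : 0 <= 3^-1 :> R by rewrite invr_ge0.
have q1 : `|3^-1 : R| < 1 by rewrite ger0_norm // invf_lt1 ?ltr1n.
apply: (cvgr_to_le (cvg_norm (ssum_cvg aC))).
apply: nearW => n /=.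
apply: (@le_trans _ _ (series (geometric C 3^-1) n)).
  rewrite /series /=; apply: le_trans (ler_norm_sum _ _ _) _.
  apply: ler_sum => i _; rewrite normrM normrX ger0_norm //.
  by rewrite mulrC ler_wpM2r ?exprn_ge0.
rewrite geometric_seriesE; last by rewrite lt_eqF // invf_lt1 ?ltr1n.
rewrite ler_pdivrMr; last by rewrite subr_gt0 invf_lt1 ?ltr1n.
have : 0 <= (3^-1 : R) ^+ n by rewrite exprn_ge0.
have : C * (3^-1 : R) ^+ n >= 0 by rewrite mulr_ge0 ?exprn_ge0.
rewrite mulrBr mulr1; lra.
Qed.

Lemma ssum_lin (a b : nat -> R) (p q C E : R) :
  (forall k, `|a k| <= C) -> (forall k, `|b k| <= E) ->
  ssum (fun k => p * a k + q * b k) = p * ssum a + q * ssum b.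
Proof.
move=> aC bE; apply/cvg_lim => //.
apply: cvg_ext (cvg_lin p q (ssum_cvg aC) (ssum_cvg bE)) _ => n /=.
rewrite /series /= !mulr_sumr -big_split /=; apply: eq_bigr => i _; ring.
Qed.

Lemma ssum_rec (a : nat -> R) C : (forall k, `|a k| <= C) ->
  ssum a = a 0%N + 3^-1 * ssum (fun k => a k.+1).
Proof.
move=> aC; apply/cvg_lim => //.
rewrite -(cvg_shiftS (series _)) /=.
have aC' k : `|a k.+1| <= C by [].
rewrite -[a 0%N]mul1r.
apply: cvg_ext (cvg_lin 1 (3^-1) (cvg_cst (a 0%N)) (ssum_cvg aC')) _ => n /=.
rewrite mul1r.
rewrite /series /= big_nat_recl //= expr0 mul1r mulr_sumr; congr (_ + _).
by apply: eq_bigr => i _; rewrite exprS mulrA.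
Qed.

(** Repeated mean value theorem, one power of |x| per vanishing derivative; the factor 1/n! is given
    up. *)
Lemma vanish_le (v : R -> R) n B : smooth v ->
  (forall j, (j < n)%N -> derive1n j v 0 = 0) ->
  (forall x, `|derive1n n v x| <= B) -> forall x, `|v x| <= B * `|x| ^+ n.
Proof.
elim: n v => [|n IH] v sv v0 vB x; first by rewrite expr0 mulr1; exact: vB.
have := @mvt_le v (derive1n 1 v) 0 x (B * `|x| ^+ n) (smooth_is_derive sv 0).
rewrite (v0 0%N isT : v 0 = 0) !subr0 exprSr mulrA; apply => z; rewrite subr0 => zx.
have B0 : 0 <= B by apply: le_trans (vB 0).
apply: le_trans (IH (derive1n 1 v) _ _ _ z) _.
- exact: smooth_derive1n.
- by move=> j jn; rewrite derive1nD addn1; exact: v0.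
- by move=> y; rewrite derive1nD addn1.
- by rewrite ler_wpM2l // lerXn2r ?nnegrE.
Qed.

End calculus.

(** * Stability of bounded families under weighted sums and blow-up at 0 *)

Section families.
Context {R : realType} (M : nat -> R) (s : ultraclass).
Hypothesis hM : weight_sequence M.
Implicit Types (r t a b h T A x C E : R) (n m p k : nat).
Let M0 := weight_gt0 hM.

(** Derivatives commute with the weighted sum because the bound on order p + 2, uniform in k,
    controls the quadratic remainder of order p. The same h works, with the constant doubled. *)
Lemma tfam_ssum (I : Type) (u : I -> nat -> R -> R) :
  tfam M s (fun ik : I * nat => u ik.1 ik.2) ->
  tfam M s (fun i x => ssum (fun k : nat => u i k x)).
Proof.
case=> su [r r0 ur] bu.
have bd i p x : exists C, forall k, `|derive1n p (u i k) x| <= C.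
  have [C C0 HC] := bfam_bound hM p bu.
  by exists C => k; exact: (HC (i, k)).
have jt i p x : is_derive x 1 (fun x => ssum (fun k => derive1n p (u i k) x))
     (ssum (fun k => derive1n p.+1 (u i k) x)).
  have [C C0 HC] := bfam_bound hM p.+2 bu.
  apply: (@is_derive_quad _ _ _ _ (2 * C)) => h.
  have [C1 HC1] := bd i p (x + h).
  have [C2 HC2] := bd i p x.
  have [C3 HC3] := bd i p.+1 x.
  have H12 k : `|1 * derive1n p (u i k) (x + h) + (-1) * derive1n p (u i k) x| <= C1 + C2.
    by rewrite mul1r mulN1r (le_trans (ler_normB _ _)) // lerD.
  rewrite -[_ - ssum _]mulr1 -[X in `|X - _|]/(_ * 1).
  have -> : ssum (fun k => derive1n p (u i k) (x + h)) - ssum (fun k => derive1n p (u i k) x)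
     = ssum (fun k => 1 * derive1n p (u i k) (x + h) + (-1) * derive1n p (u i k) x).
    by rewrite (ssum_lin _ _ HC1 HC2) mul1r mulN1r.
  rewrite mulr1.
  have -> : ssum (fun k => 1 * derive1n p (u i k) (x + h) + -1 * derive1n p (u i k) x)
     - h * ssum (fun k => derive1n p.+1 (u i k) x) =
     ssum (fun k => 1 * (1 * derive1n p (u i k) (x + h) + (-1) * derive1n p (u i k) x)
            + (- h) * derive1n p.+1 (u i k) x).
    by rewrite (ssum_lin _ _ H12 HC3) mul1r mulNr.
  rewrite -mulrA; apply: ssum_bound => k; rewrite !mul1r mulN1r mulNr.
  have := @taylor2_le _ (derive1n p (u i k)) C x h.
  rewrite !derive1nD add1n add2n; apply; first exact: smooth_derive1n (su (i, k)).
  by move=> z; exact: (HC (i, k)).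
have dE i p : derive1n p (fun x => ssum (fun k => u i k x)) =
     (fun x => ssum (fun k => derive1n p (u i k) x)).
  exact: (jetE (jt i)).
split.
- by move=> i; exact: (jet_smooth (jt i)).
- exists r => // i x rx.
  have -> : (fun k => u i k x) = (fun k => 0 * 0 + 0 * 0).
    by apply/funext => k; rewrite (ur (i, k)) // mulr0 addr0.
  by rewrite (@ssum_lin _ (fun=> 0) (fun=> 0) 0 0 0 0) ?normr0 // !mul0r addr0.
- apply: forh_mono bu => h h0 [C C0 HC]; exists (2 * C); first by rewrite mulr_ge0.
  move=> i p x _; rewrite dE -mulrA; apply: ssum_bound => k.
  exact: (HC (i, k)).
Qed.

(** A derivative of order p >= m carries the factor t^(p-m) <= 1. For p < m the negative power of t
    is compensated by the vanishing of the p-th derivative of [rho] to order m - p at 0. These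
    finitely many orders only enlarge the constant. *)
Lemma lfam_blowup (I : Type) (t : I -> R) (rho : R -> R) m :
  (forall i, 0 < t i <= 1) -> tf M s rho ->
  (forall p, (p < m)%N -> derive1n p rho 0 = 0) ->
  lfam M s (fun i x => (t i) ^- m * rho (t i * x)).
Proof.
move=> t01 trho v0; have srho := tf_smooth trho.
have t0 i : 0 < t i by case/andP: (t01 i).
have sm i : smooth (fun x => (t i) ^- m * rho (t i * x)).
  have := @smooth_lin _ ((t i) ^- m) 0 _ _ (smooth_dilate (t := t i) srho) (smooth_dilate (t := t i) srho).
  by congr smooth; apply/funext => x; rewrite mul0r addr0.
split=> // r.
have dE i p x : derive1n p (fun x => (t i) ^- m * rho (t i * x)) x =
    (t i) ^- m * ((t i) ^+ p * derive1n p rho (t i * x)).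
  have := @derive1n_lin _ ((t i) ^- m) 0 _ _ p (smooth_dilate (t := t i) srho) (smooth_dilate (t := t i) srho).
  rewrite derive1n_dilate // => /(congr1 (fun g => g x)).
  rewrite mul0r addr0 => <-.
  by congr derive1n; apply/funext => y; rewrite mul0r addr0.
have [_ _ brho] := trho.
have [B B0 HB] := bfam_bound hM m brho.
apply: forh_mono brho => h h0 [C C0 HC].
have hM0 p : 0 < h ^+ p * M p by rewrite mulr_gt0 ?exprn_gt0.
pose A := B * (1 + `|r|) ^+ m.
have A0 : 0 <= A by rewrite mulr_ge0 ?exprn_ge0 ?addr_ge0.
have S0 : 0 <= \sum_(q < m) A / (h ^+ q * M q).
  by apply: sumr_ge0 => q _; rewrite divr_ge0 // ltW.
exists (C + \sum_(q < m) A / (h ^+ q * M q)); first exact: addr_ge0.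
move=> i p x /= xr; rewrite dE.
have [mp|pm] := leqP m p.
  apply: (@le_trans _ _ (C * (h ^+ p * M p))); last by rewrite ler_wpM2r ?lerDl // ltW.
  rewrite [t i ^- m * _]mulrA normrM.
  have -> : t i ^- m * t i ^+ p = t i ^+ (p - m).
    by rewrite -[in LHS](subnKC mp) exprD mulrA mulVf ?mul1r // expf_neq0 // gt_eqF.
  rewrite -[leRHS]mul1r; apply: ler_pM => //; last exact: (HC tt).
  rewrite normrX exprn_ile1 // gtr0_norm //.
  by case/andP: (t01 i).
apply: (@le_trans _ _ A); last first.
  rewrite -ler_pdivrMr // (bigD1 (Ordinal pm)) //=.
  rewrite addrCA lerDl addr_ge0 // sumr_ge0 // => q _.
  by rewrite divr_ge0 // ltW.
have := @vanish_le _ (derive1n p rho) (m - p) B (@smooth_derive1n _ p _ srho) _ _ (t i * x).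
move=> /(_ _ _)/le_trans H.
rewrite !normrM.
apply: (@le_trans _ _ (`|t i ^- m| * (`|t i ^+ p| * (B * `|t i * x| ^+ (m - p))))).
  rewrite !ler_wpM2l //; apply: H => //.
  - by move=> j jm; rewrite derive1nD v0 // -ltn_subRL ?(ltnW pm) // ltn_subRL addnC -ltn_subRL.
  - by move=> y; rewrite derive1nD subnK ?(ltnW pm) //; exact: (HB tt).
rewrite normfV !normrX normrM (gtr0_norm (t0 i)) exprMn.
have -> : t i ^- m * (t i ^+ p * (B * (t i ^+ (m - p) * `|x| ^+ (m - p)))) = B * `|x| ^+ (m - p).
  have -> : t i ^- m * (t i ^+ p * (B * (t i ^+ (m - p) * `|x| ^+ (m - p)))) =
    (t i ^- m * (t i ^+ p * t i ^+ (m - p))) * (B * `|x| ^+ (m - p)) by ring.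
  by rewrite -exprD subnKC ?(ltnW pm) // mulVf ?mul1r // expf_neq0 // gt_eqF.
rewrite /A ler_wpM2l //.
apply: (@le_trans _ _ ((1 + `|r|) ^+ (m - p))).
  rewrite lerXn2r ?nnegrE ?addr_ge0 //.
  by apply: le_trans xr _; rewrite (le_trans (ler_norm _)) // lerDr.
by rewrite ler_weXn2l ?leq_subr // lerDl.
Qed.

End families.

(** * Regular variation *)

Section uniform_convergence.
Context {R : realType}.
Notation mu := (@lebesgue_measure R).

Lemma lebesgue_measure_dilate (c : R) (B : set (measurableTypeR R)) : 0 < c -> measurable B ->
  (c%:E * mu ((fun x => (c * x)%R) @^-1` B) = mu B)%E.
Proof.
move=> c0 mB.
have mc : measurable_fun setT (fun x : measurableTypeR R => (c * x : measurableTypeR R)).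
  exact: mulrl_measurable.
pose nu0 := @measure_function_pushforward__canonical__measure_function_Measure
  _ _ _ _ _ mu _ mc.
pose nu := mscale (NngNum (ltW c0)) nu0.
apply/esym; apply: (@lebesgue_measure_unique R nu) => // X [[a b] _ <-] /=.
rewrite /nu /nu0 /mscale /= /pushforward.
have -> : (fun x => c * x) @^-1` `]a, b] = `](a / c), (b / c)]%classic.
  apply/seteqP; split => x /=; rewrite !in_itv /= ler_pdivlMr // ltr_pdivrMr //;
  by rewrite mulrC.
rewrite !lebesgue_measure_itv /= !lte_fin ltr_pM2r ?invr_gt0 //.
case: ifPn => _; last by rewrite mule0.
by rewrite -!EFinB -EFinM mulrBr !(mulrC c) !divfK ?gt_eqF.
Qed.

Lemma measurable_dilate (c : R) (B : set (measurableTypeR R)) : measurable B ->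
  measurable ((fun x => c * x) @^-1` B : set (measurableTypeR R)).
Proof.
move=> mB; rewrite -[X in measurable X]setTI.
by apply: (mulrl_measurable (D := setT)).
Qed.

(** [L] is Lebesgue measurable, whereas dilations are handled on Borel sets. The preimages of
    rational rays are Borel up to null sets, and [Z] is the countable union of the exceptional
    sets. *)
Lemma borel_version (L : R -> R) (A : R) :
  @measurable_fun _ _ (lebesgueType R) (measurableTypeR R) `[A, +oo[ L ->
  exists Z : set (measurableTypeR R), [/\ measurable Z, mu Z = 0%E &
    measurable_fun (`[A, +oo[ `\` Z) (L : measurableTypeR R -> measurableTypeR R)].
Proof.
move=> mL.
have cE := @g_sigma_completed_algebra_genE R.
have mA : @measurable _ (lebesgueType R) `[A, +oo[.
  rewrite -[@measurable _ _]/((completed_algebra_gen mu).-sigma.-measurable) cE; exists `[A, +oo[%classic; first exact: measurable_itv.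
  by exists set0; [exact: negligible_set0|rewrite setU0].
have H (q : rat) : exists BZ : set (measurableTypeR R) * set (measurableTypeR R),
    [/\ measurable BZ.1, measurable BZ.2, mu BZ.2 = 0%E &
      BZ.1 `<=` `[A, +oo[ `&` L @^-1` `]ratr q, +oo[ /\
      `[A, +oo[ `&` L @^-1` `]ratr q, +oo[ `<=` BZ.1 `|` BZ.2].
  have := mL mA `]ratr q, +oo[%classic (measurable_itv _).
  rewrite -[@measurable _ _]/((completed_algebra_gen mu).-sigma.-measurable) cE => -[B mB [N [Z [mZ Z0 NZ]] BNE]].
  exists (B, Z); split => //=; rewrite -BNE; split; first exact: subsetUl.
  exact: setUS.
have [BZ HBZ] := choice H.
pose Z := \bigcup_(n in [set: nat]) (if unpickle n is Some q then (BZ q).2 else set0).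
have mZ : measurable Z.
  apply: bigcupT_measurable => n; case: unpickle => [q|]; last exact: measurable0.
  by have [] := HBZ q.
exists Z; split => //.
  apply/eqP; rewrite -measure_le0.
  apply: le_trans (measure_sigma_subadditive _ _ mZ (@subset_refl _ Z)) _.
    move=> n; case: unpickle => [q|]; last exact: measurable0.
    by have [] := HBZ q.
  rewrite eseries0 // => n _ _; case: unpickle => [q|]; last exact: measure0.
  by have [] := HBZ q.
apply: (measurability _ (RGenOInfty.measurableE R)) => /= _ [_ [x ->] <-].
rewrite [X in measurable X](_ : _ = \bigcup_(q : rat)
   (if x < ratr q then (BZ q).1 `\` Z else set0)).
  apply: bigcupT_measurable_rat => q; case: ifP => _; last exact: measurable0.
  by apply: measurableD => //; have [] := HBZ q.
apply/seteqP; split => t /=.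
  rewrite !in_itv /= !andbT => -[[At nZt] xL].
  have [q /andP[xq qL]] := rat_in_itvoo xL.
  exists q => //; rewrite ifT ?in_itv //=; split => //.
  have [_ _ _ [_ /(_ t)]] := HBZ q; case => //=.
    by rewrite !in_itv /= !andbT.
  by move=> Zt; exfalso; apply: nZt; exists (pickle q); [exact: I|rewrite pickleK].
move=> [q _]; case: ifPn => // xq [Bt nZt].
have [_ _ _ [/(_ t Bt) /= + _]] := HBZ q.
rewrite !in_itv /= !andbT => -[At qL]; split => //.
exact: lt_trans xq qL.
Qed.

Variable L : R -> R.
Hypothesis hL : slowly_varying L.

(** An Egorov argument. If it failed along some x_n tending to infinity, slow variation at each
    fixed u would put almost every u of [1, 4] into [S (x n)] for all large n, so the increasing
    sets of eventually good points would exhaust measure 3 while staying below 11/4. *)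
Lemma slowly_varying_good : exists S : R -> set (measurableTypeR R), 
  [/\ forall x, measurable (S x), forall x, S x `<=` `[1, 4],
   forall x u, S x u -> L x / 2 < L (x * u) < 3 / 2 * L x &
   exists X : R, forall x, X <= x -> ((11 / 4)%:E < mu (S x))%E].
Proof.
case: hL => -[A mL] [P [_ LP]] Lasym.
have [Z [mZ Z0 mLZ]] := borel_version mL.
pose D := `[A, +oo[ `\` Z.
have mD : measurable (D : set (measurableTypeR R)).
  by apply: measurableD => //; exact: measurable_itv.
pose S x : set (measurableTypeR R) := `[1, 4] `&` (fun u => x * u) @^-1` (D `&` L @^-1` `]L x / 2, 3 / 2 * L x[).
have mS x : measurable (S x).
  apply: measurableI; first exact: measurable_itv.
  by apply: measurable_dilate; apply: mLZ => //; exact: measurable_itv.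
exists S; split => //; first by move=> x u [].
  by move=> x u [_ [_ /=]]; rewrite in_itv.
apply: contrapT => /forallNP H.
have {}H (n : nat) : exists x : R, n%:R <= x /\ (mu (S x) <= (11 / 4)%:E)%E.
  have /existsNP[x /not_implyP[nx /negP]] := H n%:R.
  by rewrite -leNgt => xS; exists x.
have [x Hx] := choice H.
have xn n : n%:R <= x n by case: (Hx n).
pose G k : set (measurableTypeR R) := \bigcap_(n in [set n | (k <= n)%N]) S (x n).
have mG k : measurable (G k).
  by apply: bigcap_measurable => //; exists k => /=.
have mUG : measurable (\bigcup_k G k) by apply: bigcupT_measurable.
have Gnd : nondecreasing_seq G.
  move=> k l kl; apply/subsetPset => u Gu n /= ln; apply: Gu => /=; exact: leq_trans kl ln.
have GS k : (mu (G k) <= (11 / 4)%:E)%E.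
  apply: le_trans (_ : mu (S (x k)) <= _)%E; last by case: (Hx k).
  by apply: le_measure; rewrite ?inE // => u; apply => /=.
have UG : (mu (\bigcup_k G k) <= (11 / 4)%:E)%E.
  apply: (cvge_to_le (nondecreasing_cvg_mu mG mUG Gnd)).
  by apply: nearW => k; exact: GS.
(* Points that some dilation x_n sends into the null set [Z]. The test [0 < x n] discards the early
   indices where the dilation could be degenerate. *)
pose N : set (measurableTypeR R) := \bigcup_n (fun u => x n * u) @^-1` (if 0 < x n then Z else set0).
have mNn n : measurable ((fun u => x n * u) @^-1` (if 0 < x n then Z else set0) : set (measurableTypeR R)).
  by apply: measurable_dilate; case: ifP.
have mN : measurable N by exact: bigcupT_measurable.
have N0 : mu N = 0%E.
  apply/eqP; rewrite -measure_le0.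
  apply: le_trans (measure_sigma_subadditive _ mNn mN (@subset_refl _ N)) _.
  rewrite eseries0 // => n _ _; case: ifPn => [xn0|_]; last by rewrite preimage_set0 measure0.
  have := lebesgue_measure_dilate xn0 mZ.
  rewrite Z0 => /eqP; rewrite mule_eq0 eqe gt_eqF //= => /eqP; exact.
have cover : `[1, 4] `<=` \bigcup_k G k `|` N.
  move=> u /= u14; have := u14; rewrite in_itv /= => /andP[u1 u4].
  have [Nu|nNu] := pselect (N u); [by right|left].
  have u0 : 0 < u by apply: lt_le_trans u1.
  have := Lasym u u0 => /cvgrPdist_lt /(_ (1/2)) /(_ _)[|Q [_ HQ]].
    by rewrite divr_gt0.
  pose T := `|Q| + `|A| + `|P| + 1.
  exists (Num.truncn T).+1 => // n /= Tn.
  have Tx : T < x n.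
    apply: lt_le_trans (xn n); apply: lt_le_trans (truncnS_gt T) _.
    by rewrite ler_nat.
  have [Qx Ax Px x0] : [/\ Q < x n, A < x n, P < x n & 0 < x n].
    have := ler_norm Q; have := ler_norm A; have := ler_norm P.
    have := normr_ge0 Q; have := normr_ge0 A; have := normr_ge0 P.
    by move: Tx; rewrite /T => Tx *; split; lra.
  split => //; split; first split => /=.
  - rewrite in_itv /= andbT (le_trans (ltW Ax)) // ler_peMr // ltW //.
  - by move=> Zx; apply: nNu; exists n => //=; rewrite x0.
  - have Lx := LP _ Px.
    have := HQ _ Qx; rewrite ltr_distlC.
    move=> H12; rewrite /= (_ : L (x n * u) = L (u * x n) / L (x n) * L (x n)); last first.
      by rewrite divfK ?gt_eqF // mulrC.
    move: H12.
    move=> /andP[H1 H2]; rewrite /= in_itv /= ltr_pM2r // [L (x n) / 2]mulrC ltr_pM2r //.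
    apply/andP; split; lra.
have m14 : mu `[1, 4]%classic = 3%:E.
  by rewrite lebesgue_measure_itv /= lte_fin ltr1n -EFinB; congr EFin; lra.
have : (3%:E <= mu (\bigcup_k G k) + mu N)%E.
  rewrite -m14; apply: le_trans (_ : mu (\bigcup_k G k `|` N) <= _)%E.
    by apply: le_measure; rewrite ?inE //; exact: measurableU.
  exact: measureU2.
by rewrite N0 adde0 => /le_trans /(_ UG); rewrite lee_fin; lra.
Qed.

(** For x in [Y, 2Y] the set [S Y] and the dilate by x/Y of [S x] within [1, 2] both lie in [1, 4].
    Their measures are at least 11/4 and 11/4 - 2 = 3/4, with sum above 3, so they meet: Y u = x v
    with u, v good. Then L(Y)/2 < L(Y u) = L(x v) < 3/2 L(x), which excludes L(x) < L(Y)/4. *)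
Lemma slowly_varying_lower (B : R) :
  exists X m : R, [/\ B <= X, 0 < X, 0 < m & forall x, X <= x <= 2 * X -> m <= L x].
Proof.
have [S [mS S14 SL [X HX]]] := slowly_varying_good.
have [_ [P [_ LP]] _] := hL.
pose Y := `|B| + `|X| + `|P| + 1.
have [BY XY PY Y0] : [/\ B <= Y, X <= Y, P < Y & 0 < Y].
  have := ler_norm B; have := ler_norm X; have := ler_norm P.
  have := normr_ge0 B; have := normr_ge0 X; have := normr_ge0 P.
  by rewrite /Y; split; lra.
have LY : 0 < L Y by exact: LP.
exists Y, (L Y / 4); split => //; first by rewrite divr_gt0.
move=> x /andP[Yx xY2]; rewrite leNgt; apply/negP => Lx.
have x0 : 0 < x by exact: lt_le_trans Yx.
have c0 : 0 < x / Y by exact: divr_gt0.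
have c1 : 1 <= x / Y by rewrite ler_pdivlMr // mul1r.
have c2 : x / Y <= 2 by rewrite ler_pdivrMr.
pose Q : set (measurableTypeR R) := S x `&` `[1, 2].
have mQ : measurable Q by apply: measurableI => //; exact: measurable_itv.
have Qbig : ((3 / 4)%:E <= mu Q)%E.
  pose C : set (measurableTypeR R) := `]2, 4]%classic.
  have mC : measurable C by exact: measurable_itv.
  have mC2 : mu C = (2%R : R)%:E.
    by rewrite lebesgue_measure_itv /= lte_fin ltr_nat -EFinB; congr EFin; lra.
  have H : ((11 / 4)%:E < mu Q + (2%R : R)%:E)%E.
    rewrite -mC2; apply: lt_le_trans (HX x (le_trans XY Yx)) _.
    apply: le_trans (_ : mu (Q `|` C) <= _)%E; last exact: measureU2.
    apply: le_measure; rewrite ?inE //; first exact: measurableU.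
    move=> u Su; have := S14 _ _ Su; rewrite /= !in_itv /= => /andP[u1 u4].
    have [u2|u2] := leP u 2; first by left; split => //=; rewrite in_itv /= u1.
    by right; rewrite /C /= in_itv /= u2.
  have : mu Q \is a fin_num.
    rewrite ge0_fin_numE //.
    apply: le_lt_trans (_ : (mu `[1%R, 4%R] < +oo)%E).
      by apply: le_measure; rewrite ?inE // => u [/S14].
    by rewrite lebesgue_measure_itv /= lte_fin ltr1n -EFinB ltry.
  move=> /fineK Qf; move: H; rewrite -Qf -EFinD lte_fin lee_fin; lra.
pose P' : set (measurableTypeR R) := (fun u => (x / Y)^-1 * u) @^-1` Q.
have mP' : measurable P' by exact: measurable_dilate.
have P'big : ((3 / 4)%:E <= mu P')%E.
  have ci : 0 < (x / Y)^-1 by rewrite invr_gt0.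
  apply: le_trans Qbig _; rewrite -(lebesgue_measure_dilate ci mQ).
  rewrite -[leRHS]mul1e; apply: lee_wpmul2r => //.
  by rewrite lee_fin invf_le1.
have dis : S Y `&` P' = set0.
  apply/seteqP; split => // u [SYu [Sxu _]].
  have /andP[H1 H2] := SL _ _ SYu; have /andP[H3 H4] := SL _ _ Sxu.
  have E : x * ((x / Y)^-1 * u) = Y * u.
    by rewrite invf_div mulrA (mulrCA x) divff ?mulr1 // gt_eqF.
  rewrite E in H3 H4; lra.
have sub : S Y `|` P' `<=` `[1, 4].
  move=> u [/S14//|[_]] /=; rewrite !in_itv /= invf_div => /andP[u1 u2].
  have u0 : 0 < u.
    rewrite -(pmulr_rgt0 u (divr_gt0 Y0 x0)); exact: lt_le_trans u1.
  move: u1 u2; rewrite mulrAC ler_pdivlMr // ler_pdivrMr // mul1r => u1 u2.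
  apply/andP; split.
    by rewrite -(ler_pM2l Y0) mulr1 (le_trans Yx).
  rewrite -(ler_pM2l Y0); lra.
have m14 : mu `[1, 4]%classic = 3%:E.
  by rewrite lebesgue_measure_itv /= lte_fin ltr1n -EFinB; congr EFin; lra.
have : (mu (S Y) + mu P' <= 3%:E)%E.
  rewrite -m14 -measureU //; apply: le_measure; rewrite ?inE //.
  exact: measurableU.
by move/(le_trans (leeD (ltW (HX Y XY)) P'big)); rewrite -EFinD lee_fin; lra.
Qed.

End uniform_convergence.

(** * Limits at infinity and growth of regularly varying functions *)

Section at_infinity.
Context {R : realType}.
Implicit Types (F G : R -> R) (a b e l q x X : R).

Lemma neary_ex (P : R -> Prop) :
  (\forall x \near +oo, P x) <-> exists2 X, 0 < X & forall x, X <= x -> P x.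
Proof.
split=> [[A [_ AP]]|[X X0 XP]]; last by exists X; split; [exact: num_real|move=> x /ltW; exact: XP].
exists (`|A| + 1); first by rewrite ltr_wpDl.
by move=> x Ax; apply: AP; have := ler_norm A; lra.
Qed.

Lemma neary_and (P Q : R -> Prop) :
  (\forall x \near +oo, P x) -> (\forall x \near +oo, Q x) ->
  exists2 X, 0 < X & forall x, X <= x -> P x /\ Q x.
Proof. by move=> HP HQ; apply/neary_ex; exact: filterI HP HQ. Qed.

Lemma cvgy_ex F l : F @ +oo --> l <->
  forall e, 0 < e -> exists2 X, 0 < X & forall x, X <= x -> `|F x - l| <= e.
Proof.
split=> [/cvgrPdist_le H e e0|H].
  by have /neary_ex[X X0 HX] := H e e0; exists X => // x; rewrite distrC; exact: HX.
apply/cvgrPdist_le => e e0; apply/neary_ex; have [X X0 HX] := H e e0.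
by exists X => // x; rewrite distrC; exact: HX.
Qed.

Lemma cvgy_eq F G l : (exists X, forall x, X <= x -> F x = G x) ->
  F @ +oo --> l -> G @ +oo --> l.
Proof.
move=> [X HX]; apply: cvg_trans; apply: near_eq_cvg.
by exists X; split; [exact: num_real|move=> x /ltW /HX].
Qed.

Lemma cvgy_scale k F l : F @ +oo --> l -> (fun x => k * F x) @ +oo --> k * l.
Proof. by move=> Fl; apply: cvgM => //; exact: cvg_cst. Qed.

Arguments cvgy_scale k {F l} _.

(** Interchange of limits: the approximants [h J] have limits in x for fixed J, and their error is
    small uniformly for large x, where large may depend on J. *)
Lemma cvgy_approx (H : R -> R) (h : nat -> R -> R) (lJ eps : nat -> R) l :
  (forall J, h J @ +oo --> lJ J) -> lJ @ \oo --> l -> eps @ \oo --> 0 ->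
  (forall J, \forall x \near +oo, `|H x - h J x| <= eps J) ->
  H @ +oo --> l.
Proof.
move=> hJ lJl eps0 Hh; apply/cvgrPdist_le => e e0.
have e3 : 0 < e / 3 by rewrite divr_gt0.
have /cvgrPdist_le /(_ _ e3) H1 := lJl.
have /cvgr0Pnorm_le /(_ _ e3) H2 := eps0.
have [J [J1 J2]] : exists J, `|l - lJ J| <= e / 3 /\ `|eps J| <= e / 3.
  by have [J _ HJ] := filterI H1 H2; exists J; exact: HJ (leqnn J).
have /cvgrPdist_le /(_ _ e3) H3 := hJ J.
have := Hh J; apply: filterS2 H3 => x H3 H4.
have -> : l - H x = (l - lJ J) + (lJ J - h J x) + (h J x - H x) by ring.
apply: le_trans (ler_normD _ _) _; apply: le_trans (lerD (ler_normD _ _) (lexx _)) _.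
rewrite distrC in H4; have := ler_norm (eps J); lra.
Qed.

Lemma powR_add x a b : 0 < x -> x `^ (a + b) = x `^ a * x `^ b.
Proof. by move=> x0; rewrite powRD // (gt_eqF x0) implybT. Qed.

Lemma powR_sub x a b : 0 < x -> x `^ (a - b) = x `^ a / x `^ b.
Proof. by move=> x0; rewrite powR_add // powRN. Qed.

Lemma powR_cvgy0 b : b < 0 -> (fun x => x `^ b) @ +oo --> 0.
Proof.
move=> b0; apply/cvgy_ex => e e0; exists (e `^ b^-1); first exact: powR_gt0.
move=> x ex; rewrite subr0 ger0_norm ?powR_ge0 //.
have x0 : 0 < x by apply: lt_le_trans ex; exact: powR_gt0.
have -> : e = (e `^ b^-1) `^ b by rewrite -powRrM mulVf ?powRr1 // ?lt_eqF // ltW.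
have E y : y `^ b = (y `^ (- b))^-1 by rewrite -powRN opprK.
rewrite (E x) (E (e `^ _)) lef_pV2 ?posrE ?powR_gt0 ?powR_gt0 //.
apply: ge0_ler_powR; rewrite ?nnegrE ?powR_ge0 // ?(ltW x0) //.
by rewrite oppr_ge0 ltW.
Qed.

Lemma dyadic_scale X x : 0 < X -> X <= x -> exists n, 2 ^+ n * X <= x < 2 ^+ n.+1 * X.
Proof.
move=> X0 Xx.
have ex : exists n, x < 2 ^+ n.+1 * X.
  exists (Num.truncn (x / X)); rewrite -ltr_pdivrMr //.
  apply: lt_trans (truncnS_gt _) _; rewrite -natrX ltr_nat.
  exact: ltn_expl.
have [] := ex_minnP ex => -[|n] xn nmin.
  by exists 0%N; rewrite expr0 mul1r Xx.
exists n.+1; rewrite xn andbT leNgt; apply/negP => /nmin.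
by rewrite ltnn.
Qed.

Lemma ltr0n2 : (0 : R) < 2. Proof. exact: ltr0n. Qed.

(** The last clause is the Potter-type lower bound. Recording it here confines the measure theory of
    [L] to [slowly_varying_regvar]. *)
Definition regvar G gamma : Prop :=
  [/\ \forall x \near +oo, 0 < G x,
      forall a, 0 < a -> (fun x => G (a * x) / G x) @ +oo --> a `^ gamma &
      forall b, b < gamma -> (fun x => x `^ b / G x) @ +oo --> 0].

Lemma regvar_double G gamma q : regvar G gamma -> 2 `^ gamma < q ->
  exists2 X, 0 < X & forall x, X <= x -> 0 < G x /\ G (2 * x) <= q * G x.
Proof.
move=> [Gpos Gas _] gq.
have H : \forall x \near +oo, G (2 * x) / G x < q by exact: (@cvgr_lt _ _ _ _ _ _ (Gas 2 ltr0n2) _ gq).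
have [X X0 HX] := neary_and Gpos H.
exists X => // x /HX[Gx]; rewrite ltr_pdivrMr // => /ltW; split => //.
Qed.

Lemma regvar_half G gamma q : regvar G gamma -> 2 `^ (- gamma) < q ->
  exists2 X, 0 < X & forall x, X <= x -> 0 < G x /\ G x <= q * G (2 * x).
Proof.
move=> [Gpos Gas _] gq.
have q0 : 0 < q by apply: lt_trans gq; exact: powR_gt0.
have gq' : q^-1 < 2 `^ gamma.
  by rewrite -[_ `^ _]invrK -powRN ltf_pV2 // posrE powR_gt0.
have H : \forall x \near +oo, q^-1 < G (2 * x) / G x by exact: (@cvgr_gt _ _ _ _ _ _ (Gas 2 ltr0n2) _ gq').
have [X X0 HX] := neary_and Gpos H.
exists X => // x /HX[Gx]; rewrite ltr_pdivlMr // ltr_pdivrMl // => /ltW; split => //.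
Qed.

Lemma regvar_exprn G gamma n : regvar G gamma ->
  regvar (fun x => x ^+ n * G x) (gamma + n%:R).
Proof.
move=> [Gpos Gas Glow]; split.
- have : \forall x \near +oo, 0 < x :> R by apply: nbhs_pinfty_gt; exact: num_real.
  by apply: filterS2 Gpos => x Gx x0; rewrite mulr_gt0 ?exprn_gt0.
- move=> a a0.
  have := cvgy_scale (a ^+ n) (Gas a a0).
  rewrite powR_add // powR_mulrn ?ltW // [_ * a ^+ n]mulrC.
  apply: cvgy_eq; exists 1 => x x1 /=; rewrite exprMn.
  have x0 : x != 0 by rewrite gt_eqF // (lt_le_trans ltr01).
  have xn : x ^+ n != 0 by rewrite expf_neq0.
  rewrite invfM [a ^+ n * x ^+ n]mulrC -!mulrA [RHS]mulrCA; congr (_ * _).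
  by rewrite [RHS]mulrCA; congr (_ * _); rewrite mulrA divff // mul1r.
- move=> b bg.
  have := Glow (b - n%:R); rewrite ltrBlDr => /(_ bg).
  apply: cvgy_eq; exists 1 => x x1 /=.
  have x0 : 0 < x by rewrite (lt_le_trans ltr01).
  by rewrite powR_sub // powR_mulrn ?ltW // invfM mulrA.
Qed.

(** Only the last clause is delicate: L(x) x^e is bounded below by its lower bound on [Y, 2Y], since
    doubling x multiplies it by more than 2^-e * 2^e = 1. *)
Lemma slowly_varying_regvar (L : R -> R) alpha : slowly_varying L ->
  regvar (fun x => x * (x `^ alpha * L x)) (alpha + 1).
Proof.
move=> hL; have [_ Lpos Las] := hL.
have near0 : \forall x \near +oo, 0 < x :> R by apply: nbhs_pinfty_gt; exact: num_real.
have E x : 0 < x -> x * (x `^ alpha * L x) = x `^ (alpha + 1) * L x.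
  move=> x0; rewrite powR_add // powRr1 ?ltW // mulrA.
  by rewrite [x * _]mulrC.
split.
- by apply: filterS2 Lpos near0 => x Lx x0; rewrite !mulr_gt0 ?powR_gt0.
- move=> a a0; have := cvgy_scale (a `^ (alpha + 1)) (Las a a0).
  rewrite mulr1; apply: cvgy_eq; have /neary_ex[X X0 HX] := Lpos.
  exists X => x Xx /=; have x0 : 0 < x by apply: lt_le_trans Xx.
  rewrite !E ?mulr_gt0 // powRM ?ltW // mulrA; have := HX x Xx => Lx.
  by field; rewrite ?gt_eqF ?powR_gt0.
(* Half of the gap: one e pays for the decay of [L], the other leaves a factor x^-e tending to 0. *)
- move=> b bg; pose e := (alpha + 1 - b) / 2.
  have e0 : 0 < e by rewrite divr_gt0 ?subr_gt0.
  have qlt : (2 : R) `^ (- e) < 1.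
    rewrite powRN invf_lt1 ?powR_gt0 // /powR pnatr_eq0 /= expR_gt1 mulr_gt0 ?ln_gt0 ?ltr1n //.
  have H : \forall x \near +oo, 2 `^ (- e) < L (2 * x) / L x by exact: (@cvgr_gt _ _ _ _ _ _ (Las 2 ltr0n2) _ qlt).
  have [X X0 HX] := neary_and Lpos H.
  have [Y [m [XY Y0 m0 Lm]]] := slowly_varying_lower hL X.
  pose K := m * Y `^ e.
  have K0 : 0 < K by rewrite mulr_gt0 ?powR_gt0.
  have LK n : forall x, Y <= x <= 2 ^+ n.+1 * Y -> K <= L x * x `^ e.
    elim: n => [|n IH] x /andP[Yx xn].
      rewrite expr1 in xn; have x0 : 0 < x by exact: lt_le_trans Yx.
      have mL : m <= L x by apply: Lm; rewrite Yx.
      have Yex : Y `^ e <= x `^ e by apply: ge0_ler_powR; rewrite ?nnegrE ?(ltW e0) ?(ltW Y0) ?(ltW x0).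
      by rewrite /K ler_pM ?powR_ge0 // ltW.
    have [xn'|xn'] := leP x (2 ^+ n.+1 * Y); first by apply: IH; rewrite Yx.
    pose y := x / 2; have Yy : Y <= y.
      rewrite ler_pdivlMr // mulrC; apply: le_trans (ltW xn').
      by rewrite ler_wpM2r ?(ltW Y0) // exprS ler_peMr // exprn_ege1 // ler1n.
    have y0 : 0 < y by exact: lt_le_trans Yy.
    have /IH Ky : Y <= y <= 2 ^+ n.+1 * Y.
      by rewrite Yy /= ler_pdivrMr // mulrAC -exprSr.
    have [Ly L2y] := HX y (le_trans XY Yy).
    have -> : x = 2 * y by rewrite /y mulrC divfK.
    apply: le_trans Ky _; rewrite powRM ?(ltW y0) // mulrA ler_wpM2r ?powR_ge0 //.
    rewrite -ler_pdivrMr ?powR_gt0 // -powRN mulrC.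
    by rewrite -ler_pdivlMr // ltW.
  have H0 : (fun x => K^-1 * x `^ (- e)) @ +oo --> 0.
    rewrite -[X in _ --> X](mulr0 K^-1); apply: cvgy_scale.
    by apply: powR_cvgy0; rewrite oppr_lt0.
  apply: (squeeze_cvgr _ (cvg_cst 0) H0); apply/neary_ex; exists Y => // x Yx.
  have x0 : 0 < x by apply: lt_le_trans Yx.
  have [n /andP[_ xn]] := dyadic_scale Y0 Yx.
  have KL : K <= L x * x `^ e by apply: (LK n); rewrite Yx ltW.
  have L0 : 0 < L x by have [] := HX x (le_trans XY Yx).
  rewrite E // divr_ge0 ?mulr_ge0 ?powR_ge0 ?(ltW L0) //=.
  rewrite ler_pdivrMr ?mulr_gt0 ?powR_gt0 // -mulrA ler_pdivlMl //.
  have -> : x `^ (- e) * (x `^ (alpha + 1) * L x) = L x * x `^ e * x `^ b.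
    have -> : alpha + 1 = b + e + e by rewrite /e; field.
    rewrite (powR_add _ _ x0) (powR_add _ _ x0) powRN; field; rewrite gt_eqF ?powR_gt0 //.
  by rewrite ler_wpM2r ?powR_ge0.
Qed.

End at_infinity.

(** * Functionals bounded on bounded families *)

Section gliding_hump.
Context {R : realType}.

Lemma ssum_split (a : nat -> R) C : (forall k, `|a k| <= C) -> forall n,
  ssum a = \sum_(i < n) 3^-1 ^+ i * a i + 3^-1 ^+ n * ssum (fun k => a (n + k)%N).
Proof.
move=> aC; elim=> [|n IH]; first by rewrite big_ord0 add0r expr0 mul1r.
have aC' k : `|a (n + k)%N| <= C by [].
rewrite IH big_ord_recr /= -addrA; congr (_ + _).
rewrite (ssum_rec aC') mulrDr addn0 exprSr mulrA; congr (_ + _ * ssum _).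
by apply/funext => k; rewrite addnS addSn.
Qed.

(** An index reaching 3/4 of the supremum makes all other entries at most 4/3 of it; the given large
    entry is kept if it qualifies. *)
Lemma near_max (t : nat -> R) B : (exists C, forall j, `|t j| <= C) -> 0 <= B ->
  (exists j, B < `|t j|) ->
  exists j, B < `|t j| /\ forall i, `|t i| <= 4 / 3 * `|t j|.
Proof.
move=> [C tC] B0 [j0 Bj0].
pose E := [set `|t j| | j in [set: nat]].
have hE : has_sup E.
  split; first by exists `|t 0%N|; exists 0%N.
  by exists C => _ [j _ <-].
have ubE j : `|t j| <= sup E by apply: ub_le_sup; [case: hE|exists j].
have [j0s|sj0] := leP (3 / 4 * sup E) `|t j0|.
  by exists j0; split => // i; have := ubE i; lra.
have s0 : 0 < sup E by apply: lt_le_trans (ubE j0); exact: le_lt_trans Bj0.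
have e0 : 0 < sup E / 4 by rewrite divr_gt0.
have [_ [j _ <-] sj] := sup_adherent e0 hE.
exists j; split; first by lra.
by move=> i; have := ubE i; lra.
Qed.

(** If the table were unbounded, choose successively rows and columns so that in the k-th chosen row
    the k-th term of the weighted sum dominates: earlier columns contribute at most [S k] by column
    bounds, later ones at most 8/9 of that term by near maximality. The sum along [sigma] then
    exceeds k in that row. *)
Lemma gliding_hump (t : nat -> nat -> R) :
  (forall n, exists B, forall j, `|t n j| <= B) ->
  (forall j, exists B, forall n, `|t n j| <= B) ->
  (forall sigma : nat -> nat, exists B, forall n, `|ssum (fun k => t n (sigma k))| <= B) ->
  exists B, forall n j, `|t n j| <= B.
Proof.
move=> row col sums; apply: contrapT => /forallNP unb.
have {}unb B : 0 <= B -> exists nj : nat * nat, B < `|t nj.1 nj.2| /\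
    forall i, `|t nj.1 i| <= 4 / 3 * `|t nj.1 nj.2|.
  move=> B0; have /existsNP[n /existsNP[j /negP]] := unb B; rewrite -ltNge => Bt.
  have [j' Hj'] := near_max (row n) B0 (ex_intro _ j Bt).
  by exists (n, j').
have [C HC] := choice col.
have C0 j : 0 <= C j by apply: le_trans (HC j 0%N).
(* The factor 9 offsets the 1/9 left after the later terms, and 3^k the weight: what remains of the
   k-th term exceeds k + S, and subtracting the earlier terms leaves more than k. *)
pose B (k : nat) (S : R) := 9 * 3 ^+ k * (k%:R + `|S|).
have B0 k S : 0 <= B k S by rewrite !mulr_ge0 ?exprn_ge0 ?addr_ge0.
have [pick Hpick] := choice (fun kS : nat * R => unb _ (B0 kS.1 kS.2)).
(* Bound for the contribution of the columns already chosen; it is known before the k-th choice, so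
   the recursion is well founded. *)
pose S := fix S k := if k is k'.+1 then S k' + 3^-1 ^+ k' * C (pick (k', S k')).2 else 0.
pose sigma k := (pick (k, S k)).2.
have Spos k : 0 <= S k.
  by elim: k => //= k IH; rewrite addr_ge0 ?mulr_ge0 ?exprn_ge0 ?invr_ge0.
have SE k : S k = \sum_(i < k) 3^-1 ^+ i * C (sigma i).
  by elim: k => [|k IH]; rewrite ?big_ord0 // big_ord_recr /= -IH.
have [A HA] := sums sigma.
pose k := (Num.truncn A).+1.
pose n := (pick (k, S k)).1.
have [H1 H2] := Hpick (k, S k).
have {}H1 : B k (S k) < `|t n (sigma k)| := H1.
have {}H2 : forall i, `|t n i| <= 4 / 3 * `|t n (sigma k)| := H2.
have [D HD] := row n.
have := HA n; rewrite (ssum_split (fun i => HD (sigma i)) k).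
have HD' i : `|t n (sigma (k + i)%N)| <= D by [].
rewrite (ssum_rec HD') addn0.
set T := t n (sigma k) in H1 H2 *.
set U := ssum _; set V := \sum_(i < k) _.
have VS : `|V| <= S k.
  rewrite SE; apply: le_trans (ler_norm_sum _ _ _) _; apply: ler_sum => i _.
  rewrite normrM ger0_norm ?exprn_ge0 ?invr_ge0 // ler_wpM2l ?exprn_ge0 ?invr_ge0 //.
have UT : `|U| <= 2 * (4 / 3 * `|T|) by apply: ssum_bound => i; exact: H2.
have kA : A < k%:R by exact: truncnS_gt.
move=> VA.
have q0 : 0 < (3 : R) ^+ k by rewrite exprn_gt0.
have H3 : 9 * (k%:R + S k) < 3^-1 ^+ k * `|T|.
  rewrite exprVn [_^-1 * _]mulrC ltr_pdivlMr // mulrAC.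
  by have := H1; rewrite /B ger0_norm.
have H4 : 3^-1 ^+ k * `|T| - 3^-1 ^+ k * (3^-1 * `|U|) <= `|3^-1 ^+ k * (T + 3^-1 * U)|.
  rewrite -mulrBr normrM ger0_norm ?exprn_ge0 ?invr_ge0 // ler_wpM2l ?exprn_ge0 ?invr_ge0 //.
  rewrite -[3^-1 * `|U|](_ : `|3^-1 * U| = _); last by rewrite normrM ger0_norm ?invr_ge0.
  by rewrite -[X in _ <= `|_ + X|]opprK; apply: le_trans (lerB_dist _ _); rewrite normrN.
have H5 : 3^-1 ^+ k * (3^-1 * `|U|) <= 3^-1 ^+ k * (8 / 9 * `|T|).
  by rewrite ler_wpM2l ?exprn_ge0 ?invr_ge0 //; lra.
have H6 : `|3^-1 ^+ k * (T + 3^-1 * U)| <= `|V + 3^-1 ^+ k * (T + 3^-1 * U)| + `|V|.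
  set W := 3^-1 ^+ k * (T + 3^-1 * U).
  have {1}-> : W = (V + W) - V by ring.
  exact: ler_normB.
rewrite mulrCA in H5.
have := Spos k; lra.
Qed.

End gliding_hump.

(** * Functionals bounded on bounded families, and uniform boundedness *)

Section functionals.
Context {R : realType} (M : nat -> R) (s : ultraclass).
Hypothesis hM : weight_sequence M.
Implicit Types (u v : R -> R) (f : (R -> R) -> R) (l : R).
Local Notation tf := (tf M s).
Local Notation tfam := (tfam M s).

(* All that is used of the continuity of an ultradistribution *)
Definition ufunc f : Prop :=
  (forall a u v, tf u -> tf v -> f (fun x => a * u x + v x) = a * f u + f v) /\
  (forall (I : Type) (u : I -> R -> R), tfam u -> exists B, forall i, `|f (u i)| <= B).

Variable f : (R -> R) -> R.
Hypothesis hf : ufunc f.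

Lemma tfam_scale (I : Type) (l : I -> R) (u : I -> R -> R) X Y : 0 < X ->
  (forall i, X <= l i <= Y) -> tfam u -> tfam (fun i x => u i (x / l i)).
Proof.
move=> X0 lXY tu.
have := @tfam_dilate _ M s I (fun i => (l i)^-1) u Y^-1 X^-1.
have [iI|nI] := pselect (inhabited I); last first.
  move=> _; split; first by move=> i; exfalso; apply: nI; exists.
    by exists 1 => // i; exfalso; apply: nI; exists.
  by apply: forh_all => h h0; exists 0 => // i; exfalso; apply: nI; exists.
case: iI => i.
have Y0 : 0 < Y by have /andP[H1 H2] := lXY i; apply: lt_le_trans X0 _; exact: le_trans H1 H2.
rewrite invr_gt0 => /(_ Y0) H.
have {}H : tfam (fun i x => u i ((l i)^-1 * x)).
  apply: H => // j; have /andP[H1 H2] := lXY j.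
  have lj : 0 < l j by exact: lt_le_trans H1.
  by rewrite !lef_pV2 ?posrE // H1 H2.
by move: H; congr tfam; apply/funext => j; apply/funext => x; rewrite mulrC.
Qed.

Lemma tf_scale l u : 0 < l -> tf u -> tf (fun x => u (x / l)).
Proof.
move=> l0; apply: (@tfam_scale unit (fun=> l) (fun=> u) l l l0) => _.
by rewrite lexx.
Qed.

Lemma ufunc_ext u v : (forall x, u x = v x) -> f u = f v.
Proof. by move=> /funext ->. Qed.

Lemma ufunc_lin a b u v : tf u -> tf v -> f (fun x => a * u x + b * v x) = a * f u + b * f v.
Proof.
move=> tu tv; case: hf => fl _; rewrite fl //; last first.
  have := tf_lin hM b 0 tv tv; congr tf; apply/funext => x.
  by rewrite mul0r addr0.
congr (_ + _); have t0 : tf (fun x => 0 * v x).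
  have := tf_lin hM 0 0 tv tv; congr tf; apply/funext => x.
  by rewrite !mul0r addr0.
have f0 : f (fun x => 0 * v x) = 0.
  have E : f (fun x => 0 * v x) = -1 * f (fun x => 0 * v x) + f (fun x => 0 * v x).
    by rewrite -fl //; congr f; apply/funext => x; ring.
  by rewrite E mulN1r addNr.
have := fl b _ _ tv t0; rewrite f0 addr0 => <-; congr f; apply/funext => x; ring.
Qed.

(** Countable additivity follows from boundedness alone: the tails [S i] form a bounded family, so
    the defects D i are bounded, and splitting off one term gives D i = D i.+1 / 3. Hence |D 0| <=
    const * 3^-n for all n. *)
Lemma ufunc_ssum (u : nat -> R -> R) : tfam u ->
  f (fun x => ssum (fun k => u k x)) = ssum (fun k => f (u k)).
Proof.
move=> tu; have [fl fb] := hf.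
pose S i x := ssum (fun k => u (i + k)%N x).
have tS : tfam S.
  apply: (@tfam_ssum _ M s hM nat (fun i k => u (i + k)%N)).
  exact: (tfam_reindex (fun ik : nat * nat => (ik.1 + ik.2)%N) tu).
have [B HB] := fb _ _ tu; have [C HC] := fb _ _ tS.
have [A A0 HA] := bfam_bound hM 0 (let: And3 _ _ b := tu in b).
pose g i := ssum (fun k => f (u (i + k)%N)).
have B' i k : `|f (u (i + k)%N)| <= B by [].
have fS i : f (S i) = f (u i) + 3^-1 * f (S i.+1).
  rewrite -(ufunc_ext (u := fun x => 3^-1 * S i.+1 x + u i x)) => [|x].
    by rewrite fl 1?addrC //; exact: tfam_tf.
  rewrite /S [in RHS](@ssum_rec _ _ A) => [|k]; last exact: HA.
  rewrite addn0 addrC; congr (_ + _ * ssum _).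
  by apply/funext => k; rewrite addnS addSn.
have gS i : g i = f (u i) + 3^-1 * g i.+1.
  rewrite /g (ssum_rec (B' i)) addn0; congr (_ + _ * ssum _).
  by apply/funext => k; rewrite addnS addSn.
pose D i := f (S i) - g i.
have DS i : D i = 3^-1 * D i.+1 by rewrite /D fS gS; ring.
have Dn n : D 0%N = 3^-1 ^+ n * D n.
  elim: n => [|n IH]; first by rewrite expr0 mul1r.
  by rewrite IH DS exprSr mulrA.
have Dle i : `|D i| <= C + 2 * B.
  by rewrite (le_trans (ler_normB _ _)) // lerD // ssum_bound.
suff : D 0%N = 0.
  move/eqP; rewrite subr_eq0 => /eqP E; rewrite -[RHS]E.
  by congr f.
apply/eqP; rewrite -normr_le0; apply/ler_addgt0Pl => e e0; rewrite addr0.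
have q0 : 0 <= 3^-1 :> R by rewrite invr_ge0.
have q1 : `|3^-1 : R| < 1 by rewrite ger0_norm // invf_lt1 ?ltr1n.
have := cvg_geometric (C + 2 * B) q1.
move/cvgr0Pnorm_le => /(_ e e0)[n _ Hn]; have := Hn n (leqnn n) => /=.
apply: le_trans; rewrite (Dn n) !normrM mulrC ler_wpM2r //.
by apply: le_trans (Dle n) _; exact: ler_norm.
Qed.

(* Banach-Steinhaus along a bounded sequence of test functions, through the
   map sending a summable sequence to the corresponding combination. *)
Lemma uniform_bound (G : R -> R) (P : (R -> R) -> Prop) (chi : nat -> R -> R) :
  (\forall l \near +oo, 0 < G l) -> tfam chi ->
  (forall j, P (chi j)) ->
  (forall sigma : nat -> nat, P (fun x => ssum (fun k => chi (sigma k) x))) ->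
  (forall u, tf u -> P u ->
    exists B, \forall l \near +oo, `|f (fun x => u (x / l))| <= B * G l) ->
  exists B X, [/\ 0 < X, 0 <= B & forall l j, X <= l -> `|f (fun x => chi j (x / l))| <= B * G l].
Proof.
move=> /neary_ex[X0 X00 HG] tchi Pchi Psum bound.
apply: contrapT => H.
have {}H (n : nat) : exists lj : R * nat, X0 + n%:R <= lj.1 /\
    n%:R * G lj.1 < `|f (fun x => chi lj.2 (x / lj.1))|.
  apply: contrapT => Hn; apply: H; exists n%:R, (X0 + n%:R); split => //.
    by rewrite ltr_wpDr.
  move=> l j Xl; rewrite leNgt; apply/negP => Hl; apply: Hn.
  by exists (l, j).
have [lj Hlj] := choice H.
pose l n := (lj n).1; pose jj n := (lj n).2.
have lX n : X0 + n%:R <= l n by case: (Hlj n).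
have l0 n : 0 < l n by apply: lt_le_trans (lX n); rewrite ltr_wpDr.
have Gl n : 0 < G (l n) by apply: HG; apply: le_trans (lX n); rewrite lerDl.
(* The bound is known for large l only; the finitely many remaining scales [l n] are added to it. *)
have fbound u : tf u -> P u -> exists B, forall n, `|f (fun x => u (x / l n)) / G (l n)| <= B.
  move=> tu Pu; have [B /neary_ex[X X1 HX]] := bound u tu Pu.
  pose N := (Num.truncn X).+1.
  pose A := \sum_(n < N) `|f (fun x => u (x / l n)) / G (l n)|.
  exists (A + `|B|) => n; have [Nn|nN] := leqP N n.
    apply: (@le_trans _ _ `|B|); last by rewrite lerDr sumr_ge0.
    rewrite normrM normfV (gtr0_norm (Gl n)) ler_pdivrMr //.
    apply: le_trans (HX (l n) _) _; last by rewrite ler_wpM2r ?ler_norm // ltW.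
    apply: le_trans (ltW (truncnS_gt X)) _; apply: le_trans (lX n).
    by apply: (@le_trans _ _ n%:R); rewrite ?ler_nat // lerDr ltW.
  rewrite /A (bigD1 (Ordinal nN)) //= -addrA lerDl addr_ge0 //.
  exact: sumr_ge0.
have [_ fb] := hf.
have tchil n : tfam (fun j x => chi j (x / l n)).
  by apply: (@tfam_scale _ (fun=> l n) _ (l n) (l n)) => // _; rewrite lexx.
have [B HB] : exists B, forall n j, `|f (fun x => chi j (x / l n)) / G (l n)| <= B.
  (* Rows are the scales [l n], columns the functions [chi j]: rows are bounded by continuity of
     [f], columns by [bound], and weighted sums of columns by [bound] applied to the summed test
     function. *)
  apply: gliding_hump.
  - move=> n; have [B HB] := fb _ _ (tchil n).
    exists (B / G (l n)) => j.
    by rewrite normrM normfV (gtr0_norm (Gl n)) ler_pM2r ?invr_gt0.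
  - by move=> j; apply: fbound => //; exact: tfam_tf tchi.
  - move=> sigma.
    have tsig : tfam (fun k => chi (sigma k)) by exact: (tfam_reindex sigma tchi).
    have tS : tf (fun x => ssum (fun k => chi (sigma k) x)).
      apply: (@tfam_ssum _ M s hM unit (fun _ k => chi (sigma k))).
      exact: (tfam_reindex (fun ik : unit * nat => ik.2) tsig).
    have [B HB] := fbound _ tS (Psum sigma); exists B => n.
    rewrite (_ : ssum _ = f (fun x => ssum (fun k => chi (sigma k) (x / l n))) / G (l n)) //.
    rewrite (ufunc_ssum (u := fun k x => chi (sigma k) (x / l n))); last first.
      exact: (tfam_reindex sigma (tchil n)).
    have [C HC] := fb _ _ (tfam_reindex sigma (tchil n)).
    have := @ssum_lin _ _ _ (G (l n))^-1 0 _ _ HC HC.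
    rewrite mul0r addr0 mulrC => <-; congr ssum; apply/funext => k /=.
    by rewrite mul0r addr0 mulrC.
pose n := (Num.truncn B).+1.
have [_] := Hlj n; rewrite -/(l n) -/(jj n) -ltr_pdivlMr //; apply/negP; rewrite -leNgt.
have := HB n (jj n); rewrite normrM normfV (gtr0_norm (Gl n)) => /le_trans; apply.
exact: ltW (truncnS_gt B).
Qed.

End functionals.

(** * Cutoff functions *)

Section box.
Context {R : realType}.
Notation mu := (@lebesgue_measure R).
Implicit Types (v w : R -> R) (a x y r : R).

(** The constant 2 is the slope of the trapezoid below; averaging preserves it. *)
Definition lipc v : Prop :=
  (forall x y, `|v x - v y| <= 2 * `|x - y|) /\ exists r, forall x, r <= `|x| -> v x = 0.

Definition prim v x := \int[mu]_(t in `]-oo, x]) v t.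

Lemma lipc_continuous v : lipc v -> continuous v.
Proof.
move=> [lv _] x; apply/cvgrPdist_le => e e0.
near=> y; apply: le_trans (lv _ _) _.
rewrite mulrC -ler_pdivlMr //; near: y.
by apply: cvgr_dist_le; [exact: cvg_id|exact: divr_gt0].
Unshelve. all: by end_near. Qed.

Lemma lipc_integrable v : lipc v -> mu.-integrable setT (EFin \o v).
Proof.
move=> lv; have [_ [r vr]] := lv.
have -> : EFin \o v = (EFin \o v) \_ `[- r, r].
  apply/funext => x; rewrite patchE; case: ifPn => // xr /=; rewrite vr //.
  rewrite leNgt; apply/negP => xr'; move/negP: xr; apply.
  by rewrite inE /= in_itv /= -ler_norml ltW.
have mI : measurable (`[- r, r]%classic : set (measurableTypeR R)) by exact: measurable_itv.
apply/(integrable_mkcond _ mI).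
apply: continuous_compact_integrable; first exact: segment_compact.
by apply: continuous_subspaceT; exact: lipc_continuous.
Qed.

Lemma primP v x : lipc v -> is_derive x 1 (prim v) (v x).
Proof.
move=> lv.
have cx : {for x, continuous v} by exact: lipc_continuous.
have [] := @continuous_FTC1 R v -oo%O x (x + 1) _ _ _ cx.
- by rewrite ltrDl.
- by apply: integrableS (lipc_integrable lv) => //; exact: measurable_itv.
- by rewrite /= ltNyr.
by move=> dv <-; rewrite derive1E; apply/derivableP.
Qed.

(** The mean of [v] over [x - a, x + a], that is, convolution with a normalized indicator, written
    with a primitive so that its derivative is a difference quotient. *)
Definition box a v x := (prim v (x + a) - prim v (x - a)) / (2 * a).

Lemma box_derive a v x : 0 < a -> lipc v ->
  is_derive x 1 (box a v) ((v (x + a) - v (x - a)) / (2 * a)).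
Proof.
move=> a0 lv.
have sh b : is_derive x 1 (fun y : R => y + b) (1 + 0).
  exact: deriv_add (is_derive_id x 1) (is_derive_cst b x 1).
have d1 := deriv_comp (v := fun y => y + a) (primP (x + a) lv) (sh a).
have d2 := deriv_comp (v := fun y => y - a) (primP (x - a) lv) (sh (- a)).
have -> : box a v = (fun y => (2 * a)^-1 * (prim v (y + a) + -1 * prim v (y - a))).
  by apply/funext => y; rewrite /box mulrC mulN1r.
apply: is_derive_eq (deriv_scale (2 * a)^-1 (deriv_add d1 (deriv_scale (-1) d2))) _.
by rewrite addr0 !mulr1 mulN1r mulrC.
Qed.

(** Mean value theorem for the primitive of v - w. Sup bounds, supports, Lipschitz constants and
    convergence of iterated means are all read off from it. *)
Lemma box_value a v w x : 0 < a -> lipc v -> lipc w ->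
  exists2 y, `|y - x| <= a & box a v x - box a w x = v y - w y.
Proof.
move=> a0 lv lw.
pose g y := prim v y + (-1) * prim w y.
have gd y : is_derive y 1 g (v y + (-1) * w y).
  exact: deriv_add (primP y lv) (deriv_scale _ (primP y lw)).
have ab : x - a <= x + a by lra.
have gc : {within `[x - a, x + a], continuous g}.
  apply: continuous_subspaceT => y; apply: differentiable_continuous.
  by apply/derivable1_diffP; have [] := gd y.
have [y yx gy] := @MVT_segment _ g _ _ _ ab (fun y _ => gd y) gc.
exists y; first by move: yx; rewrite in_itv /= ler_distl.
rewrite /box -mulrBl; apply: (@mulIf _ (2 * a)); first by rewrite gt_eqF ?mulr_gt0.
rewrite divfK ?gt_eqF ?mulr_gt0 //; rewrite /g in gy.
have -> : 2 * a = x + a - (x - a) by ring.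
have -> : v y - w y = v y + -1 * w y by ring.
rewrite -gy; ring.
Qed.

Lemma lipc0 : lipc (fun=> 0).
Proof. by split=> [x y|]; [rewrite subrr normr0 mulr_ge0|exists 0]. Qed.

Lemma box_value1 a v x : 0 < a -> lipc v ->
  exists2 y, `|y - x| <= a & box a v x = v y.
Proof.
move=> a0 lv; have [y yx] := box_value x a0 lv lipc0.
rewrite subr0 => E; exists y => //; rewrite -E.
suff -> : box a (fun=> 0) x = 0 by rewrite subr0.
by rewrite /box /prim /Rintegral !integral0 subrr mul0r.
Qed.

Lemma lipc_shift v b : lipc v -> lipc (fun x => v (x + b)).
Proof.
move=> [lv [r vr]]; split=> [x y|].
  by apply: le_trans (lv _ _) _; rewrite opprD addrACA subrr addr0.
exists (r + `|b|) => x rx; apply: vr.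
have := ler_normB (x + b) b; rewrite addrK; lra.
Qed.

Lemma box_shift a v b x : 0 < a -> lipc v -> box a (fun x => v (x + b)) x = box a v (x + b).
Proof.
move=> a0 lv.
pose g y := prim (fun x => v (x + b)) y + (-1) * prim v (y + b).
have gd y : is_derive y 1 g 0.
  have sh : is_derive y 1 (fun y : R => y + b) (1 + 0).
    exact: deriv_add (is_derive_id y 1) (is_derive_cst b y 1).
  apply: is_derive_eq (deriv_add (primP y (lipc_shift b lv))
    (deriv_scale (-1) (deriv_comp (v := fun y => y + b) (primP (y + b) lv) sh))) _.
  by rewrite addr0 mulr1 mulN1r subrr.
have := @mvt_le _ g (fun=> 0) (x - a) (x + a) 0 gd.
rewrite normr0 mul0r => /(_ (fun _ _ => lexx 0)).
rewrite normr_le0 subr_eq0 => /eqP gE; rewrite /box; congr (_ / _).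
have -> : x + b + a = x + a + b by ring.
have -> : x + b - a = x - a + b by ring.
by move: gE; rewrite /g; lra.
Qed.

Lemma lipc_box a v : 0 < a -> lipc v -> lipc (box a v).
Proof.
move=> a0 lv; have [lv2 [r vr]] := lv; split=> [x y|].
  have := box_shift (y - x) x a0 lv; rewrite subrKC => <-.
  have [z _ ->] := box_value x a0 lv (lipc_shift (y - x) lv).
  by apply: le_trans (lv2 _ _) _; rewrite opprD addrA subrr add0r normrN distrC.
exists (r + a) => x rx; have [y yx ->] := box_value1 x a0 lv; apply: vr.
have := ler_normD y (x - y); rewrite subrKC distrC; lra.
Qed.

End box.

Section iterated_box.
Context {R : realType} (c : nat -> R).
Hypothesis c0 : forall q, 0 < c q.
Hypothesis csum : forall q n, \sum_(i < n) c (q + i)%N <= 1 / 4.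
Implicit Types (x y : R) (q k n p : nat).

(** Equal to 1 up to 5/4 and to 0 from 7/4 on. Means of total half-width at most 1/4 then leave it
    equal to 1 on [-1, 1] and to 0 outside ]-2, 2[. *)
Definition trapezoid x : R := Num.min 1 (Num.max 0 (2 * (7 / 4 - `|x|))).

Lemma trapezoid_lipc : lipc trapezoid.
Proof.
rewrite /trapezoid; split=> [x y|]; last first.
  exists (7 / 4) => x rx; rewrite max_l; last by lra.
  by rewrite min_r.
have H : `| `|x| - `|y| | <= `|x - y| by exact: ler_dist_dist.
move: H; rewrite !ler_norml => /andP[H1 H2].
rewrite /Num.min /Num.max; do ?case: ifPn; rewrite -?leNgt => *; apply/andP; split; lra.
Qed.

Lemma trapezoid1 x : `|x| <= 5 / 4 -> trapezoid x = 1.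
Proof. by move=> x1; rewrite /trapezoid min_l // le_max; apply/orP; right; lra. Qed.

Lemma trapezoid0 x : 7 / 4 <= `|x| -> trapezoid x = 0.
Proof. by move=> x1; rewrite /trapezoid max_l ?min_r //; lra. Qed.

Lemma trapezoid_le1 x : `|trapezoid x| <= 1.
Proof.
rewrite /trapezoid ger0_norm; first by rewrite ge_min lexx.
by rewrite le_min ler01 le_max lexx.
Qed.

(** The half-widths are c q, ..., c (q + k - 1), the last one applied first. Passing to k + 1
    therefore changes only the innermost function, and the outer means propagate the error without
    enlarging it. *)
Fixpoint boxes k q : R -> R :=
  if k is k'.+1 then box (c q) (boxes k' q.+1) else trapezoid.

Lemma boxes_lipc k : forall q, lipc (boxes k q).
Proof.
elim: k => [q|k IH q]; first exact: trapezoid_lipc.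
exact: lipc_box (IH _).
Qed.

Lemma boxes_le1 k : forall q x, `|boxes k q x| <= 1.
Proof.
elim: k => [q x|k IH q x]; first exact: trapezoid_le1.
by have [y _ /= ->] := box_value1 x (c0 q) (boxes_lipc k q.+1).
Qed.

Lemma sum_shift q k : \sum_(i < k.+1) c (q + i)%N = c q + \sum_(i < k) c (q.+1 + i)%N.
Proof.
rewrite big_ord_recl addn0; congr (_ + _); apply: eq_bigr => i _.
by rewrite lift0 addnS addSn.
Qed.

Lemma boxes1 k : forall q x, `|x| <= 5 / 4 - \sum_(i < k) c (q + i)%N -> boxes k q x = 1.
Proof.
elim: k => [q x|k IH q x]; first by rewrite big_ord0 subr0; exact: trapezoid1.
rewrite sum_shift => xs.
have [y yx /= ->] := box_value1 x (c0 q) (boxes_lipc k q.+1); apply: IH.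
by have := ler_normD (y - x) x; rewrite subrK; lra.
Qed.

Lemma boxes0 k : forall q x, 7 / 4 + \sum_(i < k) c (q + i)%N <= `|x| -> boxes k q x = 0.
Proof.
elim: k => [q x|k IH q x]; first by rewrite big_ord0 addr0; exact: trapezoid0.
rewrite sum_shift => xs.
have [y yx /= ->] := box_value1 x (c0 q) (boxes_lipc k q.+1); apply: IH.
by have := ler_normD y (x - y); rewrite subrKC distrC; lra.
Qed.

Lemma boxes_step k : forall q x, `|boxes k.+1 q x - boxes k q x| <= 2 * c (q + k)%N.
Proof.
elim: k => [q x|k IH q x].
  rewrite addn0 /=; have [y yx ->] := box_value1 x (c0 q) trapezoid_lipc.
  apply: le_trans (proj1 trapezoid_lipc _ _) _; by rewrite ler_wpM2l.
have [y _ /= ->] := box_value x (c0 q) (boxes_lipc k.+1 q.+1) (boxes_lipc k q.+1).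
by apply: le_trans (IH _ _) _; rewrite addSn addnS.
Qed.

Lemma boxes_diff k n q x : `|boxes (k + n) q x - boxes k q x| <= 2 * \sum_(i < n) c (q + k + i)%N.
Proof.
elim: n => [|n IH]; first by rewrite addn0 subrr normr0 big_ord0 mulr0.
rewrite big_ord_recr /= mulrDr addnS.
have -> : boxes (k + n).+1 q x - boxes k q x =
  (boxes (k + n) q x - boxes k q x) + (boxes (k + n).+1 q x - boxes (k + n) q x) by ring.
apply: le_trans (ler_normD _ _) (lerD IH _).
by rewrite -addnA; exact: boxes_step.
Qed.

Let csum_cvg q : cvgn (fun n => \sum_(i < n) c (q + i)%N).
Proof.
apply: nondecreasing_is_cvgn.
  apply/nondecreasing_seqP => n; rewrite big_ord_recr /= lerDl; exact: ltW.
by exists (1 / 4) => _ [n _ <-].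
Qed.

Let tail q k : R := limn (fun n => \sum_(i < n) c (q + i)%N) - \sum_(i < k) c (q + i)%N.

Let tail_ge q k n : \sum_(i < n) c (q + k + i)%N <= tail q k.
Proof.
rewrite /tail lerBrDr addrC.
have -> : \sum_(i < k) c (q + i)%N + \sum_(i < n) c (q + k + i)%N = \sum_(i < k + n) c (q + i)%N.
  by rewrite big_split_ord /=; congr (_ + _); apply: eq_bigr => i _; rewrite addnA.
apply: (@nondecreasing_cvgn_le _ _ _ (@csum_cvg q)).
apply/nondecreasing_seqP => m; rewrite big_ord_recr /= lerDl; exact: ltW.
Qed.

Let tail_cvg q : tail q @ \oo --> 0.
Proof.
rewrite -[X in _ --> X](subrr (limn (fun n => \sum_(i < n) c (q + i)%N))).
apply: cvgB; [exact: cvg_cst|exact: csum_cvg].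
Qed.

Definition boxlim q x : R := limn (fun k => boxes k q x).

Let boxes_cvg q x : cvgn (fun k => boxes k q x).
Proof.
pose d i := boxes i.+1 q x - boxes i q x.
have sd : cvgn (series d).
  apply: normed_cvg; apply: (@series_le_cvg _ _ (fun i => 2 * c (q + i)%N)) => //=.
  - by move=> i; rewrite mulr_ge0 // ltW.
  - by move=> i; exact: boxes_step.
  - have -> : series (fun i => 2 * c (q + i)%N) = (fun n => 2 * \sum_(i < n) c (q + i)%N).
      by apply/funext => n; rewrite /series /= big_mkord mulr_sumr.
    apply/cvg_ex; exists (2 * limn (fun n => \sum_(i < n) c (q + i)%N)).
    by apply: cvgM; [exact: cvg_cst|exact: csum_cvg].
apply/cvg_ex; exists (limn (series d) + boxes 0 q x).
have -> : (fun k => boxes k q x) = (fun k => series d k + boxes 0 q x).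
  by apply/funext => k; rewrite /series /= telescope_sumr // subrK.
by apply: cvgD; [exact: sd|exact: cvg_cst].
Qed.

Let boxlim_near q x k : `|boxlim q x - boxes k q x| <= 2 * tail q k.
Proof.
have H : (fun n => `|boxes (n + k)%N q x - boxes k q x|) @ \oo --> `|boxlim q x - boxes k q x|.
  apply: cvg_norm; apply: cvgB; last exact: cvg_cst.
  by have := @boxes_cvg q x; rewrite -(cvg_shiftn k).
apply: (cvgr_to_le H); apply: nearW => n.
rewrite addnC; apply: le_trans (boxes_diff _ _ _ _) _.
by rewrite ler_wpM2l // tail_ge.
Qed.

Lemma boxlim_le1 q x : `|boxlim q x| <= 1.
Proof.
by apply: (cvgr_to_le (cvg_norm (@boxes_cvg q x))); apply: nearW => n; exact: boxes_le1.
Qed.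

Lemma boxlim_eq q x v : (forall k, boxes k q x = v) -> boxlim q x = v.
Proof.
by move=> E; rewrite /boxlim (_ : (fun k => _) = fun=> v) ?lim_cst //; apply/funext.
Qed.

Lemma boxlim1 q x : `|x| <= 1 -> boxlim q x = 1.
Proof.
by move=> x1; apply: boxlim_eq => k; apply: boxes1; have := csum q k; lra.
Qed.

Lemma boxlim0 q x : 2 <= `|x| -> boxlim q x = 0.
Proof.
by move=> x1; apply: boxlim_eq => k; apply: boxes0; have := csum q k; lra.
Qed.

Lemma boxlim_lipc q : lipc (boxlim q).
Proof.
split=> [x y|]; last by exists 2 => x; exact: boxlim0.
apply: (cvgr_to_le (cvg_norm (cvgB (@boxes_cvg q x) (@boxes_cvg q y)))).
by apply: nearW => n; have [lb _] := boxes_lipc n q; exact: lb.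
Qed.

Lemma boxlim_box q x : boxlim q x = box (c q) (boxlim q.+1) x.
Proof.
apply/eqP; rewrite -subr_eq0 -normr_le0; apply/ler_addgt0Pl => e e0; rewrite addr0.
have t0 : (fun k => 2 * tail q k.+1 + 2 * tail q.+1 k) @ \oo --> 0.
  have -> : 0 = 2 * 0 + 2 * 0 :> R by rewrite mulr0 addr0.
  apply: cvg_lin; last exact: tail_cvg.
  by have := @tail_cvg q; rewrite -cvg_shiftS.
have /cvgr0Pnorm_le /(_ e e0) [k _ Hk] := t0.
apply: le_trans (Hk k (leqnn k)); apply: le_trans (ler_norm _).
have -> : boxlim q x - box (c q) (boxlim q.+1) x = (boxlim q x - boxes k.+1 q x) -
  (box (c q) (boxlim q.+1) x - box (c q) (boxes k q.+1) x) by rewrite /=; ring.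
apply: le_trans (ler_normB _ _) (lerD (boxlim_near _ _ _) _).
have [y _ ->] := box_value x (c0 q) (boxlim_lipc q.+1) (boxes_lipc k q.+1).
exact: boxlim_near.
Qed.

(** Each derivative consumes one mean, from [boxlim_box]: it is the difference quotient of step 2 c
    of a function one level deeper, which costs a factor 2 / (2 c) = 1 / c. *)
Fixpoint box_jet p q x : R :=
  if p is p'.+1 then (box_jet p' q.+1 (x + c q) - box_jet p' q.+1 (x - c q)) / (2 * c q)
  else boxlim q x.

Lemma box_jetP p : forall q x, is_derive x 1 (box_jet p q) (box_jet p.+1 q x).
Proof.
have sh b x : is_derive x 1 (fun y : R => y + b) (1 + 0).
  exact: deriv_add (is_derive_id x 1) (is_derive_cst b x 1).
elim: p => [|p IH] q x.
  have -> : box_jet 0 q = box (c q) (boxlim q.+1) by apply/funext => y; exact: boxlim_box.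
  exact: box_derive (boxlim_lipc _).
have -> : box_jet p.+1 q = (fun y => (2 * c q)^-1 * (box_jet p q.+1 (y + c q) + -1 * box_jet p q.+1 (y - c q))).
  by apply/funext => y /=; rewrite mulrC mulN1r.
have d1 := deriv_comp (v := fun y => y + c q) (IH q.+1 (x + c q)) (sh (c q) x).
have d2 := deriv_comp (v := fun y => y - c q) (IH q.+1 (x - c q)) (sh (- c q) x).
apply: is_derive_eq (deriv_scale (2 * c q)^-1 (deriv_add d1 (deriv_scale (-1) d2))) _.
by rewrite addr0 !mulr1 mulN1r mulrC.
Qed.

Lemma box_jet_le p : forall q x, `|box_jet p q x| <= \prod_(i < p) (c (q + i)%N)^-1.
Proof.
elim: p => [q x|p IH q x]; first by rewrite big_ord0; exact: boxlim_le1.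
rewrite big_ord_recl addn0 /=.
have -> : \prod_(i < p) (c (q + lift ord0 i)%N)^-1 = \prod_(i < p) (c (q.+1 + i)%N)^-1.
  by apply: eq_bigr => i _; rewrite lift0 addnS addSn.
have c2 : 0 < 2 * c q by rewrite mulr_gt0.
rewrite normrM normfV (gtr0_norm c2) ler_pdivrMr //.
apply: le_trans (ler_normB _ _) _; apply: le_trans (lerD (IH _ _) (IH _ _)) _.
rewrite mulrAC [2 * _]mulrC mulrA mulVf ?gt_eqF // mul1r; lra.
Qed.

End iterated_box.

(** * Choice of the widths from the weight sequence *)

Section cutoff.
Context {R : realType} (M : nat -> R) (s : ultraclass).
Hypothesis hM : weight_sequence M.
Let M0 := weight_gt0 hM.

(** This is (M.3) for p = 1, with the ratio of index 0 added. *)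
Lemma weight_ratio_summable : exists B : R, forall n,
  \sum_(i < n) M i / M i.+1 <= B.
Proof.
have [_ _ _ [A A0 HA]] := hM.
exists (M 0%N / M 1%N + A * 1%:R * (M 1%N / M 2)) => -[|n].
  by rewrite big_ord0 addr_ge0 ?mulr_ge0 ?invr_ge0 // ltW.
rewrite big_ord_recl /= lerD2l -lee_fin.
apply: le_trans (HA 1%N (leqnn _)).
have H := @nneseries_lim_ge R (fun q => (M q.-1 / M q)%:E) xpredT 2%N n.+2.
apply: le_trans (H _); last first.
  by move=> q _ _; rewrite lee_fin divr_ge0 // ltW.
rewrite 2!big_add1 /= big_mkord sumEFin lee_fin.
by apply: ler_sum => i _; rewrite /bump /= add1n.
Qed.

(** Take [b] to be the square root of the remainder r of the series. Then m n / b n = (r n - r n.+1)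
    / sqrt (r n) <= 2 (sqrt (r n) - sqrt (r n.+1)), which telescopes. *)
Lemma summable_improve (m : nat -> R) B : (forall q, 0 < m q) ->
  (forall n, \sum_(i < n) m i <= B) ->
  exists b : nat -> R, [/\ forall q, 0 < b q, b @ \oo --> 0 &
    exists C, forall n, \sum_(i < n) m i / b i <= C].
Proof.
move=> m0 mB.
pose S n := \sum_(i < n) m i.
have Snd : {homo S : n k / (n <= k)%N >-> n <= k}.
  by apply/nondecreasing_seqP => n; rewrite /S big_ord_recr /= lerDl ltW.
have Scv : cvgn S.
  by apply: nondecreasing_is_cvgn => //; exists B => _ [n _ <-]; exact: mB.
pose r n := limn S - S n.
have r0 n : 0 < r n.
  rewrite subr_gt0; apply: lt_le_trans (nondecreasing_cvgn_le Snd Scv n.+1).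
  by rewrite /S big_ord_recr /= ltrDl.
have rS n : m n = r n - r n.+1 by rewrite /r /S big_ord_recr /=; ring.
have rc : r @ \oo --> 0.
  by rewrite -[X in _ --> X](subrr (limn S)); apply: cvgB; [exact: cvg_cst|].
exists (fun n => Num.sqrt (r n)); split.
- by move=> q; rewrite sqrtr_gt0.
- apply/cvgr0Pnorm_le => e e0.
  have e2 : 0 < e ^+ 2 by rewrite exprn_gt0.
  have /cvgr0Pnorm_le /(_ _ e2) := rc; apply: filterS => n.
  rewrite !ger0_norm ?sqrtr_ge0 ?(ltW (r0 n)) // => rn.
  by rewrite -[e]gtr0_norm // -sqrtr_sqr ler_wsqrtr.
exists (2 * Num.sqrt (r 0%N)) => n.
apply: (@le_trans _ _ (2 * (Num.sqrt (r 0%N) - Num.sqrt (r n)))); last first.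
  by rewrite ler_pM2l // gerBl sqrtr_ge0.
elim: n => [|n IH]; first by rewrite big_ord0 subrr mulr0.
rewrite big_ord_recr /=.
set a := Num.sqrt (r n) in IH *; set a' := Num.sqrt (r n.+1).
suff : m n / a <= 2 * (a - a') by move: IH; lra.
have a0 : 0 < a by rewrite sqrtr_gt0.
have a'0 : 0 < a' by rewrite sqrtr_gt0.
have a'a : a' <= a by rewrite ler_wsqrtr // -subr_ge0 -rS ltW.
have ra : r n = a ^+ 2 by rewrite sqr_sqrtr // ltW.
have ra' : r n.+1 = a' ^+ 2 by rewrite sqr_sqrtr // ltW.
rewrite ler_pdivrMr // rS ra ra' -subr_ge0.
have -> : 2 * (a - a') * a - (a ^+ 2 - a' ^+ 2) = (a - a') ^+ 2 by ring.
exact: sqr_ge0.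
Qed.

Lemma prod_eventually_le (d : nat -> R) (h : R) Q : 0 < h -> (forall i, 0 <= d i) ->
  (forall i, (Q <= i)%N -> d i <= h) ->
  exists2 E, 0 <= E & forall p, \prod_(i < p) d i <= E * h ^+ p.
Proof.
move=> h0 d0 dh; pose P p := \prod_(i < p) (d i / h).
have P0 p : 0 <= P p by apply: prodr_ge0 => i _; rewrite divr_ge0 // ltW.
exists (\sum_(p < Q.+1) P p); first by apply: sumr_ge0.
move=> p; have -> : \prod_(i < p) d i = P p * h ^+ p.
  rewrite /P prodf_div prodr_const card_ord divfK //.
  by rewrite expf_neq0 // gt_eqF.
rewrite ler_wpM2r ?exprn_ge0 ?(ltW h0) //.
have PQ k : (k <= Q)%N -> P k <= \sum_(p < Q.+1) P p.
  move=> kQ; rewrite (bigD1 (Ordinal (kQ : (k < Q.+1)%N))) //= lerDl.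
  exact: sumr_ge0.
elim: p => [|p IH]; first exact: PQ.
have [pQ|Qp] := ltnP p Q; first exact: PQ.
apply: le_trans IH; rewrite /P big_ord_recr /= ler_piMr //; first exact: P0.
by rewrite ler_pdivrMr // mul1r dh.
Qed.

(** With half-widths proportional to M q / M q.+1 / b q the product of inverses is M p / M 0 times
    the product of the b i / k. As b tends to 0 this is O(h^p M p) for every h, which serves both
    classes. *)
Theorem cutoff_exists : exists chi : R -> R, [/\ tf M s chi,
  forall x, `|x| <= 1 -> chi x = 1 & forall x, 2 <= `|x| -> chi x = 0].
Proof.
have [B HB] := weight_ratio_summable.
have m0 q : 0 < M q / M q.+1 by exact: divr_gt0.
have [b [b0 bc [C HC]]] := summable_improve m0 HB.
(* Normalizes the sum of all half-widths to at most 1/4. *)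
pose k := (4 * (`|C| + 1))^-1.
have k0 : 0 < k by rewrite invr_gt0 mulr_gt0 // ltr_wpDl.
pose c q := k * (M q / M q.+1 / b q).
have c0 q : 0 < c q by rewrite mulr_gt0 // divr_gt0.
have csum q n : \sum_(i < n) c (q + i)%N <= 1 / 4.
  apply: (@le_trans _ _ (\sum_(i < q + n) c i)).
    rewrite big_split_ord /= lerDr; apply: sumr_ge0 => i _; exact: ltW.
  rewrite -mulr_sumr; apply: (@le_trans _ _ (k * C)); first by rewrite ler_pM2l.
  rewrite /k mulrC ler_pdivrMr ?mulr_gt0 ?ltr_wpDl //.
  by have := ler_norm C; lra.
exists (boxlim c 0); split; last 2 first.
- by move=> x; exact: boxlim1.
- by move=> x; exact: boxlim0.
have jt p x := box_jetP c0 csum p 0 x.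
split=> [_||]; first exact: (jet_smooth jt).
  by exists 2 => // _ x x2; apply: boxlim0 => //; exact: ltW.
apply: forh_all => h h0.
have [Q HQ] : exists Q, forall i, (Q <= i)%N -> b i / k <= h.
  have hk : 0 < h * k by exact: mulr_gt0.
  have /cvgr0Pnorm_le /(_ _ hk) [Q _ HQ] := bc.
  exists Q => i Qi; rewrite ler_pdivrMr //; apply: le_trans (HQ i Qi).
  exact: ler_norm.
have d0 i : 0 <= b i / k by rewrite divr_ge0 // ltW.
have [E E0 HE] := prod_eventually_le h0 d0 HQ.
exists (E / M 0%N); first by rewrite divr_ge0 // ltW.
move=> _ p x _; rewrite (jetE jt).
apply: le_trans (box_jet_le c0 csum _ _ _) _.
have -> : \prod_(i < p) (c (0 + i)%N)^-1 = (\prod_(i < p) (b i / k)) * (M p / M 0%N).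
  elim: p => [|p IH]; first by rewrite !big_ord0 mul1r divff ?gt_eqF.
  rewrite !big_ord_recr /= IH add0n /c.
  by field; rewrite ?gt_eqF.
rewrite [leRHS](_ : _ = E * h ^+ p * (M p / M 0%N)); last by ring.
by rewrite ler_wpM2r // divr_ge0 // ltW.
Qed.

End cutoff.

(** * Integrals over the half-line *)

Section improper.
Context {R : realType}.
Notation mu := (@lebesgue_measure R).
Notation pos := (`]0, +oo[%classic : set (measurableTypeR R)).
Implicit Types (f g F : R -> R) (a b s x C : R).

Definition cpos f := forall x, 0 < x -> {for x, continuous f}.

Lemma posE x : pos x <-> 0 < x.
Proof. by rewrite /= in_itv /= andbT. Qed.

Lemma cpos_measurable f : cpos f -> measurable_fun pos (f : measurableTypeR R -> measurableTypeR R).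
Proof.
move=> cf; apply: open_continuous_measurable_fun; first exact: interval_open.
by move=> x; rewrite inE => /posE; exact: cf.
Qed.

Lemma ftc_segment f F a b : 0 < a -> a <= b -> cpos f ->
  (forall x, 0 < x -> is_derive x 1 F (f x)) ->
  (\int[mu]_(x in `[a, b]) (f x)%:E = (F b - F a)%:E)%E.
Proof.
move=> a0; rewrite le_eqVlt => /predU1P[<- _ _|ab cf dF].
  by rewrite set_itv1 integral_set1 subrr.
have cF x : 0 < x -> {for x, continuous F}.
  move=> x0; apply: differentiable_continuous.
  by apply/derivable1_diffP; have [] := dF x x0.
rewrite (@continuous_FTC2 _ f F a b) ?EFinB //.
- apply: continuous_in_subspaceT => x; rewrite inE /= in_itv /= => /andP[ax _].
  by apply: cf; exact: lt_le_trans ax.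
- split.
  + move=> x; rewrite in_itv /= => /andP[ax _].
    by have [] := dF x (lt_trans a0 ax).
  + exact: cvg_at_right_filter (cF a a0).
  + exact: cvg_at_left_filter (cF b (lt_trans a0 ab)).
- move=> x; rewrite in_itv /= => /andP[ax _].
  by rewrite derive1E; have [_ ->] := dF x (lt_trans a0 ax).
Qed.

Definition seg (n : nat) : set (measurableTypeR R) := `[n.+1%:R^-1, n.+1%:R]%classic.

Lemma seg_pos n x : seg n x -> 0 < x.
Proof. by rewrite /seg /= in_itv /= => /andP[+ _]; apply: lt_le_trans; rewrite invr_gt0. Qed.

Lemma seg_in x : 0 < x -> \forall n \near \oo, seg n x.
Proof.
move=> x0; exists (Num.truncn (x + x^-1)).+1 => // n /= xn.
have H : x + x^-1 < n.+1%:R.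
  by apply: lt_le_trans (truncnS_gt _) _; rewrite ler_nat ltnW // ltnS.
have x1 : 0 < x^-1 by rewrite invr_gt0.
rewrite /seg /= in_itv /=; apply/andP; split; last by lra.
by rewrite -[leRHS]invrK lef_pV2 ?posrE //; lra.
Qed.

Lemma seg_measurable n : measurable (seg n).
Proof. exact: measurable_itv. Qed.

Lemma bigcup_seg : \bigcup_n seg n = pos.
Proof.
apply/seteqP; split => [x [n _ /seg_pos /posE]//|x /posE /seg_in[n _ Hn]].
by exists n => //; exact: (Hn n (leqnn n)).
Qed.

Lemma seg_le n : n.+1%:R^-1 <= n.+1%:R :> R.
Proof. by rewrite (@le_trans _ _ 1) ?invf_le1 ?ler1n. Qed.

(** Monotone convergence along the segments [seg n], on each of which the integral is a difference
    of two values of [F]. *)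
Lemma integrable_bounded_prim f F C : cpos f -> (forall x, 0 < x -> 0 <= f x) ->
  (forall x, 0 < x -> is_derive x 1 F (f x)) -> (forall x, 0 < x -> `|F x| <= C) ->
  mu.-integrable pos (EFin \o f).
Proof.
move=> cf f0 dF FC; apply/integrableP.
have mf : measurable_fun pos (EFin \o f).
  by apply/measurable_EFinP; exact: cpos_measurable.
split => //; apply: (@le_lt_trans _ _ (2 * C)%:E); last exact: ltry.
have C0 : 0 <= C by apply: le_trans (FC 1 ltr01).
have -> : (\int[mu]_(x in pos) `|(EFin \o f) x| = \int[mu]_(x in pos) (EFin \o f) x)%E.
  by apply: eq_integral => x; rewrite inE => /posE x0 /=; rewrite ger0_norm // f0.
rewrite -bigcup_seg.
have segnd : {homo seg : n m / (n <= m)%N >-> (n <= m)%O}.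
  move=> n m nm; apply/subsetPset => x; rewrite /seg /= !in_itv /= => /andP[H1 H2].
  apply/andP; split; last by apply: le_trans H2 _; rewrite ler_nat.
  by apply: le_trans H1; rewrite lef_pV2 ?posrE // ler_nat.
have H := @ge0_nondecreasing_set_cvg_integral _ _ _ seg (EFin \o f) mu segnd seg_measurable.
apply: (cvge_to_le (H _ _)) => [n|n x /seg_pos x0|].
- by apply: measurable_funS mf => // y /seg_pos /posE.
- by rewrite /= lee_fin f0.
apply: nearW => n /=; rewrite (@ftc_segment f F) //.
  rewrite lee_fin; apply: le_trans (ler_norm _) _; apply: le_trans (ler_normB _ _) _.
  have n0 : 0 < n.+1%:R^-1 :> R by rewrite invr_gt0.
  have := FC n.+1%:R (ltr0Sn _ _); have := FC _ n0; lra.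
exact: seg_le.
Qed.

Lemma Rintegral_dominated (f_ : nat -> R -> R) f g :
  (forall n, measurable_fun pos (f_ n : measurableTypeR R -> measurableTypeR R)) ->
  (forall x, 0 < x -> f_ n x @[n --> \oo] --> f x) ->
  mu.-integrable pos (EFin \o g) ->
  (forall n x, 0 < x -> `|f_ n x| <= g x) ->
  (\int[mu]_(x in pos) f_ n x) @[n --> \oo] --> \int[mu]_(x in pos) f x.
Proof.
move=> mf fcv ig fg; have mpos : measurable pos by exact: measurable_itv.
have H := @dominated_cvg _ _ _ mu pos mpos (fun n => EFin \o f_ n) (EFin \o f) (EFin \o g).
have fn n : (\int[mu]_(x in pos) (EFin \o f_ n) x)%E \is a fin_num.
  apply: integrable_fin_num => //.
  apply: le_integrable ig => //; first by apply/measurable_EFinP; exact: mf.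
  move=> x /posE x0 /=; rewrite lee_fin.
  by apply: le_trans (fg n x x0) _; exact: ler_norm.
have mlim : measurable_fun pos (f : measurableTypeR R -> measurableTypeR R).
  apply: (measurable_fun_cvg (h := f_)) => // x /posE; exact: fcv.
have fl : (\int[mu]_(x in pos) (EFin \o f) x)%E \is a fin_num.
  apply: integrable_fin_num => //.
  apply: le_integrable ig => //; first by apply/measurable_EFinP.
  move=> x /posE x0 /=; rewrite lee_fin.
  apply: le_trans (_ : g x <= _); last exact: ler_norm.
  apply: (cvgr_to_le (cvg_norm (fcv x x0))); apply: nearW => n; exact: fg.
apply: fine_cvg; rewrite fineK //; apply: H => //.
- by move=> n; apply/measurable_EFinP; exact: mf.
- by move=> x /posE x0; apply: cvg_EFin; [exact: nearW|exact: fcv].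
- by move=> n x /posE x0; rewrite /= lee_fin fg.
Qed.

(** The derivative of -1 / (1 + x^s): an explicit integrable majorant, of order x^(s-1) at 0 and
    x^(-s-1) at infinity. *)
Definition bump s x : R := s * x `^ (s - 1) * ((1 + x `^ s)^-1 * (1 + x `^ s)^-1).

Lemma cpos_derive f : (forall x, 0 < x -> exists l, is_derive x 1 f l) -> cpos f.
Proof.
move=> df x /df[l [dfx _]]; apply: differentiable_continuous.
exact/derivable1_diffP.
Qed.

Lemma cpos_powR a : cpos (fun x => x `^ a).
Proof. by apply: cpos_derive => x x0; exists (a * x `^ (a - 1)); exact: is_derive1_powR. Qed.

Lemma cposM f g : cpos f -> cpos g -> cpos (fun x => f x * g x).
Proof. by move=> cf cg x x0; apply: cvgM; [exact: cf|exact: cg]. Qed.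

Lemma cposD f g : cpos f -> cpos g -> cpos (fun x => f x + g x).
Proof. by move=> cf cg x x0; apply: cvgD; [exact: cf|exact: cg]. Qed.

Lemma cpos_cst a : cpos (fun=> a).
Proof. by move=> x x0; exact: cvg_cst. Qed.

Lemma cpos_continuous f : continuous f -> cpos f.
Proof. by move=> cf x _; exact: cf. Qed.

Lemma bump_prim s x : 0 < x -> is_derive x 1 (fun x => - (1 + x `^ s)^-1) (bump s x).
Proof.
move=> x0; have px : 0 < 1 + x `^ s by rewrite ltr_wpDr ?powR_ge0.
have d1 : is_derive x 1 (fun y : R => 1 + y `^ s) (0 + s * x `^ (s - 1)).
  exact: (@deriv_add _ (fun=> 1) (fun y => y `^ s) x 0 _ (is_derive_cst _ _ _) (is_derive1_powR s x0)).
have d2 := @is_deriveV _ (fun y => 1 + y `^ s) x _ 1 (lt0r_neq0 px) d1.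
have := deriv_scale (-1) d2.
have -> : (fun y => -1 * (1 + y `^ s)^-1) = (fun x => - (1 + x `^ s)^-1).
  by apply/funext => y; rewrite mulN1r.
move=> d3; apply: is_derive_eq d3 _; rewrite /GRing.scale /= add0r /bump.
by field; rewrite gt_eqF.
Qed.

Lemma integrable_bump s : 0 <= s -> mu.-integrable pos (EFin \o bump s).
Proof.
move=> s0; have px x : 0 < 1 + x `^ s by rewrite ltr_wpDr ?powR_ge0.
apply: (@integrable_bounded_prim _ (fun x => - (1 + x `^ s)^-1) 1).
- have ci : cpos (fun x => (1 + x `^ s)^-1).
    move=> x x0; apply: cvgV; first by rewrite gt_eqF.
    exact: (@cposD _ _ (@cpos_cst 1) (@cpos_powR s) x x0).
  exact: cposM (cposM (@cpos_cst s) (@cpos_powR _)) (cposM ci ci).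
- by move=> x x0; rewrite /bump !mulr_ge0 ?powR_ge0 ?invr_ge0 // ltW.
- exact: bump_prim.
- move=> x x0; rewrite normrN ger0_norm ?invr_ge0 ?(ltW (px x)) //.
  by rewrite invf_le1 // lerDl powR_ge0.
Qed.

Definition dominated s C f := forall x, 0 < x ->
  `|f x| <= C * x `^ (s - 1) /\ `|f x| <= C * x `^ (- s - 1).

(** Where x^s <= 1 one has (1 + x^s)^2 <= 4, and where x^s > 1 it is at most 4 x^(2s); hence the
    constant 4 / s. *)
Lemma dominated_bump s C f x : 0 < s -> dominated s C f -> 0 < x ->
  `|f x| <= 4 * C / s * bump s x.
Proof.
move=> s0 df x0; have [H1 H2] := df x x0.
have C0 : 0 <= C.
  rewrite -(@pmulr_lge0 _ (x `^ (s - 1))) ?powR_gt0 //.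
  exact: le_trans H1.
have p0 : 0 < x `^ s by exact: powR_gt0.
have -> : 4 * C / s * bump s x = C * x `^ (s - 1) * (4 / (1 + x `^ s) ^+ 2).
  rewrite /bump; field; rewrite (gt_eqF s0) gt_eqF //; lra.
have q0 : 0 < (1 + x `^ s) ^+ 2 by rewrite exprn_gt0 //; lra.
have [x1|x1] := leP (x `^ s) 1.
  apply: le_trans H1 _; rewrite ler_peMr ?mulr_ge0 ?powR_ge0 //.
  by rewrite ler_pdivlMr // mul1r expr2; nra.
apply: le_trans H2 _; rewrite -mulrA ler_wpM2l //.
have -> : - s - 1 = (s - 1) - s - s by ring.
rewrite (powR_sub _ _ x0) (powR_sub _ _ x0) -mulrA ler_wpM2l ?powR_ge0 //.
rewrite -invfM ler_pdivlMr // mulrC ler_pdivrMr ?mulr_gt0 // expr2; nra.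
Qed.

Lemma dominated_integrable s C f : 0 < s -> cpos f -> dominated s C f ->
  mu.-integrable pos (EFin \o f).
Proof.
move=> s0 cf df.
have mpos : measurable pos by exact: measurable_itv.
have ib : mu.-integrable pos (fun x => ((4 * C / s)%:E * (EFin \o bump s) x)%E).
  by apply: integrableZl => //; exact: integrable_bump (ltW s0).
apply: le_integrable ib => //.
  by apply/measurable_EFinP; exact: cpos_measurable.
move=> x /posE x0 /=; rewrite lee_fin; apply: le_trans (ler_norm _).
exact: dominated_bump.
Qed.

Lemma dominated_cvg_Rintegral s C (f_ : nat -> R -> R) f : 0 < s ->
  (forall n, cpos (f_ n)) -> (forall n, dominated s C (f_ n)) ->
  (forall x, 0 < x -> f_ n x @[n --> \oo] --> f x) ->
  (\int[mu]_(x in pos) f_ n x) @[n --> \oo] --> \int[mu]_(x in pos) f x.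
Proof.
move=> s0 cf df fcv.
apply: (@Rintegral_dominated _ _ (fun x => 4 * C / s * bump s x)) => //.
- by move=> n; exact: cpos_measurable.
- have mpos : measurable pos by exact: measurable_itv.
  by have := integrableZl mpos (4 * C / s) (integrable_bump (ltW s0)).
- by move=> n x x0; exact: dominated_bump.
Qed.

Lemma improper_ftc f F l0 l1 : cpos f -> mu.-integrable pos (EFin \o f) ->
  (forall x, 0 < x -> is_derive x 1 F (f x)) ->
  F n.+1%:R^-1 @[n --> \oo] --> l0 -> F n.+1%:R @[n --> \oo] --> l1 ->
  \int[mu]_(x in pos) f x = l1 - l0.
Proof.
move=> cf intf dF F0 F1.
have mpos : measurable pos by exact: measurable_itv.
have H : (\int[mu]_(x in pos) (f \_ (seg n)) x) @[n --> \oo] --> \int[mu]_(x in pos) f x.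
  apply: (@Rintegral_dominated _ _ (fun x => `|f x|)).
  - move=> n; apply/measurable_restrict => //; first exact: seg_measurable.
    apply: measurable_funS (cpos_measurable cf) => //.
  - move=> x x0; apply: cvg_near_cst; have := seg_in x0; apply: filterS => n nx.
    by rewrite patchE mem_set.
  - exact: integrable_norm.
  - move=> n x x0; rewrite patchE; case: ifPn => _; first exact: lexx.
    by rewrite normr0.
have E n : \int[mu]_(x in pos) (f \_ (seg n)) x = F n.+1%:R - F n.+1%:R^-1.
  rewrite -Rintegral_mkcondr setIC (_ : seg n `&` pos = seg n); last first.
    by apply/setIidPl => x /seg_pos /posE.
  by rewrite /Rintegral /seg (@ftc_segment f F) ?invr_gt0 // seg_le.
move/funext: E => E; rewrite E in H.
exact: (cvg_unique _ H (cvgB F1 F0)).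
Qed.

Lemma dominated_coef s C f : (forall x, 0 < x -> `|f x| <= C * x `^ s) -> 0 <= C.
Proof. by move=> /(_ 1 ltr01); rewrite powR1 mulr1; exact: le_trans. Qed.

(** Up to r the factor x^(2s) is at most r^(2s), which trades x^(s-1) for x^(-s-1); beyond r the
    function vanishes. *)
Lemma dominated_near0 s C r f : 0 < s -> 1 <= r ->
  (forall x, 0 < x -> `|f x| <= C * x `^ (s - 1)) -> (forall x, r < x -> f x = 0) ->
  dominated s (C * r `^ (2 * s)) f.
Proof.
move=> s0 r1 fC fr x x0; have C0 := dominated_coef fC.
have s20 : 0 <= 2 * s by rewrite mulr_ge0 // ltW.
split.
  apply: le_trans (fC x x0) _; rewrite ler_wpM2r ?powR_ge0 // ler_peMr //.
  by have := ler_powR r1 s20; rewrite powRr0.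
have [xr|xr] := leP x r; last by rewrite fr // normr0 !mulr_ge0 ?powR_ge0.
apply: le_trans (fC x x0) _.
have -> : s - 1 = 2 * s + (- s - 1) by ring.
rewrite powR_add // mulrA ler_wpM2r ?powR_ge0 // ler_wpM2l //.
by rewrite ge0_ler_powR ?nnegrE ?(ltW x0) // ?(le_trans (ltW x0)).
Qed.

Lemma dominated_infty s C f : 0 < s ->
  (forall x, 0 < x -> `|f x| <= C * x `^ (- s - 1)) -> (forall x, 0 < x -> x < 1 -> f x = 0) ->
  dominated s C f.
Proof.
move=> s0 fC f1 x x0; have C0 := dominated_coef fC; split; last exact: fC.
have [x1|x1] := ltP x 1; first by rewrite f1 // normr0 mulr_ge0 ?powR_ge0.
apply: le_trans (fC x x0) _; rewrite ler_wpM2l // ler_powR //; lra.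
Qed.

Lemma primitive_ex (k : R -> R) : continuous k ->
  (* The primitive starts at -1 so that it is differentiable from both sides at 0 as well. *)
  exists K : R -> R, forall x, 0 <= x -> is_derive x 1 K (k x).
Proof.
move=> ck; exists (fun x => \int[mu]_(t in `[-1, x]) k t) => x x0.
have [||||dK KE] := @continuous_FTC1_closed R k (-1) x (x + 1); last 1 first.
- move: dK KE; move: (fun y => _) => K dK KE.
  by split; [exact: dK|rewrite -derive1E].
- by rewrite ltrDl.
- apply: continuous_compact_integrable; first exact: segment_compact.
  exact: continuous_subspaceT.
- by apply: lt_le_trans x0; rewrite ltrN10.
- exact: ck.
Qed.

End improper.

(** * Asymptotics of functionals supported in the half-line *)

Section positive_part.
Context {R : realType} (M : nat -> R) (s : ultraclass).
Hypothesis hM : weight_sequence M.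
Implicit Types (u : R -> R) (x d : R).

Lemma near_gtr x d : d < x -> \forall y \near x, d < y.
Proof. by move=> dx; exact: cvgr_gt (@cvg_id _ (nbhs x)) _ dx. Qed.

Lemma near_ltr x d : x < d -> \forall y \near x, y < d.
Proof. by move=> dx; exact: cvgr_lt (@cvg_id _ (nbhs x)) _ dx. Qed.

(** For [u] vanishing near 0, this cuts off the part on the negative half-line, which a functional
    supported in [0, +oo[ does not see, and brings [u] into the scope of the hypothesis on ]0,
    +oo[. *)
Definition ppart u x : R := if 0 < x then u x else 0.

Lemma ppart_near u d x : 0 < d -> (forall y, `|y| <= d -> u y = 0) ->
  \forall y \near x, ppart u y = (if 0 < x then u else fun=> 0) y.
Proof.
move=> d0 ud; have [x0|x0] := ltP 0 x.
  by have := near_gtr x0; apply: filterS => y y0; rewrite /ppart y0.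
have := near_ltr (le_lt_trans x0 d0); apply: filterS => y yd; rewrite /ppart.
case: ifPn => // y0; apply: ud.
by rewrite gtr0_norm // ltW.
Qed.

Lemma ppart_smooth u d : 0 < d -> (forall y, `|y| <= d -> u y = 0) ->
  smooth u -> smooth (ppart u).
Proof.
move=> d0 ud su; apply: smooth_local => x.
exists (if 0 < x then u else fun=> 0); last exact: ppart_near d0 ud.
by case: ifP => _; [exact: su|exact: smooth_cst].
Qed.

Lemma derive1n_ppart u d n x : 0 < d -> (forall y, `|y| <= d -> u y = 0) ->
  derive1n n (ppart u) x = if 0 < x then derive1n n u x else 0.
Proof.
move=> d0 ud; rewrite (derive1n_near n (ppart_near x d0 ud)).
by case: ifP => // _; rewrite derive1n_cst; case: n.
Qed.

Lemma tfam_ppart (I : Type) (u : I -> R -> R) d : 0 < d ->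
  (forall i y, `|y| <= d -> u i y = 0) -> tfam M s u -> tfam M s (fun i => ppart (u i)).
Proof.
move=> d0 ud [su [r r0 ur] bu]; split.
- by move=> i; exact: ppart_smooth d0 (ud i) (su i).
- by exists r => // i x rx; rewrite /ppart ur // if_same.
apply: forh_mono bu => h h0 [C C0 HC]; exists C => // i p x _.
rewrite (derive1n_ppart _ _ d0 (ud i)); case: ifP => _; first exact: HC.
by rewrite normr0 !mulr_ge0 ?exprn_ge0 ?(ltW h0) ?(ltW (weight_gt0 hM p)).
Qed.

End positive_part.

Section geometric_limit.
Context {R : realType}.
Implicit Types (u : nat -> R) (K q : R).

Lemma geometric_cvg0 u K q : 0 <= q < 1 -> (\forall j \near \oo, `|u j| <= K * q ^+ j) ->
  u @ \oo --> 0.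
Proof.
move=> /andP[q0 q1] uK; apply: norm_cvg0.
have K0 : (fun j => K * q ^+ j) @ \oo --> 0.
  by rewrite -(mulr0 K); apply: cvgM; [exact: cvg_cst|apply: cvg_expr; rewrite ger0_norm].
apply: squeeze_cvgr (cvg_cst 0) K0.
by apply: filterS uK => j Hj; rewrite normr_ge0.
Qed.

(** The intervals [u j - w j, u j + w j], with w the geometric remainder, are nested; the limit is
    the supremum of their left ends. *)
Lemma geometric_limit u K q : 0 < q -> q < 1 -> (forall j, `|u j.+1 - u j| <= K * q ^+ j) ->
  exists A, forall j, `|u j - A| <= K / (1 - q) * q ^+ j.
Proof.
move=> q0 q1 uK; have K0 : 0 <= K by have := uK 0%N; rewrite expr0 mulr1; exact: le_trans.
have q10 : 0 < 1 - q by rewrite subr_gt0.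
pose w j := K / (1 - q) * q ^+ j.
have w0 j : 0 <= w j by rewrite mulr_ge0 ?divr_ge0 ?exprn_ge0 ?(ltW q0) ?(ltW q10).
have wS j : w j = w j.+1 + K * q ^+ j by rewrite /w exprS; field; rewrite gt_eqF.
pose lo j := u j - w j; pose hi j := u j + w j.
have loS j k : lo j <= lo (j + k)%N.
  elim: k => [|k IH]; first by rewrite addn0.
  rewrite addnS; apply: le_trans IH _; rewrite /lo (wS (j + k)%N).
  by have := uK (j + k)%N; rewrite ler_norml => /andP[H _]; lra.
have hiS j k : hi (j + k)%N <= hi j.
  elim: k => [|k IH]; first by rewrite addn0.
  rewrite addnS; apply: le_trans IH; rewrite /hi (wS (j + k)%N).
  by have := uK (j + k)%N; rewrite ler_norml => /andP[_ H]; lra.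
have lohi i j : lo i <= hi j.
  apply: le_trans (loS i j) _; apply: le_trans (hiS j i).
  by rewrite addnC /lo /hi; have := w0 (j + i)%N; lra.
exists (sup (range lo)) => j; rewrite ler_norml; apply/andP; split.
- suff : sup (range lo) <= hi j by rewrite /hi /w; lra.
  by apply: ge_sup; [exists (lo 0%N); exists 0%N|move=> _ [i _ <-]].
- suff : lo j <= sup (range lo) by rewrite /lo /w; lra.
  by apply: ub_le_sup; [exists (hi 0%N) => _ [i _ <-]|exists j].
Qed.

End geometric_limit.

Lemma ratio_bound (R : realFieldType) (U w d : R) : 0 < w -> `|U / w - d| <= 1 ->
  `|U| <= (`|d| + 1) * w.
Proof.
move=> w0 H; rewrite -ler_pdivrMr //.
have <- : `|U / w| = `|U| / w by rewrite normrM normfV (gtr0_norm w0).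
by have := ler_normD (U / w - d) d; rewrite subrK; lra.
Qed.

Section half_line_functional.
Context {R : realType} (M : nat -> R) (s : ultraclass).
Hypothesis hM : weight_sequence M.
Local Notation tf := (tf M s).
Local Notation tfam := (tfam M s).
Local Notation lf := (lf M s).
Local Notation lfam := (lfam M s).
Local Notation mu := (@lebesgue_measure R).
Local Notation pos := (`]0, +oo[%classic : set (measurableTypeR R)).
Implicit Types (u v rho chi : R -> R) (l x d a : R).

Variables (f : (R -> R) -> R) (G : R -> R) (gamma c : R).

Definition half_moment u := \int[mu]_(x in pos) (x `^ (gamma - 1) * u x).

(* What the hypotheses say about the real and imaginary parts of f on real test
   functions, with gamma = alpha + 1 and G l = l^gamma L(l). *)
Definition half_quasiasymptotic : Prop :=
  [/\ ufunc M s f,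
      forall u d, tf u -> 0 < d -> (forall x, - d <= x -> u x = 0) -> f u = 0,
      regvar G gamma &
      forall u d, tf u -> 0 < d -> (forall x, x <= d -> u x = 0) ->
        (fun l => f (fun x => u (x / l)) / G l) @ +oo --> c * half_moment u].

Hypothesis hfG : half_quasiasymptotic.

Let hf : ufunc M s f. Proof. by case: hfG. Qed.
Let hG : regvar G gamma. Proof. by case: hfG. Qed.

(** The difference of the two test functions vanishes from -d l on, so the support of [f]
    annihilates it. *)
Lemma half_ppart u d l : 0 < l -> tf u -> 0 < d -> (forall x, `|x| <= d -> u x = 0) ->
  f (fun x => u (x / l)) = f (fun x => ppart u (x / l)).
Proof.
move=> l0 tu d0 ud; have [_ supp _ _] := hfG.
have tp : tf (ppart u) by exact: (tfam_ppart hM d0 (fun _ : unit => ud) tu).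
have E : f (fun x => 1 * u (x / l) + (-1) * ppart u (x / l)) = 0.
  apply: (supp _ (d * l)); [|exact: mulr_gt0|].
    by apply: tf_lin => //; exact: tf_scale.
  move=> x xd; rewrite /ppart; case: ifPn => xl; first by rewrite mul1r mulN1r subrr.
  rewrite mulr0 addr0 ud ?mulr0 //.
  rewrite ler0_norm; last by rewrite leNgt.
  by rewrite -mulNr ler_pdivrMr // lerNl.
move: E; rewrite (ufunc_lin hM hf) ?mul1r ?mulN1r; last 2 first.
- exact: tf_scale.
- exact: tf_scale.
by move/eqP; rewrite subr_eq0 => /eqP.
Qed.

Lemma half_limit u d : tf u -> 0 < d -> (forall x, `|x| <= d -> u x = 0) ->
  (fun l => f (fun x => u (x / l)) / G l) @ +oo --> c * half_moment u.
Proof.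
move=> tu d0 ud; have [_ _ _ lim] := hfG.
have tp : tf (ppart u) by exact: (tfam_ppart hM d0 (fun _ : unit => ud) tu).
have -> : half_moment u = half_moment (ppart u).
  by apply: eq_Rintegral => x; rewrite inE => /posE x0; rewrite /ppart x0.
have pd x : x <= d -> ppart u x = 0.
  by move=> xd; rewrite /ppart; case: ifP => // x0; rewrite ud // gtr0_norm.
apply: cvgy_eq (lim _ _ tp d0 pd); exists 1 => l l1.
by rewrite (half_ppart _ tu d0 ud) // (lt_le_trans ltr01).
Qed.

Lemma half_uniform_bound (u : nat -> R -> R) d : tfam u -> 0 < d ->
  (forall j x, `|x| <= d -> u j x = 0) ->
  exists B X, [/\ 0 < X, 0 <= B & forall l j, X <= l -> `|f (fun x => u j (x / l))| <= B * G l].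
Proof.
move=> tu d0 ud.
have tp : tfam (fun j => ppart (u j)) by exact: tfam_ppart d0 ud tu.
have [Gpos _ _] := hG; have [_ _ _ lim] := hfG.
have [||v tv Pv|B [X [X0 B0 HB]]] := @uniform_bound _ M s hM f hf G (fun v => forall x, x <= d -> v x = 0) _ Gpos tp.
- by move=> j x xd; rewrite /ppart; case: ifP => // x0; rewrite ud // gtr0_norm.
- move=> sigma x xd.
  have -> : (fun k => ppart (u (sigma k)) x) = (fun k => 0 * 0 + 0 * 0).
    apply/funext => k; rewrite mulr0 addr0 /ppart; case: ifP => // x0.
    by rewrite ud // gtr0_norm.
  by rewrite (@ssum_lin _ (fun=> 0) (fun=> 0) 0 0 0 0) ?normr0 // !mul0r addr0.
- have /cvgy_ex /(_ 1 ltr01) [X X0 HX] := lim v d tv d0 Pv.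
  exists (`|c * half_moment v| + 1); have [Y Y0 HY] := proj1 (neary_ex _) Gpos.
  apply/neary_ex; exists (X + Y); first exact: addr_gt0.
  move=> l Xl; have Gl : 0 < G l by apply: HY; lra.
  have : `|f (fun x => v (x / l)) / G l - c * half_moment v| <= 1 by apply: HX; lra.
  have E : `|f (fun x => v (x / l)) / G l| = `|f (fun x => v (x / l))| / G l.
    by rewrite normrM normfV (gtr0_norm Gl).
  rewrite -ler_pdivrMr // -E => H.
  have := ler_normD (f (fun x => v (x / l)) / G l - c * half_moment v) (c * half_moment v).
  rewrite subrK; lra.
exists B, X; split => // l j Xl; rewrite (half_ppart _ (tfam_tf j tu) d0 (ud j)); first exact: HB.
exact: lt_le_trans Xl.
Qed.

Variable chi : R -> R.
Hypothesis tchi : tf chi.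
Hypothesis chi1 : forall x, `|x| <= 1 -> chi x = 1.
Hypothesis chi2 : forall x, 2 <= `|x| -> chi x = 0.

Lemma chi_bound : exists2 B, 1 <= B & forall x, `|chi x| <= B.
Proof.
have [_ _ bchi] := tchi; have [B B0 HB] := bfam_bound hM 0 bchi.
exists B => [|x]; last exact: (HB tt).
by have := HB tt 0 I; rewrite /= chi1 ?normr0 ?normr1.
Qed.

(** * Test functions vanishing to high order at 0: dyadic decomposition *)

Section vanishing.
Variables (rho : R -> R) (m : nat).
Hypothesis trho : tf rho.
Hypothesis rho0 : forall p, (p < m)%N -> derive1n p rho 0 = 0.
Hypothesis mgamma : 0 < gamma + m%:R.

Let t j : R := 2^-1 ^+ j.
Let t0 j : 0 < t j. Proof. by rewrite exprn_gt0 ?invr_gt0. Qed.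
Let tV j : (t j)^-1 = 2 ^+ j. Proof. by rewrite /t exprVn invrK. Qed.

(** The piece of [rho] at scale 2^-j brought back to unit scale and divided by 2^(-jm); bounded in j
    by [lfam_blowup]. *)
Let blow theta j x := theta x * ((t j) ^- m * rho (t j * x)).

Let blow_tfam theta : tf theta -> tfam (blow theta).
Proof.
move=> tth; apply: tfamM => //; first exact: tf_tfam.
apply: (lfam_blowup hM) => // j; rewrite t0 /= exprn_ile1 ?invr_ge0 //.
by rewrite invf_le1 // ler1n.
Qed.

(** Telescoping bump: chi (2^j x) = psi (2^j x) + chi (2^(j+1) x), with [psi] zero for |x| <=
    1/2. *)
Let psi x := 1 * chi x + (-1) * chi (2 * x).

Let tpsi : tf psi.
Proof. by apply: tf_lin => //; exact: tf_dilate. Qed.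

Let psi0 x : `|x| <= 1 / 2 -> psi x = 0.
Proof.
move=> x1; rewrite /psi !chi1 ?mulr1 ?subrr //; last by lra.
by rewrite normrM ger0_norm //; lra.
Qed.

Let head j l := f (fun x => rho (x / l) * chi (2 ^+ j * (x / l))).

(** Ratio of the geometric sum over the pieces; half of the available exponent gamma + m is kept,
    the other half covers the error in regular variation. *)
Let theta := 2 `^ ((- gamma - m%:R) / 2).
Let theta0 : 0 < theta. Proof. exact: powR_gt0. Qed.
Let theta1 : theta < 1.
Proof.
rewrite /theta /powR pnatr_eq0 /= expR_lt1 pmulr_llt0 ?ln_gt0 ?ltr1n //.
by rewrite pmulr_llt0 ?invr_gt0 //; move: mgamma; lra.
Qed.

Let tf_head j : tf (fun x => rho x * chi (2 ^+ j * x)).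
Proof. by apply: tfM => //; apply: tfam_lfam; apply: tf_dilate; rewrite ?exprn_gt0. Qed.

Let tf_piece j : tf (fun x => rho x * psi (2 ^+ j * x)).
Proof. by apply: tfM => //; apply: tfam_lfam; apply: tf_dilate; rewrite ?exprn_gt0. Qed.

Let blow_scale w j l x : 0 < l ->
  rho (x / l) * w (2 ^+ j * (x / l)) = (t j) ^+ m * blow w j (x / (t j * l)).
Proof.
move=> l0; rewrite /blow.
have -> : x / (t j * l) = 2 ^+ j * (x / l) by rewrite invfM tV; ring.
have -> : t j * (2 ^+ j * (x / l)) = x / l by rewrite -tV mulrA divff ?mul1r ?gt_eqF.
have tm : t j ^+ m != 0 by rewrite expf_neq0 // gt_eqF.
by field.
Qed.

Let head_step j l : 0 < l ->
  head j l = (t j) ^+ m * f (fun x => blow psi j (x / (t j * l))) + head j.+1 l.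
Proof.
move=> l0; rewrite /head.
have E : f (fun x => rho (x / l) * chi (2 ^+ j * (x / l))) =
   f (fun x => 1 * (rho (x / l) * psi (2 ^+ j * (x / l))) + 1 * (rho (x / l) * chi (2 ^+ j.+1 * (x / l)))).
  by congr f; apply/funext => x; rewrite /psi exprS !mulrA; ring.
rewrite E (ufunc_lin hM hf); last 2 first.
- exact: (tf_scale l0 (tf_piece j)).
- exact: (tf_scale l0 (tf_head j.+1)).
rewrite !mul1r; congr (_ + _).
have tb : tf (fun x => blow psi j (x / (t j * l))).
  by apply: tf_scale; [exact: mulr_gt0|exact: tfam_tf (blow_tfam tpsi)].
have := @ufunc_lin _ M s hM f hf (t j ^+ m) 0 _ _ tb tb; rewrite mul0r addr0 => <-.
by congr f; apply/funext => x; rewrite blow_scale // mul0r addr0.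
Qed.

(* The innermost piece, of index n with 2^n comparable to l, lives at unit scale,
   where f is bounded; this produces the term l^-m. *)
Lemma head_bound : exists C X : R, [/\ 0 <= C, 0 < X & forall J,
  \forall l \near +oo, `|f (fun x => rho (x / l) * chi (2 ^+ J * (x / l)))| <=
     C * theta ^+ J * G l + C * l `^ (- m%:R)].
Proof.
have [_ fb] := hf.
have bpsi := blow_tfam tpsi.
have bpsi0 j x : `|x| <= 1 / 2 -> blow psi j x = 0.
  by move=> x1; rewrite /blow psi0 // mul0r.
have half0 : 0 < 1 / 2 :> R by rewrite divr_gt0.
have [B [X1 [X10 B0 HB]]] := half_uniform_bound bpsi half0 bpsi0.
(* Slightly above 2^-gamma, so G(l/2) <= q G(l) for large l, and still q 2^-m = theta < 1. *)
pose q := 2 `^ ((m%:R - gamma) / 2).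
have gq : 2 `^ (- gamma) < q.
  rewrite /q /powR pnatr_eq0 /= ltr_expR ltr_pM2r ?ln_gt0 ?ltr1n //.
  by rewrite ltr_pdivlMr //; move: mgamma; lra.
have q0 : 0 < q by exact: powR_gt0.
have [X2 X20 HX2] := regvar_half hG gq.
have qt : q * 2^-1 ^+ m = theta.
  rewrite exprVn -powR_mulrn // -powRN /q /theta -powR_add //.
  by congr (_ `^ _); field.
have tle X j l : X * 2 ^+ j <= l -> X <= t j * l.
  by move=> H; rewrite mulrC -ler_pdivrMr ?tV //; rewrite -tV.
have Gq n : forall l, X2 * 2 ^+ n <= l -> 0 < G l /\ G (t n * l) <= q ^+ n * G l.
  elim: n => [|n IH] l.
    rewrite /t !expr0 !mulr1 !mul1r => Xl; split => //.
    by have [] := HX2 l Xl.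
  move=> Xl; have [Gl H1] : 0 < G l /\ G (t n * l) <= q ^+ n * G l.
    apply: IH; apply: le_trans Xl.
    by rewrite ler_pM2l // ler_eXn2l ?ltr1n.
  split => //; have [_ H2] := HX2 _ (tle _ _ _ Xl).
  apply: le_trans H2 _; rewrite exprS -mulrA ler_pM2l //.
  by apply: le_trans H1; rewrite /t exprS mulrA [2 * _]mulrA divff ?mul1r.
pose X := X1 + X2.
have X0 : 0 < X by exact: addr_gt0.
have th1 : 0 < 1 - theta by rewrite subr_gt0.
(* Peels off k pieces while their scale t_j l stays at least X. Starting from J keeps the factor
   theta^J, which later makes the error uniformly small. *)
have sum_head k : forall J l, X * 2 ^+ (J + k) <= l ->
    `|head J l| <= B / (1 - theta) * theta ^+ J * G l + `|head (J + k) l|.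
  elim: k => [|k IH] J l Xl.
    rewrite addn0 in Xl *; rewrite lerDr.
    have [Gl _] : 0 < G l /\ G (t J * l) <= q ^+ J * G l.
      by apply: Gq; apply: le_trans Xl; rewrite ler_pM2r ?exprn_gt0 // /X lerDr ltW.
    by rewrite !mulr_ge0 ?invr_ge0 ?exprn_ge0 ?(ltW th1) ?(ltW theta0) ?(ltW Gl).
  have XJ : X * 2 ^+ J <= l.
    by apply: le_trans Xl; rewrite ler_pM2l // ler_eXn2l ?ltr1n // leq_addr.
  have l0 : 0 < l by apply: lt_le_trans XJ; rewrite mulr_gt0 ?exprn_gt0.
  have := IH J.+1 l; rewrite addSn -addnS => /(_ Xl) H.
  rewrite head_step //; apply: le_trans (ler_normD _ _) _.
  apply: le_trans (lerD (lexx _) H) _; rewrite addrA lerD2r.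
  have [Gl H1] : 0 < G l /\ G (t J * l) <= q ^+ J * G l.
    by apply: Gq; apply: le_trans XJ; rewrite ler_pM2r ?exprn_gt0 // /X lerDr ltW.
  have H2 : `|f (fun x => blow psi J (x / (t J * l)))| <= B * (q ^+ J * G l).
    apply: le_trans (HB _ _ _) _; last by rewrite ler_wpM2l.
    by apply: le_trans (tle _ _ _ XJ); rewrite /X lerDl ltW.
  have H3 : `|t J ^+ m * f (fun x => blow psi J (x / (t J * l)))| <= B * theta ^+ J * G l.
    rewrite normrM ger0_norm ?exprn_ge0 ?(ltW (t0 J)) //.
    have -> : B * theta ^+ J * G l = t J ^+ m * (B * (q ^+ J * G l)).
      by rewrite -qt exprMn /t -!exprM mulnC; ring.
    by rewrite ler_wpM2l // exprn_ge0 // ltW.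
  apply: le_trans (lerD H3 (lexx _)) _; rewrite le_eqVlt; apply/orP; left; apply/eqP.
  by rewrite exprS; field; rewrite gt_eqF.
have head_eq n l : 0 < l -> head n l = t n ^+ m * f (fun x => blow chi n (x / (t n * l))).
  move=> l0; have tb : tf (fun x => blow chi n (x / (t n * l))).
    by apply: tf_scale; [exact: mulr_gt0|exact: tfam_tf (blow_tfam tchi)].
  have := @ufunc_lin _ M s hM f hf (t n ^+ m) 0 _ _ tb tb; rewrite mul0r addr0 => <-.
  by congr f; apply/funext => x; rewrite blow_scale // mul0r addr0.
(* Forces the scale into [X, 2X], so that the family indexed by all pairs is bounded; at the
   stopping index the scale t_n l is already in this interval. *)
pose clamp y := if X <= y <= 2 * X then y else X.
have clampP y : X <= clamp y <= 2 * X.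
  by rewrite /clamp; case: ifP => // _; rewrite lexx /= ler_peMl ?ler1n // ltW.
have tcl : tfam (fun (i : nat * R) x => blow chi i.1 (x / clamp i.2)).
  apply: (@tfam_scale _ _ _ _ (fun i : nat * R => clamp i.2) (fun i => blow chi i.1) X (2 * X)) => //.
  exact: (tfam_reindex (fun i : nat * R => i.1) (blow_tfam tchi)).
have [D HD] := fb _ _ tcl.
have D0 : 0 <= D by apply: le_trans (HD (0%N, X)).
have BT : 0 <= B / (1 - theta) by rewrite divr_ge0 // ltW.
have DX : 0 <= D * (2 * X) ^+ m by rewrite mulr_ge0 ?exprn_ge0 ?mulr_ge0 // ltW.
exists (B / (1 - theta) + D * (2 * X) ^+ m), X; split => //; first exact: addr_ge0.
move=> J; apply/neary_ex; exists (X * 2 ^+ J); first by rewrite mulr_gt0 ?exprn_gt0.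
move=> l Xl; have XlX : X <= l.
  by apply: le_trans Xl; rewrite ler_peMr ?(ltW X0) // exprn_ege1 // ler1n.
have l0 : 0 < l by exact: lt_le_trans XlX.
have [n /andP[nl ln]] := dyadic_scale X0 XlX.
have Jn : (J <= n)%N.
  rewrite -ltnS -(ltr_eXn2l (x := 2 : R)) ?ltr1n // -(ltr_pM2r X0).
  by apply: le_lt_trans ln; rewrite mulrC.
have := sum_head (n - J)%N J l; rewrite subnKC // mulrC => /(_ nl) H.
have [Gl _] : 0 < G l /\ G (t J * l) <= q ^+ J * G l.
  by apply: Gq; apply: le_trans Xl; rewrite ler_pM2r ?exprn_gt0 // /X lerDr ltW.
apply: le_trans H _; apply: lerD.
  by do 2 (rewrite ler_wpM2r ?exprn_ge0 ?(ltW theta0) ?(ltW Gl) //); rewrite lerDl.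
have cl : clamp (t n * l) = t n * l.
  rewrite /clamp (_ : X <= t n * l <= 2 * X) // tle 1?mulrC //=.
  by rewrite -[t n]invrK tV ler_pdivrMr ?exprn_gt0 // mulrC mulrA -exprSr ltW.
have := HD (n, t n * l); rewrite /= cl => H.
rewrite head_eq // normrM ger0_norm ?exprn_ge0 ?(ltW (t0 n)) //.
apply: (@le_trans _ _ (t n ^+ m * D)).
  by rewrite ler_wpM2l // exprn_ge0 // ltW.
rewrite powRN powR_mulrn ?(ltW l0) // mulrDl.
apply: (@le_trans _ _ (D * (2 * X) ^+ m / l ^+ m)); last first.
  by rewrite lerDr divr_ge0 // exprn_ge0 // ltW.
rewrite mulrC -mulrA ler_wpM2l // ler_pdivlMr ?exprn_gt0 // -exprMn.
rewrite lerXn2r ?nnegrE ?mulr_ge0 ?(ltW X0) ?(ltW l0) ?(ltW (t0 n)) //.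
by have /andP[] := clampP (t n * l); rewrite cl.
Qed.

Lemma vanishing_bound : exists2 B : R, 0 <= B & forall x, `|rho x| <= B * `|x| ^+ m.
Proof.
have [_ _ brho] := trho; have [B B0 HB] := bfam_bound hM m brho.
by exists B => //; apply: vanish_le (tf_smooth trho) rho0 _ => x; exact: (HB tt).
Qed.

Lemma vanishing_limit :
  (fun l => f (fun x => rho (x / l)) / G l) @ +oo --> c * half_moment rho.
Proof.
have [C [X [C0 X0 HC]]] := head_bound.
pose cut J x := 1 * rho x + (-1) * (rho x * chi (2 ^+ J * x)).
have tcut J : tf (cut J) by apply: tf_lin => //; exact: tf_head.
have p2 J : 0 < (2 : R) ^+ J by rewrite exprn_gt0.
(* Cutting [rho] off near 0 at scale 2^-J gives functions covered by [half_limit]. In the error 2 C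
   theta^J one half is the geometric sum, the other the term l^-m, eventually below theta^J G(l). *)
apply: (@cvgy_approx _ _ (fun J l => f (fun x => cut J (x / l)) / G l)
  (fun J => c * half_moment (cut J)) (fun J => 2 * C * theta ^+ J)).
- move=> J; apply: (@half_limit _ (2 ^+ J)^-1); rewrite ?invr_gt0 //.
  move=> x xJ; rewrite /cut chi1 ?mulr1 ?mulN1r ?mul1r ?subrr //.
  by rewrite normrM gtr0_norm // mulrC -ler_pdivlMr // div1r.
- apply: cvgM; first exact: cvg_cst.
  have [B B0 HB] := vanishing_bound; have [Bc Bc1 HBc] := chi_bound.
  have [r r0 rsupp] := tf_supp trho.
  have cutE J x : cut J x = rho x * (1 - chi (2 ^+ J * x)) by rewrite /cut; ring.
  have s0 : 0 < gamma + m%:R := mgamma.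
  apply: (@dominated_cvg_Rintegral _ (gamma + m%:R) (B * (1 + Bc) * (1 + r) `^ (2 * (gamma + m%:R)))) => //.
  + move=> J; apply: cposM; first exact: cpos_powR.
    by apply: cpos_continuous; apply: smooth_continuous; exact: tf_smooth (tcut J).
  + move=> J; apply: dominated_near0 => //; first by rewrite lerDl ltW.
      move=> x x0; rewrite normrM ger0_norm ?powR_ge0 // cutE normrM.
      have -> : gamma + m%:R - 1 = (gamma - 1) + m%:R by ring.
      rewrite (powR_add (gamma - 1) _ x0) powR_mulrn ?(ltW x0) //.
      have H1 : `|rho x| <= B * x ^+ m by rewrite -{2}(gtr0_norm x0); exact: HB.
      have H2 : `|1 - chi (2 ^+ J * x)| <= 1 + Bc.
        by apply: le_trans (ler_normB _ _) _; rewrite normr1 lerD2l.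
      have := ler_pM (normr_ge0 _) (normr_ge0 _) H1 H2 => H3.
      have -> : B * (1 + Bc) * (x `^ (gamma - 1) * x ^+ m) = x `^ (gamma - 1) * (B * x ^+ m * (1 + Bc)) by ring.
      by rewrite ler_wpM2l // powR_ge0.
    move=> x rx; rewrite cutE rsupp ?mul0r ?mulr0 //.
    by apply: lt_le_trans (ler_norm x); lra.
  + move=> x x0; apply: cvgM; first exact: cvg_cst.
    apply: cvg_near_cst; have := near_infty_natSinv_lt (PosNum (divr_gt0 x0 (ltr0Sn R 1))).
    apply: filterS => n /= Hn; rewrite cutE chi2 ?subr0 ?mulr1 //.
    rewrite ger0_norm ?mulr_ge0 ?(ltW x0) ?(ltW (p2 n)) //.
    have n2 : n.+1%:R <= (2 : R) ^+ n by rewrite -natrX ler_nat ltn_expl.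
    move: Hn; rewrite invf_plt ?posrE ?divr_gt0 // invf_div => Hn.
    by rewrite -ler_pdivrMr //; apply: le_trans n2; exact: ltW.
- rewrite -(mulr0 (2 * C)); apply: cvgM; first exact: cvg_cst.
  by apply: cvg_expr; rewrite ger0_norm ?(ltW theta0).
- move=> J; have [Gpos _ G3] := hG.
  have := G3 (- m%:R); rewrite -subr_gt0 opprK => /(_ mgamma) /cvgy_ex.
  move=> /(_ (theta ^+ J) (exprn_gt0 _ theta0)) [Y1 Y10 HY1].
  have [Y2 Y20 HY2] := neary_and Gpos (HC J).
  apply/neary_ex; exists (Y1 + Y2); first exact: addr_gt0.
  move=> l Yl; have [Gl H1] : 0 < G l /\ `|f (fun x => rho (x / l) * chi (2 ^+ J * (x / l)))| <= C * theta ^+ J * G l + C * l `^ (- m%:R) by apply: HY2; lra.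
  have l0 : 0 < l by lra.
  have H2 : `|l `^ (- m%:R) / G l - 0| <= theta ^+ J by apply: HY1; lra.
  rewrite subr0 ger0_norm ?divr_ge0 ?powR_ge0 ?(ltW Gl) // ler_pdivrMr // in H2.
  have -> : f (fun x => rho (x / l)) / G l - f (fun x => cut J (x / l)) / G l =
    f (fun x => rho (x / l) * chi (2 ^+ J * (x / l))) / G l.
    rewrite -mulrBl; congr (_ / _); rewrite /cut (ufunc_lin hM hf); last 2 first.
    - exact: (tf_scale l0 trho).
    - exact: (tf_scale l0 (tf_head J)).
    by rewrite mul1r mulN1r opprB addrC subrK.
  rewrite normrM normfV (gtr0_norm Gl) ler_pdivrMr //.
  by apply: le_trans H1 _; have := ler_wpM2l C0 H2; lra.
Qed.

End vanishing.

(** * Moments against cut-off powers *)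

Definition chi_power n x := x ^+ n * chi x.

Lemma tf_chi_power n : tf (chi_power n).
Proof.
have := tfM hM tchi (lf_exprn s hM n).
by congr tf; apply/funext => x; rewrite /chi_power mulrC.
Qed.

Definition moment n l := l ^+ n * f (fun x => chi_power n (x / l)).

(** The test function behind moment n (a l) - moment n l. Both cutoffs equal 1 near 0, so it
    vanishes there. *)
Definition chi_ring n a x := a ^+ n * chi_power n (x / a) + (-1) * chi_power n x.

Lemma chi_ringE n a x : 0 < a -> chi_ring n a x = x ^+ n * (chi (x / a) - chi x).
Proof.
move=> a0; rewrite /chi_ring /chi_power expr_div_n.
have an : a ^+ n != 0 by rewrite expf_neq0 // gt_eqF.
by field.
Qed.

Lemma moment_diff n a : 0 < a ->
  (fun l => (moment n (a * l) - moment n l) / (l ^+ n * G l)) @ +oo -->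
  c * half_moment (chi_ring n a).
Proof.
move=> a0.
have tring : tf (chi_ring n a).
  by apply: tf_lin => //; [apply: tf_scale => //|]; exact: tf_chi_power.
have d0 : 0 < Num.min 1 a by rewrite lt_min ltr01.
apply: cvgy_eq (half_limit tring d0 _) => [|x]; last first.
  rewrite le_min => /andP[x1 xa]; rewrite chi_ringE // !chi1 ?subrr ?mulr0 //.
  by rewrite normrM normfV (gtr0_norm a0) ler_pdivrMr ?mul1r.
exists 1 => l l1; have l0 : 0 < l by exact: lt_le_trans l1.
have -> : f (fun x => chi_ring n a (x / l)) =
    a ^+ n * f (fun x => chi_power n (x / (a * l))) - f (fun x => chi_power n (x / l)).
  have al0 : 0 < a * l by exact: mulr_gt0.
  have := ufunc_lin hM hf (a ^+ n) (-1) (tf_scale al0 (tf_chi_power n)) (tf_scale l0 (tf_chi_power n)).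
  rewrite mulN1r => <-; congr f; apply/funext => x; rewrite /chi_ring.
  have -> : x / (a * l) = x / l / a by rewrite invfM; ring.
  by [].
have ln0 : l ^+ n != 0 by rewrite expf_neq0 // gt_eqF.
have -> : moment n (a * l) - moment n l = l ^+ n *
    (a ^+ n * f (fun x => chi_power n (x / (a * l))) - f (fun x => chi_power n (x / l))).
  by rewrite /moment exprMn; ring.
by rewrite -mulf_div divff ?mul1r.
Qed.

(* The differences of the moment along l, 2l, 4l, ... are dominated by a geometric
   sequence, and the limit does not depend on l. *)
Lemma moment_limit n : gamma + n%:R < 0 -> exists A : R,
  (fun l => (moment n l - A) / (l ^+ n * G l)) @ +oo -->
  - (c * half_moment (fun x => x ^+ n * (1 - chi x))).
Proof.
move=> gn; pose W x := x ^+ n * G x.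
have hW : regvar W (gamma + n%:R) by exact: regvar_exprn.
(* Halving the negative exponent places q strictly between 2^(gamma + n) and 1. *)
pose q := 2 `^ ((gamma + n%:R) / 2) : R.
have q0 : 0 < q by exact: powR_gt0.
have Wq : 2 `^ (gamma + n%:R) < q.
  by rewrite /q /powR pnatr_eq0 /= ltr_expR ltr_pM2r ?ln_gt0 ?ltr1n //; lra.
have q1 : q < 1.
  rewrite /q /powR pnatr_eq0 /= expR_lt1 pmulr_llt0 ?ln_gt0 ?ltr1n //; lra.
have q10 : 0 < 1 - q by rewrite subr_gt0.
have [X1 X10 HX1] := regvar_double hW Wq.
have lim2 := @moment_diff n 2 (ltr0Sn R 1).
have /cvgy_ex /(_ 1 ltr01) [X2 X20 HX2] := lim2.
pose B := `|c * half_moment (chi_ring n 2)| + 1; pose X := X1 + X2.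
have X0 : 0 < X by exact: addr_gt0.
have p2 j : 1 <= (2 : R) ^+ j by rewrite exprn_ege1 // ler1n.
have Xp j l : X <= l -> X <= 2 ^+ j * l.
  move=> Xl; apply: le_trans (Xl) _; rewrite ler_peMl //.
  by apply: le_trans Xl; exact: ltW.
have Wj j l : X <= l -> 0 < W (2 ^+ j * l) /\ W (2 ^+ j * l) <= q ^+ j * W l.
  move=> Xl; have Wpos i : 0 < W (2 ^+ i * l) /\ W (2 * (2 ^+ i * l)) <= q * W (2 ^+ i * l).
    by apply: HX1; have := Xp i l Xl; rewrite /X; lra.
  split; first by have [] := Wpos j.
  elim: j => [|j IH]; first by rewrite !expr0 !mul1r.
  rewrite exprS -mulrA; have [_ H] := Wpos j; apply: le_trans H _.
  by rewrite exprS -mulrA ler_pM2l.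
have step j l : X <= l ->
    `|moment n (2 ^+ j.+1 * l) - moment n (2 ^+ j * l)| <= B * W l * q ^+ j.
  move=> Xl; have [Wp Wle] := Wj j l Xl.
  have := HX2 (2 ^+ j * l); rewrite mulrA -exprS -/(W _) => H.
  have {}H : `|(moment n (2 ^+ j.+1 * l) - moment n (2 ^+ j * l)) / W (2 ^+ j * l) -
      c * half_moment (chi_ring n 2)| <= 1.
    by apply: H; have := Xp j l Xl; rewrite /X; lra.
  have {}H : `|moment n (2 ^+ j.+1 * l) - moment n (2 ^+ j * l)| <= B * W (2 ^+ j * l).
    exact: ratio_bound Wp H.
  apply: le_trans H _; rewrite -mulrA ler_wpM2l ?[W l * _]mulrC //.
  by rewrite addr_ge0.
have lim l : X <= l -> exists A, forall j,
    `|moment n (2 ^+ j * l) - A| <= B * W l / (1 - q) * q ^+ j.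
  by move=> Xl; apply: geometric_limit => // j; exact: step.
have [A HA] := lim X (lexx X).
(* The points 2^j l and 2^j X have the fixed ratio l / X, so by [moment_diff] the moments there
   differ by O(W(2^j X)), which tends to 0: both sequences have the limit [A]. *)
have HAl l : X <= l -> forall j, `|moment n (2 ^+ j * l) - A| <= B * W l / (1 - q) * q ^+ j.
  move=> Xl; have [A' HA'] := lim l Xl; suff -> : A = A' by [].
  have l0 : 0 < l by exact: lt_le_trans Xl.
  have cvgA y a : (forall j, `|moment n (2 ^+ j * y) - a| <= B * W y / (1 - q) * q ^+ j) ->
      (fun j => moment n (2 ^+ j * y)) @ \oo --> a.
    move=> Ha; apply/subr_cvg0; apply: (@geometric_cvg0 _ _ (B * W y / (1 - q)) q).
      by rewrite (ltW q0).
    by apply: nearW.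
  have /cvgy_ex /(_ 1 ltr01) [Y Y0 HY] := @moment_diff n (l / X) (divr_gt0 l0 X0).
  have : (fun j => moment n (2 ^+ j * l) - moment n (2 ^+ j * X)) @ \oo --> A' - A.
    by apply: cvgB; exact: cvgA.
  have : (fun j => moment n (2 ^+ j * l) - moment n (2 ^+ j * X)) @ \oo --> 0.
    pose K := `|c * half_moment (chi_ring n (l / X))| + 1.
    apply: (@geometric_cvg0 _ _ (K * W X) q); first by rewrite (ltW q0).
    have := near_infty_natSinv_lt (PosNum (divr_gt0 X0 Y0)).
    apply: filterS => j /= Hj; have [Wp Wle] := Wj j X (lexx X).
    have Yj : Y <= 2 ^+ j * X.
      have n2 : j.+1%:R <= (2 : R) ^+ j by rewrite -natrX ler_nat ltn_expl.
      move: Hj; rewrite invf_plt ?posrE ?divr_gt0 // invf_div => Hj.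
      by rewrite -ler_pdivrMr //; apply: le_trans n2; exact: ltW.
    have := HY _ Yj; rewrite mulrCA divfK ?gt_eqF // -/(W _) => H.
    have {}H : `|moment n (2 ^+ j * l) - moment n (2 ^+ j * X)| <= K * W (2 ^+ j * X).
      exact: ratio_bound Wp H.
    apply: le_trans H _; rewrite -mulrA ler_wpM2l ?[W X * _]mulrC //.
    by rewrite addr_ge0.
  move=> c1 c2; apply/eqP; rewrite eq_sym -subr_eq0; apply/eqP.
  exact: (cvg_unique _ c2 c1).
exists A; have [Bc Bc1 HBc] := chi_bound.
(* [A] is approximated by the moment at 2^J l with error O(q^J W(l)). The ring functions x^n (chi (x
   / 2^J) - chi x) tend to x^n (1 - chi x), whose integral is the limit. *)
apply: (@cvgy_approx _ _ (fun J l => (moment n l - moment n (2 ^+ J * l)) / W l)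
  (fun J => - (c * half_moment (chi_ring n (2 ^+ J)))) (fun J => B / (1 - q) * q ^+ J)).
- move=> J; rewrite -mulN1r.
  have H := @moment_diff n (2 ^+ J) (lt_le_trans ltr01 (p2 J)).
  apply: cvgy_eq (@cvgy_scale _ (-1) _ _ H); exists 0 => l _.
  by rewrite mulN1r -mulNr opprB.
- apply: cvgN; apply: cvgM; first exact: cvg_cst.
  have s0 : 0 < - (gamma + n%:R) by rewrite oppr_gt0.
  have p20 J : 0 < (2 : R) ^+ J by exact: lt_le_trans (p2 J).
  apply: (@dominated_cvg_Rintegral _ (- (gamma + n%:R)) (2 * Bc)) => //.
  + move=> J; apply: cposM; first exact: cpos_powR.
    apply: cpos_continuous; apply: smooth_continuous; apply: (@tf_smooth _ M s).
    by apply: tf_lin => //; [apply: tf_scale => //|]; exact: tf_chi_power.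
  + move=> J; apply: dominated_infty => //.
      move=> x x0; rewrite normrM ger0_norm ?powR_ge0 // chi_ringE // normrM.
      rewrite ger0_norm ?exprn_ge0 ?(ltW x0) // mulrA opprK.
      have -> : gamma + n%:R - 1 = (gamma - 1) + n%:R by ring.
      rewrite (powR_add (gamma - 1) _ x0) powR_mulrn ?(ltW x0) //.
      rewrite [2 * Bc * _]mulrC ler_wpM2l ?mulr_ge0 ?powR_ge0 ?exprn_ge0 ?(ltW x0) //.
      apply: le_trans (ler_normB _ _) _.
      by have := HBc (x / 2 ^+ J); have := HBc x; lra.
    move=> x x0 x1; rewrite chi_ringE // !chi1 ?subrr ?mulr0 // gtr0_norm ?divr_gt0 ?(ltW x1) //.
    by rewrite ler_pdivrMr // mul1r; apply: le_trans (p2 J); exact: ltW.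
  + move=> x x0; apply: cvgM; first exact: cvg_cst.
    apply: cvg_near_cst.
    have xV : 0 < x^-1 by rewrite invr_gt0.
    have := near_infty_natSinv_lt (PosNum xV).
    apply: filterS => J /=; rewrite ltf_pV2 ?posrE // => Hj.
    have n2 : J.+1%:R <= (2 : R) ^+ J by rewrite -natrX ler_nat ltn_expl.
    rewrite chi_ringE // [chi (x / _)]chi1 // gtr0_norm ?divr_gt0 //.
    by rewrite ler_pdivrMr // mul1r (le_trans (ltW Hj)).
- rewrite -(mulr0 (B / (1 - q))); apply: cvgM; first exact: cvg_cst.
  by apply: cvg_expr; rewrite ger0_norm ?(ltW q0).
- move=> J; apply/neary_ex; exists X => // l Xl.
  have [Wp _] := Wj 0%N l Xl; rewrite expr0 mul1r in Wp.
  rewrite -mulrBl -/(W l).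
  have -> : moment n l - A - (moment n l - moment n (2 ^+ J * l)) = moment n (2 ^+ J * l) - A by ring.
  rewrite normrM normfV (gtr0_norm Wp) ler_pdivrMr //.
  by apply: le_trans (HAl l Xl J) _; rewrite le_eqVlt; apply/orP; left; apply/eqP; ring.
Qed.

(** A Frullani integral: since gamma + n = 0 the integrand is (chi (x/a) - chi x) / x. As chi itself
    over x is not integrable at 0, one works with a primitive [K] of (chi x - 1) / x, which is
    continuous at 0 and equals const - ln x from 2 on. *)
Lemma half_moment_ring n a : gamma + n%:R = 0 -> 0 < a ->
  half_moment (chi_ring n a) = ln a.
Proof.
move=> gn a0; have cchi : continuous chi by apply: smooth_continuous; exact: tf_smooth tchi.
pose k x := (chi x - 1) / x.
have ck : continuous k.
  move=> x; have [->|x0] := eqVneq x 0; last first.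
    apply: cvgM; last exact: cvgV.
    by apply: cvgB; [exact: cchi|exact: cvg_cst].
  rewrite /continuous_at /k invr0 mulr0; apply: cvg_near_cst.
  have := near_gtr (ltrN10 R); have := near_ltr (@ltr01 R).
  apply: filterS2 => y y1 y2; rewrite chi1 ?subrr ?mul0r // ler_norml; lra.
have [K dK] := primitive_ex ck.
have cK x : 0 <= x -> {for x, continuous K}.
  move=> x0; apply: differentiable_continuous.
  by apply/derivable1_diffP; have [] := dK x x0.
have KE y : 2 <= y -> K y = K 2 + ln 2 - ln y.
  move=> y2; have dg x : 2 <= x -> is_derive x 1 (fun z => K z + ln z) 0.
    move=> x2; have x0 : 0 < x by apply: lt_le_trans x2.
    have -> : 0 = k x + x^-1.
      by rewrite /k chi2 ?ger0_norm ?(ltW x0) // sub0r mulN1r addNr.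
    by apply: deriv_add; [apply: dK; exact: ltW|exact: is_derive1_ln].
  have [||z _] := @MVT_segment _ (fun z => K z + ln z) (fun=> 0) _ _ y2.
  - by move=> x; rewrite in_itv /= => /andP[/ltW /dg].
  - apply: continuous_in_subspaceT => x; rewrite inE /= in_itv /= => /andP[/dg [dx _] _].
    by apply: differentiable_continuous; exact/derivable1_diffP.
  by rewrite mul0r => /eqP; rewrite subr_eq0 => /eqP; lra.
(* Normalized to vanish for large x, where K (x/a) - K x = ln a; its limit at 0 is - ln a. *)
pose F x := - ln a + K (x / a) - K x.
have [Bc Bc1 HBc] := chi_bound.
pose d := Num.min 1 a.
have d0 : 0 < d by rewrite lt_min ltr01.
have fE x : 0 < x -> x `^ (gamma - 1) * chi_ring n a x = x^-1 * (chi (x / a) - chi x).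
  move=> x0; rewrite chi_ringE // mulrA; congr (_ * _).
  rewrite -powR_mulrn ?(ltW x0) // -powR_add // -powR_inv1 ?(ltW x0) //.
  by congr (_ `^ _); move: gn; lra.
have -> : ln a = 0 - (- ln a) by rewrite sub0r opprK.
rewrite /half_moment.
have cf : cpos (fun x => x `^ (gamma - 1) * chi_ring n a x).
  apply: cposM; first exact: cpos_powR.
  apply: cpos_continuous; apply: smooth_continuous; apply: (@tf_smooth _ M s).
  by apply: tf_lin => //; [apply: tf_scale => //|]; exact: tf_chi_power.
apply: (@improper_ftc R (fun x => x `^ (gamma - 1) * chi_ring n a x) F (- ln a) 0).
- exact: cf.
- apply: (@dominated_integrable _ 1 (2 * Bc / d * (2 + 2 * a) `^ (2 * 1))) => //.
  have r1 : 1 <= 2 + 2 * a by lra.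
  apply: dominated_near0 => // x x0.
    rewrite fE // subrr powRr0 mulr1.
    have [xd|dx] := leP x d.
      move: xd; rewrite le_min => /andP[x1 xa].
      rewrite !chi1 ?subrr ?mulr0 ?normr0 ?gtr0_norm ?divr_gt0 //.
        by rewrite divr_ge0 ?(ltW d0) // mulr_ge0 //; lra.
      by rewrite ler_pdivrMr // mul1r.
    rewrite normrM normfV (gtr0_norm x0) mulrC ler_pM ?invr_ge0 ?(ltW x0) //.
      by apply: le_trans (ler_normB _ _) _; have := HBc (x / a); have := HBc x; lra.
    by rewrite lef_pV2 ?posrE // ltW.
  have x00 : 0 < x by lra.
  have xa : 2 <= x / a by rewrite ler_pdivlMr //; lra.
  rewrite fE // !chi2 ?subrr ?mulr0 // gtr0_norm ?divr_gt0 //; lra.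
- move=> x x0; rewrite (fE x x0).
  have -> : x^-1 * (chi (x / a) - chi x) = (0 + k (x / a) * a^-1) + (-1) * k x.
    by rewrite /k; field; rewrite !gt_eqF.
  have -> : F = (fun x => (- ln a + K (x / a)) + (-1) * K x).
    by apply/funext => y; rewrite /F mulN1r.
  apply: deriv_add; last by apply: deriv_scale; apply: dK; exact: ltW.
  apply: (@deriv_add _ (fun=> - ln a) (fun y => K (y / a)) x 0 _ (is_derive_cst _ _ _)).
  apply: (@deriv_comp _ K (fun y => y / a)); first by apply: dK; rewrite divr_ge0 // ltW.
  have -> : (fun y : R => y / a) = (fun y => a^-1 * y) by apply/funext => y; rewrite mulrC.
  by rewrite -[X in is_derive _ _ _ X]mulr1; apply: deriv_scale; exact: is_derive_id.
- have h0 : (n.+1%:R^-1 : R) @[n --> \oo] --> 0 by exact: cvg_harmonic.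
  have -> : - ln a = - ln a + K (0 / a) - K 0 by rewrite mul0r addrK.
  apply: cvgB; last by apply: (cvg_comp _ _ h0); exact: cK.
  apply: cvgD; first exact: cvg_cst.
  have h1 : (n.+1%:R^-1 / a : R) @[n --> \oo] --> 0 / a by apply: cvgM => //; exact: cvg_cst.
  by apply: (cvg_comp _ _ h1); apply: cK; rewrite mul0r.
- apply: cvg_near_cst.
  have rV : 0 < (2 + 2 * a)^-1 by rewrite invr_gt0; lra.
  have := near_infty_natSinv_lt (PosNum rV).
  apply: filterS => J /=; rewrite ltf_pV2 ?posrE //; last lra.
  move=> HJ; have J0 : 0 < J.+1%:R :> R by [].
  have aJ : 2 <= J.+1%:R / a by rewrite ler_pdivlMr //; lra.
  have J2 : 2 <= J.+1%:R :> R by lra.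
  by rewrite /F (KE _ aJ) (KE _ J2) ln_div ?posrE //; lra.
Qed.

End half_line_functional.

(** * Identification of the limits *)

Section taylor.
Context {R : realType}.
Implicit Types (u : R -> R) (x : R) (m n p : nat).

Definition taylor_rem m u x := u x - \sum_(n < m) derive1n n u 0 / n`!%:R * x ^+ n.

Lemma deriv_sum (c : nat -> R) m x :
  is_derive x 1 (fun y : R => \sum_(i < m) c i * y ^+ i.+1) (\sum_(i < m) c i * (i.+1%:R * x ^+ i)).
Proof.
elim: m => [|m IH].
  rewrite big_ord0 (_ : (fun y : R => _) = (fun=> 0)); first exact: is_derive_cst.
  by apply/funext => y; rewrite big_ord0.
rewrite big_ord_recr (_ : (fun y : R => _) =
  (fun y => \sum_(i < m) c i * y ^+ i.+1 + c m * y ^+ m.+1)); last first.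
  by apply/funext => y; rewrite big_ord_recr.
apply: deriv_add IH _; apply: deriv_scale; exact: deriv_exprn.
Qed.

Lemma taylor_rem_derive m u x : smooth u ->
  is_derive x 1 (taylor_rem m.+1 u) (taylor_rem m (derive1 u) x).
Proof.
move=> su; pose c i := derive1n i.+1 u 0 / i.+1`!%:R.
have -> : taylor_rem m.+1 u = (fun y => (u y + (- u 0)) + (-1) * \sum_(i < m) c i * y ^+ i.+1).
  apply/funext => y; rewrite /taylor_rem big_ord_recl fact0 divr1 expr0 mulr1.
  by rewrite mulN1r opprD addrA; congr (_ - _ - _); apply: eq_bigr.
have -> : taylor_rem m (derive1 u) x =
    (derive1n 1 u x + 0) + (-1) * \sum_(i < m) c i * (i.+1%:R * x ^+ i).
  rewrite /taylor_rem addr0 mulN1r; congr (_ - _); apply: eq_bigr => i _.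
  rewrite -derive1nSr mulrA; congr (_ * _); rewrite /c factS natrM.
  by rewrite [i.+1%:R * _]mulrC invfM mulrA divfK // pnatr_eq0.
apply: deriv_add; last by apply: deriv_scale; exact: deriv_sum.
by apply: (@deriv_add _ u (fun=> - u 0)); exact: smooth_is_derive su 0%N x.
Qed.

(** Differentiation lowers the order of the remainder by one; truncated subtraction makes order 0,
    the function itself, persist from p = m on. *)
Lemma taylor_rem_jet m u : smooth u -> forall p x,
  is_derive x 1 (taylor_rem (m - p) (derive1n p u)) (taylor_rem (m - p.+1) (derive1n p.+1 u) x).
Proof.
move=> su p x; have sp := @smooth_derive1n _ p u su.
have [pm|mp] := ltnP p m.
  by rewrite subnS -{1}(prednK (_ : 0 < m - p)%N) ?subn_gt0 //; exact: taylor_rem_derive.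
rewrite (eqP mp) (eqP (leqW mp : m <= p.+1)%N).
have E0 v : taylor_rem 0 v = v by apply/funext => y; rewrite /taylor_rem big_ord0 subr0.
by rewrite !E0; exact: smooth_is_derive.
Qed.

Lemma derive1n_taylor_rem m u p : smooth u ->
  derive1n p (taylor_rem m u) = taylor_rem (m - p) (derive1n p u).
Proof. by move=> su; rewrite -(jetE (taylor_rem_jet m su)) subn0. Qed.

Lemma smooth_taylor_rem m u : smooth u -> smooth (taylor_rem m u).
Proof. by move=> su; have := jet_smooth (taylor_rem_jet m su); rewrite subn0. Qed.

Lemma taylor_rem_at0 m u : (0 < m)%N -> taylor_rem m u 0 = 0.
Proof.
case: m => // m _; rewrite /taylor_rem big_ord_recl fact0 divr1 mulr1 big1 ?addr0 ?subrr //.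
by move=> i _; rewrite expr0n mulr0.
Qed.

Lemma derive1n_taylor_rem_at0 m u p : smooth u -> (p < m)%N ->
  derive1n p (taylor_rem m u) 0 = 0.
Proof. by move=> su pm; rewrite derive1n_taylor_rem // taylor_rem_at0 // subn_gt0. Qed.

(** A class visibly stable under [derive1], as the induction by parts demands, without tracking
    weights. *)
Definition csmooth u := [/\ smooth u, exists2 r : R, 0 < r & forall x, r < `|x| -> u x = 0 &
  forall p, exists2 C : R, 0 <= C & forall x, `|derive1n p u x| <= C].

Lemma csmooth_derive u : csmooth u -> csmooth (derive1 u).
Proof.
move=> [su [r r0 ur] bu]; split.
- exact: smooth_derive.
- by exists r => // x; exact: (@derive1n_out _ u r 1 ur x).
- by move=> p; have [C C0 HC] := bu p.+1; exists C => // x; rewrite -derive1nSr.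
Qed.

Lemma tf_csmooth (M : nat -> R) (s : ultraclass) u : weight_sequence M -> tf M s u -> csmooth u.
Proof.
move=> hM tu; have [_ _ bu] := tu; split.
- exact: tf_smooth tu.
- exact: tf_supp tu.
- by move=> p; have [C C0 HC] := bfam_bound hM p bu; exists C => // x; exact: (HC tt).
Qed.

(** The bound x^m is Taylor's estimate, useful at 0. The bound x^(m-1), useful at infinity, treats
    the remainder as vanishing to order m - 1 only, with (m-1)-st derivative u^(m-1) -
    u^(m-1)(0). *)
Lemma taylor_rem_le m u : csmooth u ->
  exists2 C : R, 0 <= C & forall x, 0 < x ->
    `|taylor_rem m u x| <= C * x ^+ m /\ `|taylor_rem m u x| <= C * (x ^+ m / x).
Proof.
move=> [su [r r0 ur] bu]; have [C1 C10 H1] := bu m.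
suff [C2 C20 H2] : exists2 C : R, 0 <= C & forall x, 0 < x ->
    `|taylor_rem m u x| <= C * (x ^+ m / x).
  exists (C1 + C2); first exact: addr_ge0.
  move=> x x0; have xm : 0 <= x ^+ m by rewrite exprn_ge0 // ltW.
  split; last first.
    by apply: le_trans (H2 x x0) _; rewrite ler_wpM2r ?lerDr // divr_ge0 // ltW.
  apply: (@le_trans _ _ (C1 * x ^+ m)); last by rewrite ler_wpM2r // lerDl.
  rewrite -{2}(gtr0_norm x0); apply: vanish_le.
  - exact: smooth_taylor_rem.
  - by move=> j jm; exact: derive1n_taylor_rem_at0.
  - by move=> y; rewrite derive1n_taylor_rem // subnn /taylor_rem big_ord0 subr0; exact: H1.
(* For m = 0 the exponent m - 1 is negative and the bound by 1/x comes from compact support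
   instead. *)
case: m C1 C10 H1 => [|m] C1 C10 H1.
  exists (C1 * r); first by rewrite mulr_ge0 // ltW.
  move=> x x0; rewrite /taylor_rem big_ord0 subr0 expr0 div1r.
  have [xr|rx] := leP x r; last first.
    by rewrite ur ?normr0 ?(gtr0_norm x0) // mulr_ge0 ?invr_ge0 ?mulr_ge0 // ltW.
  apply: le_trans (H1 x) _; rewrite -mulrA ler_peMr // ler_pdivlMr //.
  by rewrite mul1r.
have [C2 C20 H2] := bu m.
exists (C2 + C2) => [|x x0]; first exact: addr_ge0.
rewrite exprSr mulfK ?gt_eqF // -{2}(gtr0_norm x0); apply: vanish_le => //.
- exact: smooth_taylor_rem.
- by move=> j jm; apply: derive1n_taylor_rem_at0 => //; exact: ltnW.
- move=> y; rewrite derive1n_taylor_rem // subSnn /taylor_rem big_ord1 fact0 divr1 expr0 mulr1.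
  by apply: le_trans (ler_normB _ _) _; rewrite lerD //; exact: H2.
Qed.

End taylor.

(** * Integration by parts for moments of Taylor remainders *)

Section half_moments.
Context {R : realType}.
Implicit Types (u : R -> R) (x gamma : R) (m n p : nat).
Local Notation mu := (@lebesgue_measure R).
Local Notation pos := (`]0, +oo[%classic : set (measurableTypeR R)).

Lemma dominated_minr (p q C : R) (f : R -> R) : 0 < p -> 0 < q ->
  (forall x, 0 < x -> `|f x| <= C * x `^ (p - 1) /\ `|f x| <= C * x `^ (- q - 1)) ->
  dominated (Num.min p q) C f.
Proof.
move=> p0 q0 H; have C0 : 0 <= C by apply: (@dominated_coef _ (p - 1) C f) => x /H[].
move=> x x0; have [H1 H2] := H x x0.
have mp : Num.min p q <= p by rewrite ge_min lexx.
have mq : Num.min p q <= q by rewrite ge_min lexx orbT.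
have m0 : 0 < Num.min p q by rewrite lt_min p0.
set e := Num.min p q in mp mq m0 *.
have Hx a b : x <= 1 -> a <= b -> x `^ b <= x `^ a.
  move=> x1 ab; rewrite -(subrK a b) addrC powR_add // ler_piMr ?powR_ge0 //.
  by have := ge0_ler_powR _ (ltW x0) ler01 x1; rewrite powR1; apply; rewrite subr_ge0.
have [x1|x1] := leP x 1; split.
- by apply: le_trans H1 _; rewrite ler_wpM2l //; apply: Hx => //; lra.
- by apply: le_trans H1 _; rewrite ler_wpM2l //; apply: Hx => //; lra.
- by apply: le_trans H2 _; rewrite ler_wpM2l // ler_powR ?(ltW x1) //; lra.
- by apply: le_trans H2 _; rewrite ler_wpM2l // ler_powR ?(ltW x1) //; lra.
Qed.

Lemma taylor_rem_moment gamma m u : csmooth u -> 0 < gamma + m%:R -> gamma + m%:R < 1 ->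
  exists e C, [/\ 0 < e, dominated e C (fun x => x `^ (gamma - 1) * taylor_rem m u x),
    forall x, 0 < x -> `|x `^ gamma * taylor_rem m u x| <= C * x `^ (gamma + m%:R) &
    forall x, 0 < x -> `|x `^ gamma * taylor_rem m u x| <= C * x `^ (gamma + m%:R - 1)].
Proof.
move=> tu g0 g1; have [C C0 HC] := taylor_rem_le m tu.
have H a b x : 0 < x -> a + m%:R = b -> `|x `^ a * taylor_rem m u x| <= C * x `^ b /\
    `|x `^ a * taylor_rem m u x| <= C * x `^ (b - 1).
  move=> x0 <-; have [H1 H2] := HC x x0.
  have a0 : 0 <= x `^ a by exact: powR_ge0.
  rewrite normrM ger0_norm // powR_add // powR_add // powR_add // powR_mulrn ?(ltW x0) //.
  rewrite powR_inv1 ?(ltW x0) //; split.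
    by rewrite mulrCA ler_wpM2l.
  by rewrite -mulrA mulrCA ler_wpM2l.
exists (Num.min (gamma + m%:R) (1 - (gamma + m%:R))), C; split.
- by rewrite lt_min g0 subr_gt0.
- apply: dominated_minr; rewrite ?subr_gt0 // => x x0.
  have [H1 H2] := H (gamma - 1) (gamma + m%:R - 1) x x0 (addrAC _ _ _); split => //.
  by apply: le_trans H2 _; rewrite ler_wpM2l // (_ : gamma + m%:R - 1 - 1 = - (1 - (gamma + m%:R)) - 1) //; ring.
- by move=> x x0; have [] := H gamma _ x x0 erefl.
- by move=> x x0; have [] := H gamma _ x x0 erefl.
Qed.

Lemma powR_natS_cvg0 (b : R) : b < 0 -> (n.+1%:R `^ b : R) @[n --> \oo] --> (0 : R).
Proof.
move=> b0; have := powR_cvgy0 b0; apply: cvg_comp.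
apply/cvgryPge => A; have := nbhs_infty_ger A.
by apply: filterS => n An; apply: le_trans An _; rewrite ler_nat.
Qed.

Lemma powR_natSinv_cvg0 (b : R) : 0 < b -> (n.+1%:R^-1 `^ b : R) @[n --> \oo] --> (0 : R).
Proof.
move=> b0; have /powR_natS_cvg0 : - b < 0 by rewrite oppr_lt0.
apply: cvg_trans; apply: near_eq_cvg; apply: nearW => n.
by rewrite -powR_inv1 // -powRrM mulN1r.
Qed.

(** The primitive x^gamma times the remainder is O(x^(gamma+m+1)) at 0 and O(x^(gamma+m)) at
    infinity. As 0 < gamma + m + 1 < 1, both boundary terms vanish. *)
Lemma half_moment_by_parts gamma m u : csmooth u -> 0 < gamma + m.+1%:R -> gamma + m.+1%:R < 1 ->
  gamma * half_moment gamma (taylor_rem m.+1 u) =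
  - half_moment (gamma + 1) (taylor_rem m (derive1 u)).
Proof.
move=> tu g0 g1; have [su _ _] := tu.
have gE : gamma + m.+1%:R = (gamma + 1) + m%:R by rewrite -natr1; ring.
have [e [C [e0 dC C1 C2]]] := taylor_rem_moment tu g0 g1.
have g0' : 0 < (gamma + 1) + m%:R by rewrite -gE.
have g1' : (gamma + 1) + m%:R < 1 by rewrite -gE.
have [e' [C' [e0' dC' _ _]]] := taylor_rem_moment (csmooth_derive tu) g0' g1'.
have cr n v : smooth v -> cpos (taylor_rem n v).
  by move=> sv; apply: cpos_continuous; apply: smooth_continuous; exact: smooth_taylor_rem.
have c1 : cpos (fun x => x `^ (gamma - 1) * taylor_rem m.+1 u x).
  by apply: cposM; [exact: cpos_powR|exact: cr].
have c2 : cpos (fun x => x `^ (gamma + 1 - 1) * taylor_rem m (derive1 u) x).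
  by apply: cposM; [exact: cpos_powR|apply: cr; exact: smooth_derive].
have i1 := dominated_integrable e0 c1 dC.
have i2 := dominated_integrable e0' c2 dC'.
have mpos : measurable pos by exact: measurable_itv.
have ig1 : mu.-integrable pos (EFin \o (fun x => gamma * (x `^ (gamma - 1) * taylor_rem m.+1 u x))).
  exact: (integrableZl mpos gamma i1).
apply/eqP; rewrite -addr_eq0; apply/eqP.
rewrite /half_moment -RintegralZl // -RintegralD //.
rewrite -[RHS](subrr (0 : R)).
have F0 (h : R ^nat) b : (h n `^ b @[n --> \oo] --> (0 : R)) -> (forall n, 0 < h n) ->
    (forall x, 0 < x -> `|x `^ gamma * taylor_rem m.+1 u x| <= C * x `^ b) ->
    (fun n => h n `^ gamma * taylor_rem m.+1 u (h n)) @ \oo --> 0.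
  move=> hb h0 HC; apply: norm_cvg0.
  have hb' : (fun n => C * h n `^ b) @ \oo --> 0.
    by rewrite -(mulr0 C); apply: cvgM => //; exact: cvg_cst.
  apply: squeeze_cvgr (cvg_cst 0) hb'.
  by apply: nearW => n; rewrite normr_ge0 HC.
apply: (@improper_ftc _ _ (fun x => x `^ gamma * taylor_rem m.+1 u x)).
- by apply: cposD => //; apply: cposM => //; exact: cpos_cst.
- exact: (integrableD mpos ig1 i2).
- move=> x x0; have := deriv_mul (is_derive1_powR gamma x0) (taylor_rem_derive m x su).
  by rewrite addrK -mulrA.
- by apply: (F0 _ _ (powR_natSinv_cvg0 g0)) => // n; rewrite invr_gt0.
- by apply: (F0 _ _ (@powR_natS_cvg0 (gamma + m.+1%:R - 1) _)) => //; rewrite subr_lt0.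
Qed.

Lemma half_moment_taylor_rem N gamma u : csmooth u -> 0 < gamma + N%:R -> gamma + N%:R < 1 ->
  half_moment gamma (taylor_rem N u) =
  (-1) ^+ N / (\prod_(i < N) (gamma + i%:R)) * half_moment (gamma + N%:R) (derive1n N u).
Proof.
elim: N gamma u => [|N IH] gamma u cu g0 g1.
  rewrite big_ord0 expr0 divr1 mul1r addr0; congr half_moment.
  by apply/funext => x; rewrite /taylor_rem big_ord0 subr0.
have gE : gamma + N.+1%:R = (gamma + 1) + N%:R by rewrite -natr1; ring.
have gn0 : gamma != 0.
  by apply/eqP => ge0; move: g1; rewrite ge0 add0r -natr1; have := ler0n R N; lra.
have := half_moment_by_parts cu g0 g1.
rewrite IH ?gE -?derive1nSr; [|exact: csmooth_derive|by rewrite -gE|by rewrite -gE].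
move=> H; apply: (mulfI gn0); rewrite H big_ord_recl addr0.
have -> : \prod_(i < N) (gamma + (lift ord0 i)%:R) = \prod_(i < N) (gamma + 1 + i%:R).
  by apply: eq_bigr => i _; rewrite lift0 -natr1; ring.
set P := \prod_(i < N) _; rewrite exprS invfM; set P' := P^-1; by field.
Qed.
End half_moments.

Lemma cvgyD (R : realType) (F H : R -> R) (a b : R) : F @ +oo --> a -> H @ +oo --> b ->
  (fun x => F x + H x) @ +oo --> a + b.
Proof. by move=> Fa Hb; exact: cvgD. Qed.

Lemma cvgy_sum (R : realType) (F : nat -> R -> R) (l : nat -> R) (P : pred nat) m :
  (forall n, P n -> F n @ +oo --> l n) ->
  (fun x => \sum_(n < m | P n) F n x) @ +oo --> \sum_(n < m | P n) l n.
Proof.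
move=> Fl; elim: m => [|m IH].
  rewrite big_ord0 (_ : (fun _ => _) = (fun=> 0)); first exact: cvg_cst.
  by apply/funext => x; rewrite big_ord0.
rewrite big_mkcond big_ord_recr -big_mkcond /=.
rewrite (_ : (fun _ => _) = (fun x => \sum_(n < m | P n) F n x + if P m then F m x else 0)); last first.
  by apply/funext => x; rewrite big_mkcond big_ord_recr -big_mkcond.
have H : (fun x => if P m then F m x else 0) @ +oo --> (if P m then l m else 0).
  by case: ifP => [/Fl//|_]; exact: cvg_cst.
exact: cvgD IH H.
Qed.

Section half_moment_integrable.
Context {R : realType}.
Implicit Types (v : R -> R) (gamma B r : R) (m n : nat) (k : nat -> R).
Local Notation mu := (@lebesgue_measure R).
Local Notation pos := (`]0, +oo[%classic : set (measurableTypeR R)).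

Definition half_integrable gamma v := mu.-integrable pos (EFin \o (fun x => x `^ (gamma - 1) * v x)).

Lemma half_integrable_near0 gamma m v B r : cpos v -> 0 < gamma + m%:R -> 1 <= r ->
  (forall x, 0 < x -> `|v x| <= B * x ^+ m) -> (forall x, r < x -> v x = 0) ->
  half_integrable gamma v.
Proof.
move=> cv g0 r1 vB vr.
apply: (@dominated_integrable _ _ (B * r `^ (2 * (gamma + m%:R)))); [exact: g0| |].
  by apply: cposM => //; exact: cpos_powR.
apply: dominated_near0 => // [x x0|x rx]; last by rewrite vr ?mulr0.
have -> : gamma + m%:R - 1 = (gamma - 1) + m%:R by ring.
rewrite (powR_add (gamma - 1) _ x0) powR_mulrn ?(ltW x0) //.
by rewrite normrM ger0_norm ?powR_ge0 // mulrCA ler_wpM2l ?powR_ge0 // vB.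
Qed.

Lemma half_integrable_infty gamma n v B : cpos v -> gamma + n%:R < 0 ->
  (forall x, 0 < x -> `|v x| <= B * x ^+ n) -> (forall x, 0 < x -> x < 1 -> v x = 0) ->
  half_integrable gamma v.
Proof.
move=> cv g0 vB v1.
apply: (@dominated_integrable _ (- (gamma + n%:R)) B); first by rewrite oppr_gt0.
  by apply: cposM => //; exact: cpos_powR.
apply: dominated_infty => [|x x0|x x0 x1]; [by rewrite oppr_gt0| |by rewrite v1 ?mulr0].
have -> : - - (gamma + n%:R) - 1 = (gamma - 1) + n%:R by ring.
rewrite (powR_add (gamma - 1) _ x0) powR_mulrn ?(ltW x0) //.
by rewrite normrM ger0_norm ?powR_ge0 // mulrCA ler_wpM2l ?powR_ge0 // vB.
Qed.

Lemma Rintegral_lin_sum (D : set (measurableTypeR R)) (v : R -> R) (w : nat -> R -> R) k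
    (P : pred nat) m : measurable D ->
  mu.-integrable D (EFin \o v) -> (forall n, (n < m)%N -> P n -> mu.-integrable D (EFin \o w n)) ->
  mu.-integrable D (EFin \o (fun x => v x - \sum_(n < m | P n) k n * w n x)) /\
  \int[mu]_(x in D) (v x - \sum_(n < m | P n) k n * w n x) =
  \int[mu]_(x in D) v x - \sum_(n < m | P n) k n * \int[mu]_(x in D) w n x.
Proof.
move=> mD iv; elim: m => [|m IH] iw.
  have -> : (fun x => v x - \sum_(n < 0 | P n) k n * w n x) = v.
    by apply/funext => x; rewrite big_ord0 subr0.
  by rewrite big_ord0 subr0.
have [i1 e1] := IH (fun n nm => iw n (ltnW nm)).
rewrite [X in _ = _ - X]big_mkcond big_ord_recr -big_mkcond /=.
have [Pm|Pm] := boolP (P m); last first.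
  suff -> : (fun x => v x - \sum_(n < m.+1 | P n) k n * w n x) =
      (fun x => v x - \sum_(n < m | P n) k n * w n x) by rewrite addr0.
  apply/funext => x; rewrite [in LHS]big_mkcond big_ord_recr -big_mkcond /=.
  by rewrite (negbTE Pm) addr0.
have i2 := integrableZl mD (k m) (iw m (ltnSn m) Pm).
have -> : (fun x => v x - \sum_(n < m.+1 | P n) k n * w n x) =
  (fun x => (v x - \sum_(n < m | P n) k n * w n x) - k m * w m x).
  apply/funext => x; rewrite [in LHS]big_mkcond big_ord_recr -big_mkcond /= Pm; ring.
split; first exact: (integrableB mD i1 i2).
rewrite RintegralB // RintegralZl //; last exact: (iw m (ltnSn m) Pm).
by rewrite e1 opprD addrA.
Qed.

Lemma half_moment_sum gamma v (w : nat -> R -> R) k (P : pred nat) m :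
  half_integrable gamma v -> (forall n, (n < m)%N -> P n -> half_integrable gamma (w n)) ->
  half_integrable gamma (fun x => v x - \sum_(n < m | P n) k n * w n x) /\
  half_moment gamma (fun x => v x - \sum_(n < m | P n) k n * w n x) =
  half_moment gamma v - \sum_(n < m | P n) k n * half_moment gamma (w n).
Proof.
move=> iv iw; have mpos : measurable pos by exact: measurable_itv.
rewrite /half_integrable /half_moment.
have -> : (fun x => x `^ (gamma - 1) * (v x - \sum_(n < m | P n) k n * w n x)) =
  (fun x => x `^ (gamma - 1) * v x - \sum_(n < m | P n) k n * (x `^ (gamma - 1) * w n x)).
  by apply/funext => x; rewrite mulrBr mulr_sumr; congr (_ - _); apply: eq_bigr => n _; ring.
exact: (@Rintegral_lin_sum _ _ (fun n x => x `^ (gamma - 1) * w n x)).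
Qed.

End half_moment_integrable.

(** * Expansion on arbitrary real test functions *)

Section real_expansion.
Context {R : realType} (M : nat -> R) (s : ultraclass).
Hypothesis hM : weight_sequence M.
Local Notation tf := (tf M s).
Local Notation tfam := (tfam M s).
Implicit Types (u v : R -> R) (l x a : R) (m n p : nat).

Variable chi : R -> R.
Hypothesis tchi : tf chi.
Hypothesis chi1 : forall x, `|x| <= 1 -> chi x = 1.
Hypothesis chi2 : forall x, 2 <= `|x| -> chi x = 0.

Definition taylor_coef u n := derive1n n u 0 / n`!%:R.

Definition taylor_cut m u x := u x - \sum_(n < m) taylor_coef u n * chi_power chi n x.

Lemma taylor_cutS m u : taylor_cut m.+1 u =
  (fun x => 1 * taylor_cut m u x + (- taylor_coef u m) * chi_power chi m x).
Proof.
by apply/funext => x; rewrite /taylor_cut big_ord_recr /= mul1r mulNr opprD addrA.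
Qed.

Lemma tf_taylor_cut m u : tf u -> tf (taylor_cut m u).
Proof.
move=> tu; elim: m => [|m IH].
  by have -> : taylor_cut 0 u = u by apply/funext => x; rewrite /taylor_cut big_ord0 subr0.
rewrite taylor_cutS; apply: tf_lin => //.
exact: tf_chi_power.
Qed.

Lemma taylor_cut_eq m u x : `|x| <= 1 -> taylor_cut m u x = taylor_rem m u x.
Proof.
move=> x1; rewrite /taylor_cut /taylor_rem; congr (_ - _); apply: eq_bigr => n _.
by rewrite /chi_power chi1 // mulr1.
Qed.

Lemma derive1n_taylor_cut m u p : smooth u -> (p < m)%N -> derive1n p (taylor_cut m u) 0 = 0.
Proof.
move=> su pm; rewrite (@derive1n_near _ _ (taylor_rem m u)); first exact: derive1n_taylor_rem_at0.
have := near_gtr (ltrN10 R); have := near_ltr (@ltr01 R).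
by apply: filterS2 => y y1 y2; rewrite taylor_cut_eq // ler_norml; lra.
Qed.

Variables (f : (R -> R) -> R) (G : R -> R) (gamma c : R).
Hypothesis hfG : half_quasiasymptotic M s f G gamma c.

Let hf : ufunc M s f. Proof. by case: hfG. Qed.
Let hG : regvar G gamma. Proof. by case: hfG. Qed.

Lemma ufunc_taylor_cut m u l : 0 < l -> tf u ->
  f (fun x => u (x / l)) = f (fun x => taylor_cut m u (x / l)) +
    \sum_(n < m) taylor_coef u n * (moment f chi n l / l ^+ n).
Proof.
move=> l0 tu; elim: m => [|m IH].
  rewrite big_ord0 addr0; congr f; apply/funext => x.
  by rewrite /taylor_cut big_ord0 subr0.
rewrite IH big_ord_recr taylor_cutS (ufunc_lin hM hf); last 2 first.
- by apply: tf_scale => //; exact: tf_taylor_cut.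
- by apply: tf_scale => //; exact: tf_chi_power.
have lm : l ^+ m != 0 by rewrite expf_neq0 // gt_eqF.
rewrite /= {2}/moment [l ^+ m * _ / _]mulrAC divff // mul1r.
by set S := \sum_(_ < _) _; ring.
Qed.

Lemma expansion m u : tf u -> 0 < gamma + m%:R ->
  (fun l => (f (fun x => u (x / l)) - \sum_(n < m) taylor_coef u n * (moment f chi n l / l ^+ n)) / G l)
    @ +oo --> c * half_moment gamma (taylor_cut m u).
Proof.
move=> tu gm; have su := tf_smooth tu.
have := @vanishing_limit _ M s hM f G gamma c hfG chi tchi chi1 chi2 (taylor_cut m u) m
  (tf_taylor_cut m tu) (fun p => @derive1n_taylor_cut m u p su) gm.
apply: cvgy_eq; exists 1 => l l1; rewrite (ufunc_taylor_cut m _ tu) ?addrK //.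
exact: lt_le_trans l1.
Qed.

Lemma half_integrable_taylor_cut m u : tf u -> 0 < gamma + m%:R ->
  half_integrable gamma (taylor_cut m u).
Proof.
move=> tu gm; have tc := tf_taylor_cut m tu.
have [B B0 HB] := vanishing_bound hM tc (fun p => @derive1n_taylor_cut m u p (tf_smooth tu)).
have [r r0 ur] := tf_supp tc.
apply: (@half_integrable_near0 _ _ m _ B (1 + r)) => //.
- by apply: cpos_continuous; apply: smooth_continuous; exact: tf_smooth tc.
- by rewrite lerDl ltW.
- by move=> x x0; rewrite -{2}(gtr0_norm x0).
- by move=> x rx; apply: ur; apply: lt_le_trans (ler_norm x); lra.
Qed.

Lemma half_integrable_tail n : gamma + n%:R < 0 ->
  half_integrable gamma (fun x => x ^+ n * (1 - chi x)).
Proof.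
move=> gn; have [B B1 HB] := chi_bound hM tchi chi1.
apply: (@half_integrable_infty _ _ n _ (1 + B)) => //.
- apply: cposM; first by apply: cpos_continuous; exact: smooth_continuous (@smooth_exprn R n).
  have -> : (fun x => 1 - chi x) = (fun x => 1 + (-1) * chi x).
    by apply/funext => x; rewrite mulN1r.
  apply: cposD; first exact: cpos_cst.
  apply: cposM; first exact: cpos_cst.
  by apply: cpos_continuous; apply: smooth_continuous; exact: tf_smooth tchi.
- move=> x x0; rewrite normrM ger0_norm ?exprn_ge0 ?(ltW x0) // mulrC.
  rewrite ler_wpM2r ?exprn_ge0 ?(ltW x0) //.
  by apply: le_trans (ler_normB _ _) _; rewrite normr1 lerD2l.
- by move=> x x0 x1; rewrite chi1 ?subrr ?mulr0 // gtr0_norm // ltW.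
Qed.

(** Replacing a moment with gamma + n < 0 by its limit [A n] alters the limit by -c times the
    integral of x^(gamma-1) x^n (1 - chi x), so the subtracted Taylor terms lose their cutoff.
    Moments with gamma + n >= 0 have to be kept. *)
Lemma expansion_constants m : 0 < gamma + m%:R -> exists A : nat -> R, forall u, tf u ->
  (fun l => (f (fun x => u (x / l)) - \sum_(n < m) taylor_coef u n *
      ((if gamma + n%:R < 0 then A n else moment f chi n l) / l ^+ n)) / G l)
    @ +oo --> c * half_moment gamma (fun x => taylor_cut m u x -
      \sum_(n < m | gamma + n%:R < 0) taylor_coef u n * (x ^+ n * (1 - chi x))).
Proof.
move=> gm.
have /choice[A HA] : forall n, exists A : R, gamma + n%:R < 0 ->
    (fun l => (moment f chi n l - A) / (l ^+ n * G l)) @ +oo -->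
    - (c * half_moment gamma (fun x => x ^+ n * (1 - chi x))).
  move=> n; have [gn|gn] := ltP (gamma + n%:R) 0; last by exists 0.
  by have [A HA] := moment_limit hM hfG tchi chi1 gn; exists A.
exists A => u tu.
have [_ ->] := @half_moment_sum _ gamma (taylor_cut m u) (fun n x => x ^+ n * (1 - chi x))
  (taylor_coef u) (fun n => gamma + n%:R < 0) m (half_integrable_taylor_cut tu gm)
  (fun n _ => @half_integrable_tail n).
pose E n l := taylor_coef u n * ((moment f chi n l - A n) / (l ^+ n * G l)).
have H2 : (fun l => \sum_(n < m | gamma + n%:R < 0) E n l) @ +oo -->
    \sum_(n < m | gamma + n%:R < 0) taylor_coef u n *
      - (c * half_moment gamma (fun x => x ^+ n * (1 - chi x))).
  apply: (@cvgy_sum _ E (fun n => taylor_coef u n * - (c * half_moment gamma (fun x => x ^+ n * (1 - chi x))))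
    (fun n => gamma + n%:R < 0)) => n gn.
  by apply: cvgM; [exact: cvg_cst|exact: HA].
have := cvgyD (expansion tu gm) H2.
rewrite mulrBr mulr_sumr -sumrN.
have -> : \sum_(n < m | gamma + n%:R < 0) taylor_coef u n *
      - (c * half_moment gamma (fun x => x ^+ n * (1 - chi x))) =
   \sum_(n < m | gamma + n%:R < 0) - (c * (taylor_coef u n * half_moment gamma (fun x => x ^+ n * (1 - chi x)))).
  by apply: eq_bigr => n _; ring.
apply: cvgy_eq; exists 1 => l l1; have l0 : 0 < l by exact: lt_le_trans l1.
rewrite /E [X in _ + X]big_mkcond.
have -> : \sum_(n < m) (if gamma + n%:R < 0 then taylor_coef u n * ((moment f chi n l - A n) / (l ^+ n * G l)) else 0) =
   (\sum_(n < m) taylor_coef u n * (moment f chi n l / l ^+ n) -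
    \sum_(n < m) taylor_coef u n * ((if gamma + n%:R < 0 then A n else moment f chi n l) / l ^+ n)) / G l.
  rewrite -sumrB mulr_suml; apply: eq_bigr => n _.
  by case: ifP => _; rewrite ?subrr ?mul0r // invfM; ring.
by rewrite -mulrDl addrA subrK.
Qed.

Lemma moment_log n a : gamma + n%:R = 0 -> 0 < a ->
  (fun l => (moment f chi n (a * l) - moment f chi n l) / (l ^+ n * G l)) @ +oo --> c * ln a.
Proof.
move=> gn a0; have := @moment_diff _ M s hM f G gamma c hfG chi tchi chi1 n a a0.
by rewrite (half_moment_ring hM tchi chi1 chi2 gn a0).
Qed.

End real_expansion.

(** * Values of the Gamma function at negative non-integers *)

Section gamma_function.
Context {R : realType}.
Implicit Types (x alpha : R) (N : nat).
Local Notation mu := (@lebesgue_measure R).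
Local Notation pos := (`]0, +oo[%classic : set (measurableTypeR R)).

(** A divergent integral would have value 0 by convention, so integrability is established before
    bounding below by the integral over [1, 2]. *)
Lemma Gamma_integral_neq0 x : 0 < x -> x < 1 -> Gamma_integral x != 0.
Proof.
move=> x0 x1; pose g t : R := t `^ (x - 1) * expR (- t).
have cg : cpos g.
  apply: cposM; first exact: cpos_powR.
  apply: cpos_derive => t t0; exists (expR (- t) * -1).
  by apply: (@deriv_comp _ expR (fun y => - y)).
have gd : dominated (Num.min x 1) 4 g.
  apply: dominated_minr => // t t0.
  have e0 : 0 < expR (- t) by exact: expR_gt0.
  have e1 : expR (- t) <= 1 by rewrite -expR0 ler_expR; lra.
  have p0 : 0 <= t `^ (x - 1) by exact: powR_ge0.
  rewrite /g ger0_norm; last by rewrite mulr_ge0 // ltW.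
  split; first by rewrite mulrC ler_wpM2r //; lra.
  (* From exp t >= (1 + t/2)^2, four times which dominates 1 + t^2; it yields the decay t^-2 at
     infinity. *)
  have E2 : expR (- t) * (1 + t ^+ 2) <= 4.
    have H : 1 + t / 2 <= expR (t / 2) by exact: expR_ge1Dx.
    have H2 : (1 + t / 2) ^+ 2 <= expR (t / 2) ^+ 2.
      by rewrite ler_sqr ?nnegrE ?expR_ge0 //; lra.
    rewrite expRN mulrC ler_pdivrMr ?expR_gt0 //.
    have -> : expR t = expR (t / 2) ^+ 2 by rewrite expr2 -expRD; congr expR; field.
    by move: H2; nra.
  have -> : t `^ (x - 1) = t `^ (x + 1) * t `^ (- 1 - 1).
    by rewrite -powR_add //; congr (_ `^ _); ring.
  rewrite -mulrA [t `^ (-1 - 1) * _]mulrC mulrA ler_wpM2r ?powR_ge0 //.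
  apply: le_trans E2; rewrite mulrC ler_wpM2l ?(ltW e0) //.
  have [t1|t1] := leP t 1.
    have : t `^ (x + 1) <= 1 by have := ge0_ler_powR _ (ltW t0) ler01 t1; rewrite powR1; apply; lra.
    by have := sqr_ge0 t; lra.
  have : t `^ (x + 1) <= t `^ 2%:R by rewrite ler_powR ?(ltW t1) //; lra.
  by rewrite powR_mulrn ?(ltW t0) //; lra.
have m0 : 0 < Num.min x 1 by rewrite lt_min x0 ltr01.
have ig := dominated_integrable m0 cg gd.
have mpos : measurable pos by exact: measurable_itv.
pose D : set (measurableTypeR R) := `[1, 2]%classic.
have msub : measurable D by exact: measurable_itv.
have sub : D `<=` pos.
  by move=> t; rewrite /D /= !in_itv /= andbT => /andP[t1 _]; exact: lt_le_trans ltr01 t1.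
pose b := expR (- 2) * 2 `^ (x - 1) : R.
have b0 : 0 < b by rewrite mulr_gt0 ?expR_gt0 ?powR_gt0.
suff : 0 < Gamma_integral x by move/gt_eqF => ->.
rewrite /Gamma_integral; apply: (lt_le_trans b0).
rewrite /Rintegral -lee_fin fineK; last exact: integrable_fin_num.
have g0 t : 0 < t -> (0 <= (g t)%:E)%E.
  by move=> t0; rewrite lee_fin mulr_ge0 ?powR_ge0 ?expR_ge0.
apply: (@le_trans _ _ (\int[mu]_(t in D) (g t)%:E)%E); last first.
  apply: ge0_subset_integral => //; first by apply/measurable_EFinP; exact: cpos_measurable.
  by move=> t /posE; exact: g0.
apply: (@le_trans _ _ (\int[mu]_(t in D) b%:E)%E).
  have muD : mu D = (2 - 1)%:E.
    by have := @lebesgue_measure_itv R `[1, 2]; rewrite /= lte_fin ltr1n -EFinD.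
  by rewrite integral_cst // [X in (_ <= _ * X)%E]muD -EFinM lee_fin; lra.
apply: ge0_le_integral => //.
- by move=> t _; rewrite lee_fin ltW.
- by apply/measurable_EFinP; apply: measurable_funS (cpos_measurable cg).
- move=> t; rewrite /D /= in_itv /= => /andP[t1 t2]; rewrite lee_fin /b /g mulrC.
  have t0 : 0 < t by lra.
  apply: ler_pM; rewrite ?powR_ge0 ?expR_ge0 ?ler_expR //; last lra.
  have -> : x - 1 = - (1 - x) by ring.
  rewrite !powRN lef_pV2 ?posrE ?powR_gt0 //.
  by rewrite ge0_ler_powR ?nnegrE //; lra.
Qed.

Lemma Gamma_ratio alpha N : (0 < N)%N -> - N.+1%:R < alpha -> alpha < - N%:R ->
  Gamma (alpha + 1) / Gamma (alpha + N%:R + 1) = (\prod_(i < N) (alpha + 1 + i%:R))^-1.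
Proof.
case: N => // N _; rewrite -[N.+2%:R]natr1 => a1 a2.
(* Here N has been lowered by one, so the recursion in [Gamma] uses exactly the original N factors
   and reaches the argument alpha + N + 1, lying in ]0, 1[. *)
have t0 : Num.truncn (- (alpha + 1)) = N.
  by apply: truncn_def; rewrite -natr1 in a1 a2 *; lra.
have N0 : 0 <= N%:R :> R by exact: ler0n.
have g0 : 0 < alpha + N.+1%:R + 1 by lra.
rewrite /Gamma g0 (_ : 0 < alpha + 1 = false); last by apply/negbTE; rewrite -leNgt; rewrite -natr1 in a2; lra.
rewrite t0 (_ : alpha + 1 + N.+1%:R = alpha + N.+1%:R + 1); last by ring.
by rewrite mulrAC divff ?mul1r // Gamma_integral_neq0 //; lra.
Qed.

End gamma_function.

Section finite_part.
Context {R : realType}.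
Local Notation mu := (@lebesgue_measure R).
Local Notation pos := (`]0, +oo[%classic : set (measurableTypeR R)).
Local Notation tail := (`]1, +oo[%classic : set (measurableTypeR R)).
Implicit Types (u : R -> R) (x p : R) (k n : nat).

Lemma powR_tail p : 1 < p -> mu.-integrable tail (EFin \o (fun x => x `^ (- p))) /\
  \int[mu]_(x in tail) x `^ (- p) = (p - 1)^-1.
Proof.
move=> p1; pose F x := (1 - p)^-1 * x `^ (1 - p).
have dF x : 0 < x -> is_derive x 1 F (x `^ (- p)).
  move=> x0; have -> : x `^ (- p) = (1 - p)^-1 * ((1 - p) * x `^ (1 - p - 1)).
    rewrite mulrA mulVf ?mul1r; last by rewrite lt_eqF // subr_lt0.
    by congr (_ `^ _); ring.
  by apply: deriv_scale; exact: is_derive1_powR.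
have cF : cpos F by apply: cpos_derive => x x0; exists (x `^ (- p)); exact: dF.
have F1 : F 1 = - (p - 1)^-1 by rewrite /F powR1 mulr1 -invrN opprB.
pose D : set (measurableTypeR R) := `[1, +oo[%classic.
have H : (\int[mu]_(x in D) (x `^ (- p))%:E = 0%:E - (F 1)%:E)%E.
  apply: ge0_continuous_FTC2y.
  - by move=> x _; exact: powR_ge0.
  - apply: continuous_in_subspaceT => x; rewrite inE /= in_itv /= andbT => x1.
    by apply: cpos_powR; exact: lt_le_trans x1.
  - rewrite -(mulr0 (1 - p)^-1); apply: cvgy_scale; apply: powR_cvgy0; lra.
  - by move=> x x1; have [] := dF x (lt_trans ltr01 x1).
  - exact: cvg_at_right_filter (cF 1 ltr01).
  - move=> x; rewrite in_itv /= andbT => x1.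
    by rewrite derive1E; have [_ ->] := dF x (lt_trans ltr01 x1).
have sub : tail `<=` pos by move=> x /=; rewrite !in_itv /= !andbT; exact: lt_trans.
have mt : measurable_fun D (EFin \o (fun x : measurableTypeR R => x `^ (- p) : measurableTypeR R)).
  apply/measurable_EFinP; apply: measurable_funS (cpos_measurable (@cpos_powR R (- p))) => //.
  by move=> x; rewrite /D /= !in_itv /= !andbT => x1; exact: lt_le_trans ltr01 x1.
have i1 : mu.-integrable D (EFin \o (fun x => x `^ (- p))).
  apply/integrableP; split => //.
  under eq_integral do rewrite /= ger0_norm ?powR_ge0 //.
  by rewrite H F1 -EFinB ltry.
have i2 : mu.-integrable tail (EFin \o (fun x => x `^ (- p))).
  apply: integrableS i1; [exact: measurable_itv|exact: measurable_itv|].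
  by move=> x; rewrite /D /= !in_itv /= !andbT; exact: ltW.
split => //; rewrite Rintegral_itv_obnd_cbnd // /Rintegral H F1 /=.
by rewrite sub0r opprK.
Qed.

Lemma tail_integrable_le (v w : R -> R) : cpos w -> half_integrable 1 v ->
  (forall x, 1 < x -> `|w x| <= `|v x|) -> mu.-integrable tail (EFin \o w).
Proof.
move=> cw iv wv; have mt : measurable tail by exact: measurable_itv.
have sub : tail `<=` pos by move=> x /=; rewrite !in_itv /= !andbT; exact: lt_trans.
have iv' : mu.-integrable tail (EFin \o (fun x => x `^ (1 - 1) * v x)).
  by apply: integrableS iv => //; exact: measurable_itv.
apply: le_integrable iv' => //.
  by apply/measurable_EFinP; apply: measurable_funS (cpos_measurable cw) => //; exact: measurable_itv.
move=> x; rewrite /= in_itv /= andbT => x1.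
by rewrite lee_fin subrr powRr0 mul1r wv.
Qed.

Variables (M : nat -> R) (s : ultraclass).
Hypothesis hM : weight_sequence M.
Variable chi : R -> R.
Hypothesis tchi : tf M s chi.
Hypothesis chi1 : forall x, `|x| <= 1 -> chi x = 1.

Lemma tf_half_integrable u : tf M s u -> half_integrable 1 u.
Proof.
move=> tu; have [r r0 ur] := tf_supp tu; have [_ _ bu] := tu.
have [B B0 HB] := bfam_bound hM 0 bu.
apply: (@half_integrable_near0 _ _ 0 _ B (1 + r)).
- by apply: cpos_continuous; apply: smooth_continuous; exact: tf_smooth tu.
- by rewrite addr0.
- by rewrite lerDl ltW.
- by move=> x _; rewrite expr0 mulr1; exact: (HB tt x I).
- by move=> x rx; apply: ur; apply: lt_le_trans (ler_norm x); lra.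
Qed.

(** Split at 1. Below 1 the cutoff is 1 and the whole Taylor polynomial is subtracted. Above 1 the
    terms n < k recombine to x^n without cutoff and integrate to 1/(k - n), the Hadamard constants;
    the term n = k keeps its cutoff, since 1/x is not integrable at infinity. *)
Lemma finite_part_identity k u : tf M s u ->
  half_moment (- k%:R) (fun x => taylor_cut chi k.+1 u x -
    \sum_(n < k.+1 | - k%:R + n%:R < 0 :> R) taylor_coef u n * (x ^+ n * (1 - chi x))) =
  \int[mu]_(x in `]0, 1[) (taylor_rem k.+1 u x / x ^+ k.+1) +
  \int[mu]_(x in tail) (u x / x ^+ k.+1) -
  \sum_(n < k) taylor_coef u n / (k - n)%N%:R -
  taylor_coef u k * \int[mu]_(x in tail) (chi x / x).
Proof.
move=> tu; set V := (fun x => _ - _).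
have g0 : 0 < - k%:R + k.+1%:R :> R by rewrite -natr1 addKr.
have [iV _] := @half_moment_sum _ (- k%:R) (taylor_cut chi k.+1 u) (fun n x => x ^+ n * (1 - chi x))
  (taylor_coef u) (fun n => - k%:R + n%:R < 0) k.+1 (half_integrable_taylor_cut hM tchi chi1 tu g0)
  (fun n _ => @half_integrable_tail _ _ _ hM _ tchi chi1 _ n).
have kE x : 0 < x -> x `^ (- k%:R - 1) = (x ^+ k.+1)^-1.
  by move=> x0; rewrite -opprD natr1 powRN powR_mulrn // ltW.
have nk n : (- k%:R + n%:R < 0 :> R) = (n < k)%N by rewrite addrC subr_lt0 ltr_nat.
have pos1 : (BRight 0 <= BRight (1 : R))%O by rewrite bnd_simp.
have pos2 : (BRight (1 : R) <= +oo)%O by [].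
pose g x := x `^ (- k%:R - 1) * V x.
have ig : mu.-integrable pos (EFin \o g) by exact: iV.
have -> : half_moment (- k%:R) V = \int[mu]_(x in pos) g x by [].
have := Rintegral_itvB ig pos1 pos2; move/(congr1 (fun t => t + \int[mu]_(x in `]0, 1]) g x)).
rewrite subrK [RHS]addrC => ->.
rewrite -Rintegral_itv_bndo_bndc; last first.
  apply: integrableS ig; [exact: measurable_itv|exact: measurable_itv|].
  by move=> x /=; rewrite !in_itv /= andbT => /andP[].
rewrite -!addrA; congr (_ + _).
  apply: eq_Rintegral => x; rewrite inE /= in_itv /= => /andP[x0 x1].
  rewrite /g kE // mulrC /V taylor_cut_eq ?gtr0_norm ?(ltW x1) //.
  rewrite big1 ?subr0 // => n _; rewrite chi1 ?subrr ?mulr0 //.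
  by rewrite gtr0_norm // ltW.
pose W (n : nat) x : R := if (n < k)%N then x `^ (- (k.+1 - n)%N%:R) else chi x / x.
have su := tf_smooth tu.
have cinv n : cpos (fun x : R => (x ^+ n)^-1).
  move=> x x0; apply: cvgV; first by rewrite expf_neq0 // gt_eqF.
  exact: (@exprn_continuous R n x).
have i1 : mu.-integrable tail (EFin \o (fun x => u x / x ^+ k.+1)).
  apply: tail_integrable_le (tf_half_integrable tu) _.
    apply: cposM => //; apply: cpos_continuous; exact: smooth_continuous.
  move=> x x1; rewrite normrM ler_piMr // normfV ger0_norm ?exprn_ge0 ?(le_trans ler01 (ltW x1)) //.
  by rewrite invf_le1 ?exprn_gt0 ?(lt_trans ltr01 x1) // exprn_ege1 // ltW.
have pn n : (n < k)%N -> 1 < (k.+1 - n)%N%:R :> R.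
  by move=> nk'; rewrite ltr1n subSn ?(ltnW nk') // ltnS subn_gt0.
have i2 n : (n < k.+1)%N -> true -> mu.-integrable tail (EFin \o W n).
  move=> _ _; rewrite /W; have [nk'|_] := ltnP n k; first by have [] := powR_tail (pn n nk').
  apply: tail_integrable_le (tf_half_integrable tchi) _.
    apply: cposM; last by have := cinv 1%N; under eq_fun do rewrite expr1.
    by apply: cpos_continuous; apply: smooth_continuous; exact: tf_smooth tchi.
  move=> x x1; have x0 : 0 < x by exact: lt_trans x1.
  by rewrite normrM ler_piMr // normfV gtr0_norm // invf_le1 // ltW.
have mt : measurable tail by exact: measurable_itv.
have [_] := Rintegral_lin_sum (taylor_coef u) mt i1 i2.
have -> : \int[mu]_(x in tail) (u x / x ^+ k.+1 - \sum_(n < k.+1) taylor_coef u n * W n x) =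
    \int[mu]_(x in tail) g x.
  apply: eq_Rintegral => x; rewrite inE /= in_itv /= andbT => x1.
  have x0 : 0 < x by exact: lt_trans x1.
  rewrite /g kE // /V /taylor_cut -addrA -opprD mulrBr [_ * u x]mulrC; congr (_ - _).
  rewrite [X in _ = _ * (_ + X)]big_mkcond -big_split mulr_sumr; apply: eq_bigr => n _ /=.
  rewrite nk /W /chi_power; case: ifPn => [nk'|nk'].
    rewrite powRN powR_mulrn ?(ltW x0) //.
    have -> : x ^+ k.+1 = x ^+ n * x ^+ (k.+1 - n) by rewrite -exprD subnKC // ltnW.
    by field; rewrite !expf_neq0 ?gt_eqF.
  have -> : n = k :> nat by apply/eqP; rewrite eqn_leq -ltnS ltn_ord leqNgt.
  by rewrite addr0 exprS; field; rewrite expf_neq0 gt_eqF.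
move=> ->; congr (_ + _); rewrite big_ord_recr /= -opprD; congr (- (_ + _)).
  apply: eq_bigr => n _; congr (_ * _); rewrite /W ltn_ord.
  have [_ ->] := powR_tail (pn n (ltn_ord n)).
  by rewrite (subSn (ltnW (ltn_ord n))) -[(k - n).+1%:R]natr1 addrK.
by rewrite /W ltnn.
Qed.

End finite_part.

(** * Complex-valued test functions *)

Section complex_limits.
Context {R : realType}.
Local Notation normc := (@ComplexField.Normc.normc R).
Implicit Types (a b : R) (z : R[i]).

Lemma ler_Re_normc a b : `|a| <= normc (a +i* b)%C.
Proof. by rewrite /= -sqrtr_sqr ler_wsqrtr // lerDl sqr_ge0. Qed.

Lemma ler_Im_normc a b : `|b| <= normc (a +i* b)%C.
Proof. by rewrite /= -sqrtr_sqr ler_wsqrtr // lerDr sqr_ge0. Qed.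

Lemma normc_real a : normc (a +i* 0)%C = `|a|.
Proof. by rewrite /= expr0n addr0 sqrtr_sqr. Qed.

Lemma normc_le a b : normc (a +i* b)%C <= `|a| + `|b|.
Proof.
rewrite /= -[leRHS]ger0_norm ?addr_ge0 // -sqrtr_sqr ler_wsqrtr //.
rewrite sqrrD -!normrX (ger0_norm (sqr_ge0 a)) (ger0_norm (sqr_ge0 b)).
by rewrite lerD2r lerDl mulrn_wge0 // mulr_ge0.
Qed.

Lemma normc_ge0 z : 0 <= normc z.
Proof. by case: z => a b; exact: sqrtr_ge0. Qed.

Lemma cvgy_complexP (X Y : R -> R) x y :
  ((fun l => (X l +i* Y l)%C) @ +oo --> ((x +i* y)%C : R[i]^o)) <->
  (X @ +oo --> x /\ Y @ +oo --> y).
Proof.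
have P : ((fun l => (X l +i* Y l)%C) @ +oo --> ((x +i* y)%C : R[i]^o)) <->
    forall e : R[i], 0 < e -> \forall l \near +oo, `|((x +i* y)%C : R[i]) - (X l +i* Y l)%C| <= e.
  exact: (@cvgrPdist_le R[i] (R[i]^o : normedModType R[i])).
have E l : `|((x +i* y)%C : R[i]) - (X l +i* Y l)%C| = (normc ((x - X l) +i* (y - Y l))%C)%:C%C by [].
split=> [/P.1 H|[/cvgy_ex HX /cvgy_ex HY]].
  have {}H (e : R) : 0 < e ->
      exists2 A : R, 0 < A & forall l, A <= l -> normc ((x - X l) +i* (y - Y l))%C <= e.
    move=> e0; have e0' : 0 < (e%:C)%C :> R[i] by rewrite ltcR.
    by have /neary_ex[A A0 HA] := H _ e0'; exists A => // l /HA; rewrite E lecR.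
  split; apply/cvgy_ex => e e0; have [A A0 HA] := H e e0; exists A => // l Al.
    by rewrite distrC; apply: le_trans (HA l Al); exact: ler_Re_normc.
  by rewrite distrC; apply: le_trans (HA l Al); exact: ler_Im_normc.
apply: P.2 => -[e e'] H; move: (H); rewrite ltcE /= => /andP[/eqP e'0 e0].
rewrite e'0; have e20 : 0 < e / 2 by rewrite divr_gt0.
have [A A0 HA] := HX _ e20; have [B B0 HB] := HY _ e20.
apply/neary_ex; exists (A + B); first exact: addr_gt0.
move=> l Al; rewrite E lecR; apply: le_trans (normc_le _ _) _.
have HA' : `|X l - x| <= e / 2 by apply: HA; lra.
have HB' : `|Y l - y| <= e / 2 by apply: HB; lra.
by rewrite distrC [`|y - _|]distrC; lra.
Qed.

End complex_limits.

Section complex_arith.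
Context {R : realType}.
Implicit Types (a b r : R) (z : R[i]).

Lemma mul_realC r a b : r%:C%C * (a +i* b)%C = (r * a +i* (r * b))%C.
Proof.
have -> : r%:C%C * (a +i* b)%C = ((r * a - 0 * b) +i* (r * b + 0 * a))%C by [].
by rewrite !mul0r subr0 addr0.
Qed.

Lemma mulCreal z r : z * r%:C%C = (complex.Re z * r +i* (complex.Im z * r))%C.
Proof. by case: z => a b; rewrite mulrC mul_realC ![r * _]mulrC. Qed.

Lemma divCreal a b r : (a +i* b)%C / r%:C%C = ((a / r) +i* (b / r))%C.
Proof. by rewrite -fmorphV mulrC mul_realC ![r^-1 * _]mulrC. Qed.

Lemma realCM a b : (a * b)%:C%C = a%:C%C * b%:C%C :> R[i]. Proof. exact: rmorphM. Qed.
Lemma realCV a : (a^-1)%:C%C = (a%:C%C)^-1 :> R[i]. Proof. exact: fmorphV. Qed.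
Lemma realC_eq0 a : (a%:C%C == 0 :> R[i]) = (a == 0).
Proof. by rewrite eq_complex /= eqxx andbT. Qed.

Lemma complexEta z : z = (complex.Re z +i* complex.Im z)%C.
Proof. by case: z. Qed.

Lemma sum_complex m (X Y : nat -> R) :
  \sum_(n < m) (X n +i* Y n)%C = ((\sum_(n < m) X n) +i* (\sum_(n < m) Y n))%C.
Proof. by elim: m => [|m IH]; rewrite ?big_ord0 // !big_ord_recr /= IH. Qed.

Lemma natC n : n%:R = n%:R%:C%C :> R[i].
Proof. by rewrite rmorph_nat. Qed.

End complex_arith.

Section complex_testfun.
Context {R : realType} (M : nat -> R) (s : ultraclass).
Hypothesis hM : weight_sequence M.
Local Notation normc := (@ComplexField.Normc.normc R).
Local Notation tf := (tf M s).
Local Notation tfam := (tfam M s).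
Implicit Types (u v : R -> R) (phi : R -> R[i]) (x l : R).

Definition cembed u x : R[i] := (u x)%:C%C.

Lemma cderivn_cembed n u x : cderivn n (cembed u) x = (derive1n n u x)%:C%C.
Proof. by rewrite /cderivn /= derive1n_cst; case: n. Qed.

Lemma ultranorm_cembed K h u C : 0 < h -> (forall p x, `|derive1n p u x| <= C * (h ^+ p * M p)) ->
  (ultranorm M K h (cembed u) <= C%:E)%E.
Proof.
move=> h0 uC; apply: ge_ereal_sup => _ [x Kx [p _ <-]].
rewrite cderivn_cembed normc_real lee_fin ler_pdivrMr //.
by rewrite mulr_gt0 ?exprn_gt0 ?(weight_gt0 hM).
Qed.

Lemma testfun_cembed (Omega K : set R) u : tf u -> compact K -> K `<=` Omega ->
  (forall x, ~ K x -> u x = 0) -> testfun s M Omega (cembed u).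
Proof.
move=> tu cK KO uK; split; last first.
  by exists K; split => // x nKx; rewrite /cembed uK.
have su := tf_smooth tu; have [_ _ bu] := tu; split.
  by move=> n x _ /=; split; [exact: su|exact: (@smooth_cst R 0)].
have H K' h : 0 < h -> (exists2 C, 0 <= C & forall (_ : unit) p x, [set: R] x ->
    `|derive1n p u x| <= C * (h ^+ p * M p)) -> (ultranorm M K' h (cembed u) < +oo)%E.
  move=> h0 [C C0 HC]; apply: le_lt_trans (ltry C); apply: ultranorm_cembed => // p x.
  exact: (HC tt).
move=> K' _ _; move: bu; rewrite /bfam /forh; case: (s) => [bu h h0|[h h0 bu]].
  by apply: H => //; exact: bu.
by exists h => //; exact: H.
Qed.

(** The class bounds are read on one ball containing the support and extend to the line because all
    derivatives vanish outside it. *)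
Lemma testfun_tf phi : testfun s M setT phi ->
  tf (fun x => complex.Re (phi x)) /\ tf (fun x => complex.Im (phi x)).
Proof.
move=> [[sphi bphi] [K [cK _ phiK]]].
have [r r0 Kr] : exists2 r : R, 0 < r & forall x, K x -> `|x| <= r.
  have := compact_bounded cK; case=> N [_ HN].
  exists (`|N| + 1); first by rewrite ltr_wpDl.
  by move=> x Kx; apply: (HN (`|N| + 1)) => //; have := ler_norm N; lra.
have phir x : r < `|x| -> phi x = 0.
  by move=> rx; apply: phiK => /Kr; rewrite leNgt rx.
have H (g : R -> R) : (forall n x, derivable (derive1n n g) x 1) ->
    (forall n x, `|derive1n n g x| <= normc (cderivn n phi x)) ->
    (forall x, phi x = 0 -> g x = 0) -> tf g.
  move=> sg gphi g0; have gr x : r < `|x| -> g x = 0 by move=> /phir /g0.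
  split; [by move=> _; exact: sg|by exists r => // _; exact: gr|].
  pose K' : set R := [set x | `|x| <= r].
  have cK' : compact K'.
    have -> : K' = `[- r, r]%classic.
      by apply/seteqP; split => x; rewrite /K' /= in_itv /= ler_norml.
    exact: segment_compact.
  have E h : 0 < h -> (ultranorm M K' h phi < +oo)%E ->
      exists2 C, 0 <= C & forall (_ : unit) p x, [set: R] x -> `|derive1n p g x| <= C * (h ^+ p * M p).
    move=> h0 lty; have hp p : 0 < h ^+ p * M p by rewrite mulr_gt0 ?exprn_gt0 ?(weight_gt0 hM).
    have ub x p : K' x -> ((normc (cderivn p phi x) / (h ^+ p * M p))%:E <= ultranorm M K' h phi)%E.
      by move=> Kx; apply: ereal_sup_ubound; exists x => //; exists p.
    have [C UC] : exists C, ultranorm M K' h phi = C%:E.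
      have /= := ub 0 0%N; rewrite /K' /= normr0 => /(_ (ltW r0)).
      by move: lty; case: (ultranorm _ _ _ _) => [C _ _|//|//]; exists C.
    have C0 : 0 <= C.
      have := ub 0 0%N; rewrite UC /K' /= normr0 => /(_ (ltW r0)); rewrite lee_fin.
      by apply: le_trans; rewrite divr_ge0 ?normc_ge0 // ltW.
    exists C => // _ p x _; have [xr|rx] := leP `|x| r.
      by have := ub x p xr; rewrite UC lee_fin ler_pdivrMr //; apply: le_trans.
    by rewrite (derive1n_out p gr rx) normr0 mulr_ge0 // ltW.
  rewrite /bfam /forh; case: (s) bphi => bphi.
    by move=> h h0; apply: E => //; exact: bphi.
  by have [h h0 Hh] := bphi K' cK' (@subsetT _ _); exists h => //; exact: E.
split; apply: H => [n x|n x|x ->].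
- by have [] := sphi n x I.
- exact: ler_Re_normc.
- by [].
- by have [] := sphi n x I.
- exact: ler_Im_normc.
- by [].
Qed.

Variable f : functional R.
Hypothesis hf : ultradistribution s M setT f.

(** Real-linear parts of [f] on real functions. For phi = u + i v the value f phi has real part re u
    - im v and imaginary part im u + re v. *)
Definition re_part u : R := complex.Re (f (cembed u)).
Definition im_part u : R := complex.Im (f (cembed u)).

Lemma cembed_lin a u v : cembed (fun x => a * u x + v x) = (fun x => a%:C%C * cembed u x + cembed v x).
Proof. by apply/funext => x; rewrite /cembed rmorphD rmorphM. Qed.

Lemma tf_testfun u : tf u -> testfun s M setT (cembed u).
Proof.
move=> tu; have [r r0 ur] := tf_supp tu.
apply: (testfun_cembed tu (@segment_compact _ (- r) r)) => // x.
rewrite /= in_itv /= -ler_norml => /negP; rewrite -ltNge; exact: ur.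
Qed.

(** A neighbourhood on which |f| < 1 contains a ball of radius e for the norm of the step holding
    the family. Scaling by a common t puts all members in it, so |f| <= 1/t. *)
Lemma parts_bounded (I : Type) (u : I -> R -> R) : tfam u ->
  exists B, forall i, normc (f (cembed (u i))) <= B.
Proof.
move=> tu; have [flin fcont] := hf; have [_ [r r0 ur] bu] := tu.
have [V [_ nV] fV] := fcont 1 ltr01.
pose K : set R := `[- r, r]%classic.
have cK : compact K by exact: segment_compact.
have supp i : supp_in K (cembed (u i)).
  move=> x; rewrite /K /= in_itv /= -ler_norml => /negP; rewrite -ltNge => rx.
  by rewrite /cembed ur.
have tc i : testfun s M setT (cembed (u i)) by apply: tf_testfun; exact: tfam_tf tu.
have H h : 0 < h -> (exists2 C, 0 <= C & forall i p x, [set: R] x -> `|derive1n p (u i) x| <= C * (h ^+ p * M p)) ->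
    (exists2 e : R, 0 < e & forall phi, testfun s M setT phi -> supp_in K phi ->
      (ultranorm M K h phi < e%:E)%E -> V phi) ->
    exists B, forall i, normc (f (cembed (u i))) <= B.
  move=> h0 [C C0 HC] [e e0 He].
  pose t := e / (C + 1); have t0 : 0 < t by rewrite divr_gt0 // ltr_wpDl.
  exists t^-1 => i.
  have tui : tf (fun x => t * u i x + 0 * u i x) by apply: tf_lin => //; exact: tfam_tf tu.
  have {}tui : tf (fun x => t * u i x).
    by move: tui; congr tf; apply/funext => x; rewrite mul0r addr0.
  have Vt : V (cembed (fun x => t * u i x)).
    apply: He; first exact: tf_testfun.
      by move=> x Kx; rewrite /cembed; have := supp i x Kx; rewrite /cembed => -[->]; rewrite mulr0.
    apply: (@le_lt_trans _ _ (t * C)%:E); last first.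
      by rewrite lte_fin /t mulrAC ltr_pdivrMr ?ltr_wpDl // ltr_pM2l // ltrDl.
    apply: ultranorm_cembed => // p x.
    have := @derive1n_lin R t 0 (u i) (u i) p (tf_smooth (tfam_tf i tu)) (tf_smooth (tfam_tf i tu)).
    have -> : (fun x => t * u i x + 0 * u i x) = (fun x => t * u i x).
      by apply/funext => y; rewrite mul0r addr0.
    move=> ->; rewrite mul0r addr0 normrM (gtr0_norm t0) -[t * C * _]mulrA ler_pM2l //.
    exact: HC.
  have := fV _ (tf_testfun tui) Vt.
  have -> : f (cembed (fun x => t * u i x)) = t%:C%C * f (cembed (u i)).
    (* Homogeneity extracted from linearity in the form a u + v, with a = t - 1 and both functions
       equal. *)
    have := flin (t - 1)%:C%C _ _ (tc i) (tc i).
    rewrite -cembed_lin; have -> : (fun x => (t - 1) * u i x + u i x) = (fun x => t * u i x).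
      by apply/funext => x; ring.
    by move=> ->; rewrite rmorphB rmorph1 mulrBl mul1r subrK.
  rewrite ComplexField.Normc.normcM normc_real (gtr0_norm t0) => /ltW.
  by rewrite mulrC -ler_pdivlMr // div1r.
move: bu (nV _ cK (@subsetT _ _)) H; rewrite /nbhs0_step /bfam /forh.
case: (s) => [bu [h h0 nb]|[h h0 bu] nb] H.
  by apply: (H h) => //; exact: bu.
by apply: (H h) => //; exact: nb.
Qed.

Lemma parts_ufunc : ufunc M s re_part /\ ufunc M s im_part.
Proof.
have [flin _] := hf.
have E a u v : tf u -> tf v -> f (cembed (fun x => a * u x + v x)) = a%:C%C * f (cembed u) + f (cembed v).
  by move=> tu tv; rewrite cembed_lin flin //; exact: tf_testfun.
split; split.
- move=> a u v tu tv; rewrite /re_part E // (complexEta (f (cembed u))) mul_realC.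
  by case: (f (cembed v)).
- move=> I u tu; have [B HB] := parts_bounded tu; exists B => i.
  by apply: le_trans (HB i); rewrite /re_part; case: (f _) => a b; exact: ler_Re_normc.
- move=> a u v tu tv; rewrite /im_part E // (complexEta (f (cembed u))) mul_realC.
  by case: (f (cembed v)).
- move=> I u tu; have [B HB] := parts_bounded tu; exists B => i.
  by apply: le_trans (HB i); rewrite /im_part; case: (f _) => a b; exact: ler_Im_normc.
Qed.

Lemma pos_powerE beta phi : pos_power beta phi =
  (half_moment (beta + 1) (fun x => complex.Re (phi x)) +i*
   half_moment (beta + 1) (fun x => complex.Im (phi x)))%C.
Proof.
rewrite /pos_power /cintegral /half_moment addrK.
by congr (_ +i* _)%C; apply: eq_Rintegral => x _; rewrite {1}(complexEta (phi x)) mul_realC.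
Qed.

Variables (L : R -> R) (alpha : R) (c : R[i]).
Hypothesis hL : slowly_varying L.
Hypothesis hsupp : supported_in s M `[0, +oo[ f.
Hypothesis hqa : quasiasymptotic s M `]0, +oo[ (dilate f) alpha L (scaled c (pos_power alpha)).

Let G l := l * (l `^ alpha * L l).

Lemma pos_power_cembed u : pos_power alpha (cembed u) = (half_moment (alpha + 1) u)%:C%C.
Proof.
rewrite pos_powerE /=; congr (_ +i* _)%C; rewrite /half_moment.
by under eq_Rintegral do rewrite mulr0; rewrite /Rintegral integral0.
Qed.

Lemma parts_half_limit u d : tf u -> 0 < d -> (forall x, x <= d -> u x = 0) ->
  (fun l => re_part (fun x => u (x / l)) / G l) @ +oo --> complex.Re c * half_moment (alpha + 1) u /\
  (fun l => im_part (fun x => u (x / l)) / G l) @ +oo --> complex.Im c * half_moment (alpha + 1) u.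
Proof.
move=> tu d0 ud; have [r r0 ur] := tf_supp tu.
have tc : testfun s M `]0, +oo[ (cembed u).
  apply: (testfun_cembed tu (@segment_compact _ d r)) => [x|x].
    by rewrite /= !in_itv /= andbT => /andP[dx _]; exact: lt_le_trans dx.
  rewrite /= in_itv /= => /negP; rewrite negb_and -!ltNge => /orP[/ltW /ud//|rx].
  by apply: ur; apply: lt_le_trans rx (ler_norm x).
have := hqa tc; rewrite /scaled pos_power_cembed.
set I := half_moment _ u.
have -> : c * I%:C%C = (complex.Re c * I +i* (complex.Im c * I))%C.
  by rewrite mulrC {1}(complexEta c) mul_realC ![I * _]mulrC.
rewrite -[X in X -> _]/(_ --> _).
have -> : (fun l => dilate f l (cembed u) / (l `^ alpha * L l)%:C%C) =
   (fun l => (re_part (fun x => u (x / l)) / G l +i* (im_part (fun x => u (x / l)) / G l))%C).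
  apply/funext => l; rewrite /dilate (complexEta (f _)) mul_realC divCreal /G !invfM.
  by congr (_ +i* _)%C; rewrite [l^-1 * _]mulrC -mulrA.
by move/cvgy_complexP.
Qed.

Lemma parts_half_quasiasymptotic :
  half_quasiasymptotic M s re_part G (alpha + 1) (complex.Re c) /\
  half_quasiasymptotic M s im_part G (alpha + 1) (complex.Im c).
Proof.
have [u1 u2] := parts_ufunc.
have supp u d : tf u -> 0 < d -> (forall x, - d <= x -> u x = 0) -> f (cembed u) = 0.
  move=> tu d0 ud; have [r r0 ur] := tf_supp tu; apply: hsupp.
  apply: (testfun_cembed tu (@segment_compact _ (- r) (- d))) => [x|x].
    by rewrite /= !in_itv /= andbT => /andP[_ xd] x0; lra.
  rewrite /= in_itv /= => /negP; rewrite negb_and -!ltNge => /orP[xr|/ltW /ud//].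
  by apply: ur; rewrite ltr0_norm; lra.
have hG := slowly_varying_regvar alpha hL.
split; split => // u d tu d0 ud.
- by rewrite /re_part (supp u d).
- by have [] := parts_half_limit tu d0 ud.
- by rewrite /im_part (supp u d).
- by have [] := parts_half_limit tu d0 ud.
Qed.

End complex_testfun.

Lemma cvgy_eqC (R : realType) (F H : R -> R[i]) (z : R[i]) :
  (exists X, forall l, X <= l -> F l = H l) ->
  (F @ +oo --> (z : R[i]^o)) -> (H @ +oo --> (z : R[i]^o)).
Proof.
move=> [X HX]; apply: cvg_trans; apply: near_eq_cvg.
by exists X; split; [exact: num_real|move=> x /ltW /HX].
Qed.

Lemma cvgy_subC (R : realType) (F : R -> R[i]) (z : R[i]) :
  (F @ +oo --> (z : R[i]^o)) -> ((fun l => F l - z) @ +oo --> (0 : R[i]^o)).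
Proof.
have P (H : R -> R[i]) (w : R[i]) : (H @ +oo --> (w : R[i]^o)) <->
    forall e : R[i], 0 < e -> \forall l \near +oo, `|w - H l| <= e.
  exact: (@cvgrPdist_le R[i] (R[i]^o : normedModType R[i])).
move/P => H; apply/P => e /H; apply: filterS => l.
by rewrite sub0r opprB.
Qed.

(** * Complex test functions and the three ranges of alpha *)

Section complex_expansion.
Context {R : realType} (M : nat -> R) (s : ultraclass) (L : R -> R) (alpha : R).
Variables (c : R[i]) (f : functional R).
Hypotheses (hM : weight_sequence M) (hL : slowly_varying L)
  (hf : ultradistribution s M setT f) (hsupp : supported_in s M `[0, +oo[ f)
  (hqa : quasiasymptotic s M `]0, +oo[ (dilate f) alpha L (scaled c (pos_power alpha))).
Implicit Types (u v : R -> R) (phi : R -> R[i]) (x l : R) (m n : nat).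

Variable chi : R -> R.
Hypothesis tchi : tf M s chi.
Hypothesis chi1 : forall x, `|x| <= 1 -> chi x = 1.
Hypothesis chi2 : forall x, 2 <= `|x| -> chi x = 0.

Definition cpair (F : (R -> R) -> R) phi : R[i] :=
  (F (fun x => complex.Re (phi x)) +i* F (fun x => complex.Im (phi x)))%C.

(** The limit functional on real functions, a regularized integral of x^alpha u. It is identified
    below with x_+^alpha, or with the finite part up to a multiple of a delta derivative. *)
Definition regular_moment m u := half_moment (alpha + 1) (fun x => taylor_cut chi m u x -
  \sum_(n < m | alpha + 1 + n%:R < 0) taylor_coef u n * (x ^+ n * (1 - chi x))).

Definition cmoment n l : R[i] := (moment (re_part f) chi n l +i* moment (im_part f) chi n l)%C.

Let G l := l * (l `^ alpha * L l).

(** Four real expansions, of the two parts of [f] on the two parts of phi, combine by the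
    multiplication rule of complex numbers into the factor [c]. *)
Lemma complex_expansion m : 0 < alpha + 1 + m%:R -> exists A : nat -> R[i],
  forall phi, testfun s M setT phi ->
  (fun l => (f (fun x => phi (x / l)) - \sum_(n < m) cderivn n phi 0 / n`!%:R *
      ((if alpha + 1 + n%:R < 0 then A n else cmoment n l) / (l ^+ n)%:C%C)) / (G l)%:C%C)
    @ +oo --> (c * cpair (regular_moment m) phi : R[i]^o).
Proof.
move=> gm; have [h1 h2] := parts_half_quasiasymptotic hM hf hL hsupp hqa.
have [A1 HA1] := expansion_constants hM tchi chi1 chi2 h1 gm.
have [A2 HA2] := expansion_constants hM tchi chi1 chi2 h2 gm.
exists (fun n => (A1 n +i* A2 n)%C) => phi tphi.
have [tu tv] := testfun_tf hM tphi.
set u := (fun x => complex.Re (phi x)) in tu; set v := (fun x => complex.Im (phi x)) in tv.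
pose S1 n l := if alpha + 1 + n%:R < 0 then A1 n else moment (re_part f) chi n l.
pose S2 n l := if alpha + 1 + n%:R < 0 then A2 n else moment (im_part f) chi n l.
pose E1 w l := (re_part f (fun x => w (x / l)) - \sum_(n < m) taylor_coef w n * (S1 n l / l ^+ n)) / G l.
pose E2 w l := (im_part f (fun x => w (x / l)) - \sum_(n < m) taylor_coef w n * (S2 n l / l ^+ n)) / G l.
have lim1 w : tf M s w -> E1 w @ +oo --> complex.Re c * regular_moment m w by exact: HA1.
have lim2 w : tf M s w -> E2 w @ +oo --> complex.Im c * regular_moment m w by exact: HA2.
have H : (fun l => ((E1 u l - E2 v l) +i* (E1 v l + E2 u l))%C) @ +oo -->
    (c * cpair (regular_moment m) phi : R[i]^o).
  have -> : c * cpair (regular_moment m) phi =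
      ((complex.Re c * regular_moment m u - complex.Im c * regular_moment m v) +i*
       (complex.Re c * regular_moment m v + complex.Im c * regular_moment m u))%C.
    by rewrite {1}(complexEta c).
  apply/cvgy_complexP; split; last exact: cvgyD (lim1 _ tv) (lim2 _ tu).
  by apply: cvgB; [exact: lim1|exact: lim2].
apply: cvgy_eqC H; exists 1 => l l1; have l0 : 0 < l by exact: lt_le_trans l1.
have [flin _] := hf.
have -> : f (fun x => phi (x / l)) =
   ((re_part f (fun x => u (x / l)) - im_part f (fun x => v (x / l))) +i*
    (im_part f (fun x => u (x / l)) + re_part f (fun x => v (x / l))))%C.
  have -> : (fun x => phi (x / l)) =
      (fun x => 'i%C * cembed (fun x => v (x / l)) x + cembed (fun x => u (x / l)) x).
    by apply/funext => x; rewrite /cembed /u /v {1}[phi _]complexE addrC.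
  rewrite flin; last 2 first.
  - by apply: (tf_testfun hM); exact: (tf_scale l0 tv).
  - by apply: (tf_testfun hM); exact: (tf_scale l0 tu).
  rewrite /re_part /im_part; case: (f _) => a b; case: (f _) => a' b' /=.
  by congr (_ +i* _)%C; ring.
have term n : cderivn n phi 0 / n`!%:R *
    ((if alpha + 1 + n%:R < 0 then (A1 n +i* A2 n)%C else cmoment n l) / (l ^+ n)%:C%C) =
  ((taylor_coef u n * (S1 n l / l ^+ n) - taylor_coef v n * (S2 n l / l ^+ n)) +i*
   (taylor_coef u n * (S2 n l / l ^+ n) + taylor_coef v n * (S1 n l / l ^+ n)))%C.
  have -> : (if alpha + 1 + n%:R < 0 then (A1 n +i* A2 n)%C else cmoment n l) = (S1 n l +i* S2 n l)%C.
    by rewrite /S1 /S2; case: ifP.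
  by rewrite natC /cderivn !divCreal.
under eq_bigr do rewrite term.
rewrite (sum_complex m (fun n => taylor_coef u n * (S1 n l / l ^+ n) - taylor_coef v n * (S2 n l / l ^+ n))
  (fun n => taylor_coef u n * (S2 n l / l ^+ n) + taylor_coef v n * (S1 n l / l ^+ n))).
rewrite sumrB big_split /=.
set s1 := \sum_(_ < _) _; set s2 := \sum_(_ < _) _; set s3 := \sum_(_ < _) _; set s4 := \sum_(_ < _) _.
set z1 := (_ - im_part _ _); set z2 := (_ + re_part _ _).
rewrite -[(z1 +i* z2)%C - _]/((z1 - (s1 - s2)) +i* (z2 - (s3 + s4)))%C divCreal.
by congr (_ +i* _)%C; rewrite /E1 /E2 /z1 /z2 -/s1 -/s2 -/s3 -/s4; ring.
Qed.

Lemma dilate_divE l phi z : (dilate f l phi - l^-1%:C%C * z) / (l `^ alpha * L l)%:C%C =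
  (f (fun x => phi (x / l)) - z) / (G l)%:C%C.
Proof. by rewrite /dilate -mulrBr /G [in RHS]realCM realCV [in RHS]invfM mulrCA mulrA. Qed.

Lemma signC n : (-1) ^+ n = ((-1) ^+ n)%:C%C :> R[i].
Proof. by rewrite rmorphXn rmorphN rmorph1. Qed.

Lemma signCK n (z : R[i]) : (-1) ^+ n * ((-1) ^+ n * z) = z.
Proof. by rewrite mulrA -exprMn mulrNN mulr1 expr1n mul1r. Qed.

Lemma xplus_regular_moment0 phi : -1 < alpha -> xplus alpha phi = cpair (regular_moment 0) phi.
Proof.
move=> a1; rewrite /xplus a1 pos_powerE /cpair /regular_moment.
by congr (_ +i* _)%C; congr half_moment; apply/funext => x; rewrite /taylor_cut !big_ord0 !subr0.
Qed.

(** When all subtracted orders have alpha + 1 + n < 0, x^n chi + x^n (1 - chi) = x^n and the cutoff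
    disappears. *)
Lemma regular_moment_taylor_rem N u : (forall n, (n < N)%N -> alpha + 1 + n%:R < 0) ->
  regular_moment N u = half_moment (alpha + 1) (taylor_rem N u).
Proof.
move=> aN; congr half_moment; apply/funext => x.
rewrite /taylor_cut /taylor_rem -addrA -opprD; congr (_ - _).
rewrite [X in _ + X]big_mkcond -big_split; apply: eq_bigr => n _ /=.
by rewrite aN // /chi_power /taylor_coef; ring.
Qed.

Lemma xplus_regular_moment N phi : testfun s M setT phi ->
  - N.+1%:R < alpha -> alpha < - N%:R -> (0 < N)%N ->
  xplus alpha phi = cpair (regular_moment N) phi.
Proof.
move=> tphi a1 a2 N0; have [tu tv] := testfun_tf hM tphi.
have N1 : 1 <= N%:R :> R by rewrite ler1n.
have E u : tf M s u -> regular_moment N u =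
    (-1) ^+ N * (Gamma (alpha + 1) / Gamma (alpha + N%:R + 1)) *
    half_moment (alpha + N%:R + 1) (derive1n N u).
  move=> tw; rewrite regular_moment_taylor_rem => [|n nN]; last first.
    have : n.+1%:R <= N%:R :> R by rewrite ler_nat.
    by rewrite -natr1; lra.
  have a3 := a1; rewrite -natr1 in a3.
  rewrite half_moment_taylor_rem; [|exact: tf_csmooth tw|lra|lra].
  have -> : alpha + 1 + N%:R = alpha + N%:R + 1 by ring.
  by rewrite Gamma_ratio.
rewrite /cpair !E // /xplus ltNge (_ : alpha <= -1) /=; last lra.
have -> : Num.truncn (- alpha) = N by apply: truncn_def; lra.
rewrite /scaled /ddist pos_powerE signC mulrA -rmorphM mul_realC /=.
by congr (_ +i* _)%C; rewrite [in LHS]mulrC mulrC ![_ * (-1) ^+ N]mulrC.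
Qed.

Lemma quasiasymptotic_integrable : -1 < alpha ->
  quasiasymptotic s M setT (dilate f) alpha L (scaled c (xplus alpha)).
Proof.
move=> a1; have g0 : 0 < alpha + 1 + 0%:R by lra.
have [A HA] := complex_expansion g0 => phi tphi.
rewrite /scaled xplus_regular_moment0 //.
apply: cvgy_eqC (HA phi tphi); exists 0 => l _.
by rewrite big_ord0 -dilate_divE mulr0 subr0.
Qed.

Lemma quasiasymptotic_singular N : alpha < -1 -> - N.+1%:R < alpha -> alpha < - N%:R ->
  exists a : 'I_N -> R[i],
    quasiasymptotic s M setT (fun l phi => dilate f l phi -
      \sum_(n < N) a n * (ddist n (@delta R) phi / (l ^+ n.+1)%:C%C))
      alpha L (scaled c (xplus alpha)).
Proof.
move=> a1 aN1 aN; have N0 : (0 < N)%N.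
  by case: N aN1 {aN} => [|//]; lra.
have g0 : 0 < alpha + 1 + N%:R by rewrite -natr1 in aN1; lra.
have [A HA] := complex_expansion g0.
(* 1/n! is the Taylor coefficient, and the sign undoes that of delta^(n) on phi. *)
exists (fun n => (-1) ^+ n * (A n / n`!%:R)) => phi tphi.
rewrite /scaled (@xplus_regular_moment N) //.
apply: cvgy_eqC (HA phi tphi); exists 1 => l l1; rewrite -dilate_divE.
congr ((_ - _) / _); rewrite mulr_sumr; apply: eq_bigr => n _.
have -> : alpha + 1 + n%:R < 0.
  have : n.+1%:R <= N%:R :> R by rewrite ler_nat.
  by rewrite -natr1; lra.
rewrite /ddist /delta exprS realCM invfM realCV.
rewrite -{1}(signCK n (cderivn n phi 0)); set D := (-1) ^+ n * cderivn _ _ _.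
by ring.
Qed.

(** The constant depending on the cutoff that separates the finite part from the regularized
    integral; it is absorbed into [b]. *)
Let P : R := \int[lebesgue_measure]_(x in `]1, +oo[) (chi x / x).

Lemma finite_part_regular_moment k phi : alpha = - k.+1%:R -> testfun s M setT phi ->
  Pf_Hx k.+1 phi = cpair (regular_moment k.+1) phi + cderivn k phi 0 / k`!%:R * P%:C%C.
Proof.
move=> ak tphi; have [tu tv] := testfun_tf hM tphi.
have gk : alpha + 1 = - k%:R by rewrite ak -natr1; ring.
set u := (fun x => complex.Re (phi x)) in tu; set v := (fun x => complex.Im (phi x)) in tv.
have E w : tf M s w -> regular_moment k.+1 w + taylor_coef w k * P =
  \int[lebesgue_measure]_(x in `]0, 1[) (taylor_rem k.+1 w x / x ^+ k.+1) +
  \int[lebesgue_measure]_(x in `]1, +oo[) (w x / x ^+ k.+1) -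
  \sum_(n < k) taylor_coef w n / (k - n)%N%:R.
  by move=> tw; rewrite /regular_moment gk (finite_part_identity hM tchi chi1 k tw) subrK.
rewrite /cpair -/u -/v natC /cderivn divCreal mulCreal.
rewrite -[RHS]/((regular_moment k.+1 u + taylor_coef u k * P) +i*
  (regular_moment k.+1 v + taylor_coef v k * P))%C !E //.
rewrite /Pf_Hx /=.
have -> : \sum_(j < k) cderivn j phi 0 / (j`!%:R * (k.+1 - 1 - j)%N%:R) =
    ((\sum_(n < k) taylor_coef u n / (k - n)%N%:R) +i* (\sum_(n < k) taylor_coef v n / (k - n)%N%:R))%C.
  rewrite -(sum_complex k (fun n => taylor_coef u n / (k - n)%N%:R) (fun n => taylor_coef v n / (k - n)%N%:R)).
  apply: eq_bigr => n _; rewrite subn1 /= !natC -realCM divCreal.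
  by rewrite !invfM !mulrA.
have -> : (fun x => (phi x - \sum_(j < k.+1) cderivn j phi 0 * (x ^+ j / j`!%:R)%:C%C) / (x ^+ k.+1)%:C%C) =
   (fun x => (taylor_rem k.+1 u x / x ^+ k.+1 +i* (taylor_rem k.+1 v x / x ^+ k.+1))%C).
  apply/funext => x; rewrite {1}(complexEta (phi x)).
  have -> : \sum_(j < k.+1) cderivn j phi 0 * (x ^+ j / j`!%:R)%:C%C =
    ((\sum_(j < k.+1) derive1n j u 0 / j`!%:R * x ^+ j) +i* (\sum_(j < k.+1) derive1n j v 0 / j`!%:R * x ^+ j))%C.
    rewrite -(sum_complex k.+1 (fun j => derive1n j u 0 / j`!%:R * x ^+ j) (fun j => derive1n j v 0 / j`!%:R * x ^+ j)).
    by apply: eq_bigr => j _; rewrite mulCreal /=; congr (_ +i* _)%C; ring.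
  by rewrite -divCreal.
have -> : (fun x => phi x / (x ^+ k.+1)%:C%C) = (fun x => (u x / x ^+ k.+1 +i* (v x / x ^+ k.+1))%C).
  by apply/funext => x; rewrite (complexEta (phi x)) divCreal.
by [].
Qed.

Lemma powR_negative_integer k l : alpha = - k.+1%:R -> 0 < l -> l `^ alpha * L l = L l / l ^+ k.+1.
Proof. by move=> -> l0; rewrite powRN powR_mulrn ?ltW // mulrC. Qed.

(** Correcting the moment by a multiple of [L] does not disturb the logarithmic relation, because
    L(a x) / L(x) - 1 tends to 0. *)
Lemma slow_log_defect k (F : R -> R) (d a : R) : alpha = - k.+1%:R -> 0 < a ->
  (fun l => (F (a * l) - F l) / (l ^+ k * G l)) @ +oo --> d * ln a ->
  (fun x => (F (a * x) - F x) / L x - d * P * (L (a * x) / L x - 1) - d * ln a) @ +oo --> 0.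
Proof.
move=> ak a0 HF; have [_ _ L1] := hL.
have HF' : (fun x => (F (a * x) - F x) / L x) @ +oo --> d * ln a.
  apply: cvgy_eq HF; exists 1 => l l1; have l0 : 0 < l by exact: lt_le_trans l1.
  rewrite /G (powR_negative_integer ak l0) exprS.
  by congr (_ / _); field; rewrite ?expf_neq0 ?gt_eqF.
have HL : (fun x => d * P * (L (a * x) / L x - 1)) @ +oo --> 0.
  have -> : 0 = d * P * (1 - 1) by rewrite subrr mulr0.
  apply: cvgy_scale.
  by apply: cvgB; [exact: L1|exact: cvg_cst].
have -> : 0 = d * ln a - 0 - d * ln a by rewrite subr0 subrr.
by apply: cvgB; [exact: cvgB|exact: cvg_cst].
Qed.

Lemma quasiasymptotic_negative_integer k : alpha = - k.+1%:R ->
  exists b : R -> R[i],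
    (forall a : R, 0 < a ->
       (b (a * x) - (b x + c * ((-1) ^+ k / k`!%:R) * (L x * ln a)%:C%C)) / (L x)%:C%C
         @[x --> +oo] --> (0 : R[i]^o)) /\
    exists a : 'I_k.+1 -> R[i],
      littleo_dual s M
        (fun l phi => dilate f l phi
           - (c * (L l / l ^+ k.+1)%:C%C * Pf_Hx k.+1 phi
              + b l / (l ^+ k.+1)%:C%C * ddist k (@delta R) phi
              + \sum_(j < k.+1) a j * (ddist j (@delta R) phi / (l ^+ j.+1)%:C%C)))
        (fun l => L l / l ^+ k.+1).
Proof.
move=> ak.
have gk : alpha + 1 = - k%:R by rewrite ak -natr1; ring.
have g0 : 0 < alpha + 1 + k.+1%:R by rewrite gk -natr1; lra.
have [A HA] := complex_expansion g0.
(* The factor (-1)^k / k! turns the k-th Taylor coefficient into delta^(k); the term c P L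
   compensates the excess of the finite part over the regular moment. *)
pose b l : R[i] := (-1) ^+ k / k`!%:R * (cmoment k l - c * (P * L l)%:C%C).
have [h1 h2] := parts_half_quasiasymptotic hM hf hL hsupp hqa.
have gk0 : alpha + 1 + k%:R = 0 by rewrite gk addNr.
have [_ Lpos _] := hL.
exists b; split.
  move=> a a0; pose e : R := (-1) ^+ k / k`!%:R.
  have eC : (-1) ^+ k / k`!%:R = e%:C%C :> R[i] by rewrite signC natC -realCV -realCM.
  pose F1 := moment (re_part f) chi k; pose F2 := moment (im_part f) chi k.
  pose D F d x := (F (a * x) - F x) / L x - d * P * (L (a * x) / L x - 1) - d * ln a.
  have D1 : (fun x => e * D F1 (complex.Re c) x) @ +oo --> 0.
    rewrite -(mulr0 e); apply: cvgy_scale; apply: (slow_log_defect ak a0).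
    exact: (moment_log hM tchi chi1 chi2 h1 gk0 a0).
  have D2 : (fun x => e * D F2 (complex.Im c) x) @ +oo --> 0.
    rewrite -(mulr0 e); apply: cvgy_scale; apply: (slow_log_defect ak a0).
    exact: (moment_log hM tchi chi1 chi2 h2 gk0 a0).
  apply: cvgy_eqC ((cvgy_complexP _ _ 0 0).2 (conj D1 D2)).
  have [X X0 HX] := proj1 (neary_ex _) Lpos; exists X => x Xx.
  have Lx : L x != 0 by rewrite gt_eqF // HX.
  have bE y : b y = ((e * (F1 y - complex.Re c * (P * L y))) +i* (e * (F2 y - complex.Im c * (P * L y))))%C.
    by rewrite /b eC [c * _]mulCreal mul_realC.
  rewrite !bE eC -mulrA -realCM mulCreal.
  have CS (x1 y1 x2 y2 x3 y3 : R) : (x1 +i* y1)%C - ((x2 +i* y2)%C + (x3 +i* y3)%C) =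
    ((x1 - (x2 + x3)) +i* (y1 - (y2 + y3)))%C by [].
  rewrite CS divCreal.
  by congr (_ +i* _)%C; rewrite /D; field.
(* The coefficient of the top order k is 0: that derivative of delta is already carried by [b]. *)
exists (fun j => if (j < k)%N then (-1) ^+ j * (A j / j`!%:R) else 0) => phi tphi.
have H : (fun l => (f (fun x => phi (x / l)) - \sum_(n < k.+1) cderivn n phi 0 / n`!%:R *
      ((if alpha + 1 + n%:R < 0 then A n else cmoment n l) / (l ^+ n)%:C%C)) / (G l)%:C%C - c * cpair (regular_moment k.+1) phi)
    @ +oo --> (0 : R[i]^o).
  exact: cvgy_subC (HA phi tphi).
apply: cvgy_eqC H; have [X X0 HX] := proj1 (neary_ex _) Lpos; exists X => l Xl.
have l0 : 0 < l by exact: lt_le_trans Xl.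
have Ll : L l != 0 by rewrite gt_eqF // HX.
rewrite -dilate_divE (powR_negative_integer ak l0).
set r := (L l / l ^+ k.+1)%:C%C.
have r0 : r != 0 by rewrite /r realC_eq0 mulf_neq0 // invr_eq0 expf_neq0 // gt_eqF.
set Q := cpair _ _; set S := \sum_(n < k.+1) _.
set B := (_ + \sum_(j < k.+1) _).
suff -> : B = l^-1%:C%C * S + c * Q * r by rewrite opprD addrA [in RHS]mulrBl mulfK.
rewrite /B (finite_part_regular_moment ak tphi) -/Q /S !big_ord_recr /=.
rewrite ltnn mul0r addr0 gk0 ltxx.
have -> : \sum_(j < k) (if (j < k)%N then (-1) ^+ j * (A j / j`!%:R) else 0) *
     (ddist j (delta (R:=R)) phi / (l ^+ j.+1)%:C%C) =
   l^-1%:C%C * \sum_(n < k) cderivn n phi 0 / n`!%:R *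
     ((if alpha + 1 + n%:R < 0 then A n else cmoment n l) / (l ^+ n)%:C%C).
  rewrite mulr_sumr; apply: eq_bigr => n _; rewrite ltn_ord.
  have -> : alpha + 1 + n%:R < 0 by rewrite gk addrC subr_lt0 ltr_nat.
  rewrite /ddist /delta exprS realCM invfM realCV.
  rewrite -{2}(signCK n (cderivn n phi 0)); set D := (-1) ^+ n * cderivn _ _ _.
  by ring.
set T := \sum_(n < k) _.
rewrite /ddist /delta /b -{1 3}(signCK k (cderivn k phi 0)); set D := (-1) ^+ k * cderivn k phi 0.
rewrite /r !realCM !realCV exprS realCM; set x := l%:C%C; set y := (l ^+ k)%:C%C.
by rewrite !invfM; ring.
Qed.

End complex_expansion.

Theorem theorem3p7 (R : realType) (M : nat -> R) (s : ultraclass)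
    (L : R -> R) (alpha : R) (c : R[i]) (f : functional R)
    (hM : weight_sequence M)
    (hL : slowly_varying L)
    (hf : ultradistribution s M setT f)
    (hsupp : supported_in s M `[0, +oo[ f)
    (hqa : quasiasymptotic s M `]0, +oo[ (dilate f) alpha L
             (scaled c (pos_power alpha))) :
  [/\ -1 < alpha ->
        quasiasymptotic s M setT (dilate f) alpha L (scaled c (xplus alpha)),
      alpha < -1 ->
      forall N : nat, - (N.+1%:R) < alpha -> alpha < - (N%:R) ->
        exists a : 'I_N -> R[i],
          quasiasymptotic s M setT
            (fun lambda phi => dilate f lambda phi
               - \sum_(n < N) a n * (ddist n (@delta R) phi
                                       / (lambda ^+ n.+1)%:C%C))
            alpha L (scaled c (xplus alpha)) &
      forall k : nat, (1 <= k)%N -> alpha = - (k%:R) ->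
        exists b : R -> R[i],
          (forall a : R, 0 < a ->
             (b (a * x) - (b x + c * ((-1) ^+ k.-1 / (k.-1)`!%:R)
                                   * (L x * ln a)%:C%C)) / (L x)%:C%C
               @[x --> +oo] --> (0 : R[i]^o)) /\
          exists a : 'I_k -> R[i],
            littleo_dual s M
              (fun lambda phi => dilate f lambda phi
                 - (c * (L lambda / lambda ^+ k)%:C%C * Pf_Hx k phi
                    + b lambda / (lambda ^+ k)%:C%C
                        * ddist k.-1 (@delta R) phi
                    + \sum_(j < k) a j * (ddist j (@delta R) phi
                                            / (lambda ^+ j.+1)%:C%C)))
              (fun lambda => L lambda / lambda ^+ k)].
Proof.
have [chi [tchi chi1 chi2]] := cutoff_exists s hM.
split.
- exact: (quasiasymptotic_integrable hM hL hf hsupp hqa tchi chi1 chi2).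
- move=> a1 N aN1 aN.
  exact: (quasiasymptotic_singular hM hL hf hsupp hqa tchi chi1 chi2 a1 aN1 aN).
- move=> [//|k] _ ak.
  exact: (quasiasymptotic_negative_integer hM hL hf hsupp hqa tchi chi1 chi2 ak).
Qed.
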